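(* Let $\mathfrak{g}(\infty)$ be $\mathfrak{o}(\infty)$ or $\mathfrak{sp}(\infty)$. If $I\subset U(\mathfrak{g}(\infty))$ is a locally integrable two-sided ideal, then $I$ is integrable.
   Context: $\mathfrak{g}(2n)$ denotes $\mathfrak{o}(2n)$ or $\mathfrak{sp}(2n)$, realized as $2n\times 2n$ complex matrices $X$ (indices $-n,\dots,-1,1,\dots,n$) with $XF+FX^t=0$ for the antidiagonal matrix $F$ with entries all $1$ (resp. $1$ in rows $-n,\dots,-1$ and $-1$ in rows $1,\dots,n$); $\mathfrak{g}(2n)\subset\mathfrak{g}(2n+2)$ by bordering with zeros and $\mathfrak{g}(\infty)=\varinjlim\mathfrak{g}(2n)$. An ideal $I\subset U(\mathfrak{g}(\infty))$ is locally integrable if for every $n$, $I\cap U(\mathfrak{g}(2n))$ is an intersection of two-sided ideals of finite codimension in $U(\mathfrak{g}(2n))$. A $\mathfrak{g}(\infty)$-module $M$ is integrable if $\dim(U'\cdot m)<\infty$ for all finitely generated subalgebras $U'\subset U(\mathfrak{g}(\infty))$ and $m\in M$; an ideal is integrable if it is the annihilator of an integrable module. *)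

(* Defs.v *)
From HB Require Import structures.
From mathcomp Require Import all_boot all_order all_algebra.
From mathcomp Require Import complex Rstruct.
Set Implicit Arguments. Unset Strict Implicit. Unset Printing Implicit Defensive.
Import Order.TTheory GRing.Theory Num.Theory.
Local Open Scope ring_scope.

Definition C : numClosedFieldType := complex Rdefinitions.R.

(* Row/column k : 'I_(n+n) carries the label -n,...,-1,1,...,n. *)
Definition lab (n : nat) (k : 'I_(n + n)) : int :=
  if (k < n)%N then (k%:Z - n%:Z)%R else (k%:Z - n%:Z + 1)%R.

(* The antidiagonal matrix F: all entries 1 for o(2n) (symp = false);
   1 in rows -n..-1 and -1 in rows 1..n for sp(2n) (symp = true). *)
Definition Fmat (symp : bool) (n : nat) : 'M[C]_(n + n) :=
  \matrix_(i, j) (if lab i + lab j == 0 then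
                    (if symp && (0 < lab i) then -1 else 1) else 0).

Definition gmat (symp : bool) (n : nat) (X : 'M[C]_(n + n)) : Prop :=
  X *m Fmat symp n + Fmat symp n *m X^T = 0.

(* The inclusion g(2n) -> g(2n+2): bordering with zeros. *)
Definition emb (n : nat) (X : 'M[C]_(n + n)) : 'M[C]_(n.+1 + n.+1) :=
  \matrix_(i, j)
    match @insub _ (fun k => (k < n + n)%N) 'I_(n + n) (i : nat).-1,
          @insub _ (fun k => (k < n + n)%N) 'I_(n + n) (j : nat).-1 with
    | Some i', Some j' => if (0 < i)%N && (0 < j)%N then X i' j' else 0
    | _, _ => 0
    end.

(* A compatible family of Lie algebra maps g(2n) -> B (B with commutator),
   i.e. a Lie algebra homomorphism g(infty) = lim g(2n) -> B. *)
Definition lie_family (symp : bool) (B : algType C)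
    (f : forall n, 'M[C]_(n + n) -> B) : Prop :=
  [/\ (forall n (a : C) X Y, gmat symp X -> gmat symp Y ->
         f n (a *: X + Y) = a *: f n X + f n Y),
      (forall n X Y, gmat symp X -> gmat symp Y ->
         f n (X *m Y - Y *m X) = f n X * f n Y - f n Y * f n X) &
      (forall n X, gmat symp X -> f n.+1 (emb X) = f n X)].

Definition alg_morph (A B : algType C) (phi : A -> B) : Prop :=
  [/\ (forall (a : C) x y, phi (a *: x + y) = a *: phi x + phi y),
      phi 1 = 1 & (forall x y, phi (x * y) = phi x * phi y)].

Definition is_univ_env (symp : bool) (A : algType C)
    (iota : forall n, 'M[C]_(n + n) -> A) : Prop :=
  lie_family symp iota /\
  forall (B : algType C) (f : forall n, 'M[C]_(n + n) -> B),
    lie_family symp f ->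
    exists phi : A -> B,
      [/\ alg_morph phi,
          (forall n X, gmat symp X -> phi (iota n X) = f n X) &
          (forall psi : A -> B, alg_morph psi ->
             (forall n X, gmat symp X -> psi (iota n X) = f n X) ->
             forall x, psi x = phi x)].

Definition gen_subalg (A : algType C) (S : A -> Prop) (x : A) : Prop :=
  forall P : A -> Prop,
    P 1 ->
    (forall (a : C) y z, P y -> P z -> P (a *: y + z)) ->
    (forall y z, P y -> P z -> P (y * z)) ->
    (forall y, S y -> P y) -> P x.

(* U(g(2n)) as a subalgebra of U(g(infty)) = A *)
Definition Usub (symp : bool) (A : algType C)
    (iota : forall n, 'M[C]_(n + n) -> A) (n : nat) : A -> Prop :=
  gen_subalg (fun x => exists X, gmat symp X /\ x = iota n X).

Definition in_span (V : lmodType C) (s : seq V) (v : V) : Prop :=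
  exists c : nat -> C, v = \sum_(i < size s) c i *: s`_i.

Definition two_sided_ideal (A : algType C) (I : A -> Prop) : Prop :=
  [/\ I 0, (forall (a : C) x y, I x -> I y -> I (a *: x + y)) &
      (forall u x, I x -> I (u * x) /\ I (x * u))].

Definition fincodim_ideal (A : algType C) (S : A -> Prop) (J : A -> Prop) : Prop :=
  [/\ (forall x, J x -> S x), J 0,
      (forall (a : C) x y, J x -> J y -> J (a *: x + y)),
      (forall u x, S u -> J x -> J (u * x) /\ J (x * u)) &
      exists s : seq A, (forall x, x \in s -> S x) /\
        forall u, S u -> exists j c, J j /\
          u = j + \sum_(i < size s) (c i : C) *: s`_i].

Definition locally_integrable (symp : bool) (A : algType C)
    (iota : forall n, 'M[C]_(n + n) -> A) (I : A -> Prop) : Prop :=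
  forall n, exists Fam : (A -> Prop) -> Prop,
    (forall J, Fam J -> fincodim_ideal (Usub symp iota n) J) /\
    forall x, (Usub symp iota n x /\ I x) <->
              (Usub symp iota n x /\ forall J, Fam J -> J x).

Definition is_module (A : algType C) (M : lmodType C) (act : A -> M -> M) : Prop :=
  [/\ (forall (a : C) x y m, act (a *: x + y) m = a *: act x m + act y m),
      (forall (a : C) x m m', act x (a *: m + m') = a *: act x m + act x m'),
      (forall m, act 1 m = m) &
      (forall x y m, act (x * y) m = act x (act y m))].

Definition integrable_module (A : algType C) (M : lmodType C) (act : A -> M -> M)
  : Prop :=
  forall (s : seq A) (m : M), exists t : seq M,
    forall u, gen_subalg (fun x => x \in s) u -> in_span t (act u m).

Definition integrable_ideal (A : algType C) (I : A -> Prop) : Prop :=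
  exists (M : lmodType C) (act : A -> M -> M),
    [/\ is_module act, integrable_module act &
        forall x, I x <-> (forall m, act x m = 0)].

(* Main.v *)
(** The Lie algebra is spanned by elements [X a b] indexed by pairs of labels, and an injection of the set of
indices into itself induces an endomorphism of the enveloping algebra [A]; every ideal is invariant under these,
since on each [U_k] they are compositions of inner automorphisms. Let [x] lie outside [I]. For every large [m]
a finite-dimensional module of [U_m] annihilated by [I] but not by [x] provides a highest weight functional. The
indices needed to see that [x] acts nontrivially can be bounded independently of [m], so for a fixed [K] there are
weights of [U_(K+M)] with a long run of unused indices. The weights of the functionals killing [I] form a Zariski
closed set, the weights on the run are monotone, and Hilbert's basis theorem yields one weight whose run can be
made constant of any length [r]. The corresponding functionals on [U_(K+r)] kill [I], do not kill the ideal of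
[x], and kill the [N]-th power of the lowest root vector with [N] independent of [r], because the run contributes
trivially to the nilpotency order. Hence [x] lies outside the ideal generated by [I] and the [N]-th powers of the
root vectors. These ideals meet each [U_k] in finite codimension, and the functionals on [A] killing one of them
form an integrable module with annihilator [I]. *)

Require Import Defs.
From HB Require Import structures.
From mathcomp Require Import all_boot all_order all_algebra.
From mathcomp Require Import spectral mxred boolp classical_sets functions.
From mathcomp Require Import zify ring.
Set Implicit Arguments. Unset Strict Implicit. Unset Printing Implicit Defensive.
Import Order.TTheory GRing.Theory Num.Theory.
Local Open Scope ring_scope.
Opaque C.

(** * Spans and ordered words *)

Section Span.
Variable V : lmodType C.

Inductive lspan (S : V -> Prop) : V -> Prop :=
| lspan0 : lspan S 0
| lspan_cons a x y : S x -> lspan S y -> lspan S (a *: x + y).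

Lemma lspan_sub S x : S x -> lspan S x.
Proof. by move=> Sx; rewrite -[x]addr0 -[x]scale1r; apply: lspan_cons => //; apply: lspan0. Qed.

Lemma lspanD S x y : lspan S x -> lspan S y -> lspan S (x + y).
Proof.
elim=> [|a u v Su _ IH] Sy; first by rewrite add0r.
by rewrite -addrA; apply: lspan_cons => //; apply: IH.
Qed.

Lemma lspanZ S a x : lspan S x -> lspan S (a *: x).
Proof.
elim=> [|b u v Su _ IH]; first by rewrite scaler0; apply: lspan0.
by rewrite scalerDr scalerA; apply: lspan_cons.
Qed.

Lemma lspanP S a x y : lspan S x -> lspan S y -> lspan S (a *: x + y).
Proof. by move=> Sx Sy; apply: lspanD => //; apply: lspanZ. Qed.

Lemma lspanN S x : lspan S x -> lspan S (- x).
Proof. by rewrite -scaleN1r; apply: lspanZ. Qed.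

Lemma lspanB S x y : lspan S x -> lspan S y -> lspan S (x - y).
Proof. by move=> Sx /lspanN; apply: lspanD. Qed.

Lemma lspan_bind (S S' : V -> Prop) x :
  (forall z, S z -> lspan S' z) -> lspan S x -> lspan S' x.
Proof.
move=> SS'; elim=> [|a u v /SS' Su _ IH]; first exact: lspan0.
exact: lspanP.
Qed.

Lemma lspan_mono (S S' : V -> Prop) x :
  (forall z, S z -> S' z) -> lspan S x -> lspan S' x.
Proof. by move=> SS'; apply: lspan_bind => z /SS'; apply: lspan_sub. Qed.

Lemma lspan_ind_lin (S P : V -> Prop) x :
  P 0 -> (forall a u v, P u -> P v -> P (a *: u + v)) ->
  (forall z, S z -> P z) -> lspan S x -> P x.
Proof. by move=> P0 PD SP; elim=> // a u v /SP Pu _; apply: PD. Qed.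

End Span.

Lemma lspan_mul (B : algType C) (S S' S'' : B -> Prop) x y :
  (forall u v, S u -> S' v -> lspan S'' (u * v)) ->
  lspan S x -> lspan S' y -> lspan S'' (x * y).
Proof.
move=> h; elim=> [|a u v Su _ IH] S'y; first by rewrite mul0r; apply: lspan0.
rewrite mulrDl -scalerAl; apply: lspanP; last exact: IH.
elim: S'y => [|b u' v' Su' _ IH']; first by rewrite mulr0; apply: lspan0.
by rewrite mulrDr -scalerAr; apply: lspanP => //; apply: h.
Qed.

Section GenSubalg.
Variable B : algType C.
Implicit Types (S P : B -> Prop) (x y : B).

Inductive gsub S : B -> Prop :=
| gsub1 : gsub S 1
| gsub_sub x : S x -> gsub S x
| gsubP a x y : gsub S x -> gsub S y -> gsub S (a *: x + y)
| gsubM x y : gsub S x -> gsub S y -> gsub S (x * y).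

Lemma gen_subalgE S x : gen_subalg S x <-> gsub S x.
Proof.
split=> [h|h P P1 PD PM PS].
- apply: (h (gsub S)); [exact: gsub1 | | exact: gsubM | exact: gsub_sub].
  by move=> a y z; apply: gsubP.
- by elim: h => // [a y z _ Py _ Pz|y z _ Py _ Pz]; [exact: PD | exact: PM].
Qed.

Lemma gsub0 S : gsub S 0.
Proof. by have := gsubP (-1) (gsub1 S) (gsub1 S); rewrite scaleN1r addNr. Qed.
Lemma gsubZ S a x : gsub S x -> gsub S (a *: x).
Proof. by move=> Sx; rewrite -[_ *: _]addr0; apply: gsubP => //; apply: gsub0. Qed.
Lemma gsubD S x y : gsub S x -> gsub S y -> gsub S (x + y).
Proof. by move=> Sx Sy; rewrite -[x]scale1r; apply: gsubP. Qed.
Lemma gsubN S x : gsub S x -> gsub S (- x).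
Proof. by rewrite -scaleN1r; apply: gsubZ. Qed.
Lemma gsubB S x y : gsub S x -> gsub S y -> gsub S (x - y).
Proof. by move=> Sx /gsubN; apply: gsubD. Qed.
Lemma gsubX S x n : gsub S x -> gsub S (x ^+ n).
Proof.
move=> Sx; elim: n => [|n IH]; first by rewrite expr0; apply: gsub1.
by rewrite exprS; apply: gsubM.
Qed.
Lemma gsub_sum S (I : Type) (r : seq I) (Q : pred I) (F : I -> B) :
  (forall i, Q i -> gsub S (F i)) -> gsub S (\sum_(i <- r | Q i) F i).
Proof.
move=> h; refine (big_ind (gsub S) _ _ h); first exact: gsub0.
by move=> x y; apply: gsubD.
Qed.
Lemma gsubMn S x n : gsub S x -> gsub S (x *+ n).
Proof. by move=> Sx; rewrite -scaler_nat; apply: gsubZ. Qed.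
Lemma gsub_bind S S' x :
  (forall z, S z -> gsub S' z) -> gsub S x -> gsub S' x.
Proof.
by move=> h; elim=> //; [exact: gsub1 | move=> a y z _ + _; exact: gsubP | move=> y z _ + _; exact: gsubM].
Qed.
Lemma gsub_lspan S S' x : (forall z, S z -> gsub S' z) -> lspan S x -> gsub S' x.
Proof.
move=> h; apply: lspan_ind_lin => //; first exact: gsub0.
by move=> a u v; apply: gsubP.
Qed.
End GenSubalg.

Ltac gsub_closed := repeat first [ assumption | apply: gsub1 | apply: gsub0 | apply: gsubB | apply: gsubD
  | apply: gsubN | apply: gsubMn | apply: gsubZ | apply: gsubX | apply: gsubM ].

Section Words.
Variables (T : eqType) (B : algType C) (X : T -> B) (D : pred T) (rk : T -> nat).

Lemma sorted_split (c : nat) v : sorted (relpre rk leq) v ->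
  v = [seq s <- v | (rk s < c)%N] ++ [seq s <- v | ~~ (rk s < c)%N].
Proof.
have tr : transitive (relpre rk leq) by move=> x y z; apply: leq_trans.
elim: v => //= s u IH pth; have aps := allP (order_path_min tr pth).
case: ifP => /= st; first by rewrite -IH //; apply: path_sorted pth.
have ge r : r \in u -> ~~ (rk r < c)%N.
  by move=> /aps /= sr; move/negbT: st; rewrite -!leqNgt => /leq_trans; apply.
have -> : [seq s0 <- u | (rk s0 < c)%N] = [::].
  by apply/eqP; rewrite -(negbK (_ == _)) -has_filter -all_predC; apply/allP.
by rewrite /=; congr (_ :: _); symmetry; apply/all_filterP/allP.
Qed.

Definition wprod (w : seq T) : B := \prod_(t <- w) X t.

Lemma wprod_cat w1 w2 : wprod (w1 ++ w2) = wprod w1 * wprod w2.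
Proof. by rewrite /wprod big_cat. Qed.
Lemma wprod_cons t w : wprod (t :: w) = X t * wprod w.
Proof. by rewrite /wprod big_cons. Qed.
Lemma wprod_nil : wprod [::] = 1.
Proof. by rewrite /wprod big_nil. Qed.

Lemma gsub_words x :
  gsub (fun z => exists2 t, D t & z = X t) x <->
  lspan (fun z => exists2 w, all D w & z = wprod w) x.
Proof.
split=> h.
- elim: h => {x} [|_ [t Dt ->]|a y z _ + _|y z _ + _].
  + by apply: lspan_sub; exists [::]; rewrite ?wprod_nil.
  + by apply: lspan_sub; exists [:: t]; rewrite ?/wprod /= ?Dt ?big_seq1.
  + by move=> ? ?; apply: lspanP.
  + apply: lspan_mul => u v [w Dw ->] [w' Dw' ->].
    by apply: lspan_sub; exists (w ++ w'); rewrite ?all_cat ?Dw ?wprod_cat.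
- apply: gsub_lspan h => _ [w Dw ->].
  elim: w Dw => [_|t w IH /= /andP [Dt Dw]]; first by rewrite wprod_nil; apply: gsub1.
  by rewrite wprod_cons; apply: gsubM; [apply: gsub_sub; exists t | apply: IH].
Qed.

Hypothesis brk : forall s t, D s -> D t ->
  lspan (fun z => exists2 r, D r & z = X r) (X s * X t - X t * X s).

Let short d (z : B) := exists w, [/\ all D w, (size w <= d)%N & z = wprod w].
Let sshort d (z : B) :=
  exists w, [/\ all D w, (size w <= d)%N, sorted (relpre rk leq) w & z = wprod w].

Lemma word_commutator t w : D t -> all D w ->
  lspan (short (size w)) (X t * wprod w - wprod w * X t).
Proof.
move=> Dt; elim: w => [_|s w IH /= /andP [Ds Dw]].
  by rewrite wprod_nil mulr1 mul1r subrr; apply: lspan0.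
rewrite wprod_cons.
rewrite (_ : _ - _ = (X t * X s - X s * X t) * wprod w + X s * (X t * wprod w - wprod w * X t)).
  apply: lspanD.
    apply: (lspan_mul (S' := fun z => z = wprod w)) (brk Dt Ds) (lspan_sub _) => //.
    move=> _ _ [r Dr ->] ->; apply: lspan_sub; exists (r :: w).
    by rewrite /= Dr Dw leqnn wprod_cons.
  apply: (lspan_mul (S := fun z => z = X s)) (lspan_sub _) (IH Dw) => //.
  move=> _ _ -> [v [Dv sv ->]]; apply: lspan_sub; exists (s :: v).
  by rewrite /= Ds Dv ltnS sv wprod_cons.
by rewrite mulrBl mulrBr !mulrA addrA subrK.
Qed.

Lemma word_sort d w : all D w -> (size w <= d)%N -> lspan (sshort d) (wprod w).
Proof.
elim: d w => [|d IHd] w Dw sw.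
  by apply: lspan_sub; exists w; split=> //; case: w sw {Dw}.
have low z : lspan (short d) z -> lspan (sshort d.+1) z.
  apply: lspan_bind => _ [v [Dv sv ->]].
  apply: lspan_mono (IHd v Dv sv) => _ [u [Du su srt ->]].
  by exists u; split=> //; apply: leqW.
elim: w Dw sw => [_ _|t w IHw /= /andP [Dt Dw] sw].
  by apply: lspan_sub; exists [::].
have {IHw} : lspan (fun z => exists w, [/\ all D w, (size w <= d)%N, sorted (relpre rk leq) w & z = wprod w]) (wprod w).
  exact: IHd.
rewrite wprod_cons => h; apply: (lspan_mul (S := fun z => z = X t)) (lspan_sub _) h => //.
move=> _ _ -> [v [Dv sv srt ->]].
pose a := [seq s <- v | (rk s < rk t)%N]; pose b := [seq s <- v | ~~ (rk s < rk t)%N].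
have vE : v = a ++ b by apply: sorted_split.
have Da : all D a by apply/allP => r; rewrite mem_filter => /andP [_] /(allP Dv).
have Db : all D b by apply/allP => r; rewrite mem_filter => /andP [_] /(allP Dv).
rewrite (_ : _ * _ = (X t * wprod a - wprod a * X t) * wprod b + wprod (a ++ t :: b)).
  apply: lspanD.
    apply: low; apply: (lspan_mul (S' := fun z => z = wprod b)) (word_commutator Dt Da) (lspan_sub _) => //.
    move=> _ _ [u [Du su ->]] ->; apply: lspan_sub; exists (u ++ b).
    rewrite all_cat Du Db wprod_cat size_cat; split=> //.
    by apply: leq_trans sv; rewrite [in X in (_ <= X)%N]vE size_cat leq_add2r.
  apply: lspan_sub; exists (a ++ t :: b); split=> //.
  - by rewrite all_cat /= Da Dt Db.
  - by rewrite size_cat /= addnS -size_cat -vE ltnS.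
  - move: srt; rewrite [in X in X -> _]vE.
    have tr : transitive (relpre rk leq) by move=> x y z; apply: leq_trans.
    rewrite !(sorted_pairwise tr) !pairwise_cat /= => /and3P [ab pa pb].
    rewrite pa pb /= !andbT; apply/andP; split; last first.
      by apply/allP => r; rewrite mem_filter /= -leqNgt => /andP [].
    rewrite allrel_consr ab andbT; apply/allP => r; rewrite mem_filter /= => /andP [+ _].
    exact: ltnW.
by rewrite vE !wprod_cat wprod_cons mulrBl !mulrA subrK.
Qed.

Lemma pbw_sorted x :
  gsub (fun z => exists2 t, D t & z = X t) x ->
  lspan (fun z => exists w, [/\ all D w, sorted (relpre rk leq) w & z = wprod w]) x.
Proof.
move/gsub_words; apply: lspan_bind => _ [w Dw ->].
by apply: lspan_mono (word_sort Dw (leqnn _)) => _ [u [Du _ su ->]]; exists u.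
Qed.
End Words.

(** * Inner automorphisms without convergence *)

Section AdPoly.
Variable B : algType C.
Implicit Types (y z u : B) (c : {poly B}) (K : B -> Prop).

(* [adpoly y c] says that [c] is the solution [t |-> exp (t ad y) c(0)] of [c' = [y, c]], so that evaluation
   at [1] is the action of the inner automorphism [exp (ad y)]; this is multiplicative without any convergence question. *)
Definition adpoly y c := c^`() = y%:P * c - c * y%:P.
Definition expad y u z := exists c, [/\ c`_0 = u, c.[1] = z & adpoly y c].

Lemma adpolyM y c d : adpoly y c -> adpoly y d -> adpoly y (c * d).
Proof.
rewrite /adpoly derivM => -> ->.
by rewrite mulrBl mulrBr !mulrA addrA subrK.
Qed.

Lemma adpolyP y a c d : adpoly y c -> adpoly y d -> adpoly y ((a%:A)%:P * c + d).
Proof.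
rewrite /adpoly derivD derivM derivC mul0r add0r => -> ->.
rewrite mulrBr mulrDr mulrDl opprD !mulrA.
rewrite -(polyCM _ _) -(polyCM _ _) mulr_algr mulr_algl.
by rewrite addrACA.
Qed.

Lemma adpoly1 y : adpoly y 1.
Proof. by rewrite /adpoly derivC mulr1 mul1r subrr. Qed.

Lemma adpolyX y c n : adpoly y c -> adpoly y (c ^+ n).
Proof.
move=> hc; elim: n => [|n IH]; first by rewrite expr0; apply: adpoly1.
by rewrite exprS; apply: adpolyM.
Qed.

Lemma horner1M c d : (c * d).[1] = c.[1] * d.[1].
Proof. by rewrite hornerM_comm // /comm_poly mulr1 mul1r. Qed.

Lemma horner1X c n : (c ^+ n).[1] = c.[1] ^+ n.
Proof.
elim: n => [|n IH]; first by rewrite !expr0 hornerC.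
by rewrite !exprS horner1M IH.
Qed.

Lemma expadM y u u' z z' : expad y u z -> expad y u' z' -> expad y (u * u') (z * z').
Proof.
move=> [c [<- <- hc]] [d [<- <- hd]]; exists (c * d); split; last exact: adpolyM.
  by rewrite coefM big_ord1.
by rewrite horner1M.
Qed.

Lemma expadP y a u u' z z' : expad y u z -> expad y u' z' -> expad y (a *: u + u') (a *: z + z').
Proof.
move=> [c [<- <- hc]] [d [<- <- hd]]; exists ((a%:A)%:P * c + d); split; last exact: adpolyP.
  by rewrite coefD coefCM mulr_algl.
by rewrite hornerD horner1M hornerC mulr_algl.
Qed.

Lemma expad1 y : expad y 1 1.
Proof. by exists 1; rewrite hornerC coefC eqxx; split=> //; apply: adpoly1. Qed.

Definition subspace K := K 0 /\ (forall a u z, K u -> K z -> K (a *: u + z)).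

Lemma subspace_sum K : subspace K -> forall (I : Type) (r : seq I) (Q : pred I) (F : I -> B),
  (forall i, Q i -> K (F i)) -> K (\sum_(i <- r | Q i) F i).
Proof.
move=> [K0 KP] I r Q F KF; elim/big_ind: _ => // x z Kx Kz.
by rewrite -[x]scale1r; apply: KP.
Qed.

Lemma subspaceZ K : subspace K -> forall a u, K u -> K (a *: u).
Proof. by move=> [K0 KP] a u Ku; rewrite -[_ *: _]addr0; apply: KP. Qed.

Lemma subspaceD K : subspace K -> forall u z, K u -> K z -> K (u + z).
Proof. by move=> [K0 KP] u z Ku Kz; rewrite -[u]scale1r; apply: KP. Qed.

Lemma subspaceB K : subspace K -> forall u z, K u -> K z -> K (u - z).
Proof. by move=> hK u z Ku Kz; rewrite -scaleN1r addrC; case: hK => [K0 KP]; apply: KP. Qed.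

Lemma adpoly_coef K y c : subspace K -> (forall z, K z -> K (y * z - z * y)) ->
  adpoly y c -> K c`_0 -> forall i, K c`_i.
Proof.
move=> hK Kad hc K0; elim=> // i IH.
have := congr1 (fun p : {poly B} => p`_i) hc.
rewrite coef_deriv coefB coefCM coefMC => e.
have -> : c`_i.+1 = (i.+1%:R : C)^-1 *: (c`_i.+1 *+ i.+1).
  by rewrite -scaler_nat scalerA mulVf ?scale1r // pnatr_eq0.
by rewrite e; apply: subspaceZ => //; apply: Kad.
Qed.

Lemma expad_in K y u z : subspace K -> (forall z, K z -> K (y * z - z * y)) ->
  expad y u z -> K u -> K z.
Proof.
move=> hK Kad [c [<- <- hc]] K0; rewrite horner_coef; apply: subspace_sum => // i _.
by rewrite expr1n mulr1; apply: (adpoly_coef hK Kad hc K0).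
Qed.

Definition qpoly (u0 u1 u2 : B) : {poly B} := (u2%:P * 'X + u1%:P) * 'X + u0%:P.

Lemma adpoly_quad y u0 u1 u2 : y * u0 - u0 * y = u1 -> y * u1 - u1 * y = u2 *+ 2 ->
  y * u2 - u2 * y = 0 -> adpoly y (qpoly u0 u1 u2).
Proof.
move=> e0 e1 e2; rewrite /adpoly /qpoly !derivMXaddC derivC mul0r addr0.
have swX (p : {poly B}) : p * 'X * y%:P = p * y%:P * 'X by rewrite -!mulrA commr_polyX.
rewrite !(mulrDl, mulrDr, mulrA, swX) -!polyCM.
rewrite [RHS](_ : _ = (y * u2 - u2 * y)%:P * 'X * 'X + (y * u1 - u1 * y)%:P * 'X + (y * u0 - u0 * y)%:P).
  by rewrite e0 e1 e2 polyC0 !mul0r add0r mulr2n polyCD mulrDl addrAC.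
by rewrite !polyCB !mulrBl !opprD addrACA; congr (_ + _); rewrite addrACA.
Qed.

Lemma qpoly0 u0 u1 u2 : (qpoly u0 u1 u2)`_0 = u0.
Proof. by rewrite /qpoly coefD coefMX coefC add0r. Qed.

Lemma qpoly_horner1 u0 u1 u2 : (qpoly u0 u1 u2).[1] = u0 + u1 + u2.
Proof. by rewrite /qpoly !hornerMXaddC hornerC !mulr1 addrC [u2 + u1]addrC addrA. Qed.

Lemma expad_quad y u0 u1 u2 : y * u0 - u0 * y = u1 -> y * u1 - u1 * y = u2 *+ 2 ->
  y * u2 - u2 * y = 0 -> expad y u0 (u0 + u1 + u2).
Proof.
move=> e0 e1 e2; exists (qpoly u0 u1 u2); rewrite qpoly0 qpoly_horner1; split=> //.
exact: adpoly_quad.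
Qed.

Lemma size_exprS_leq c s n : (size c <= s.+1)%N -> (size (c ^+ n) <= (s * n).+1)%N.
Proof.
move=> sc; elim: n => [|n IH]; first by rewrite expr0 muln0 size_polyC oner_eq0.
rewrite exprS; apply: leq_trans (size_polyMleq _ _) _.
by rewrite mulnS; move: sc IH; lia.
Qed.

Lemma coef_expr_top c s n : (size c <= s.+1)%N -> (c ^+ n)`_(s * n) = c`_s ^+ n.
Proof.
move=> sc; elim: n => [|n IH]; first by rewrite muln0 !expr0 coefC.
have sz := size_exprS_leq n sc.
rewrite !exprS coefM mulnS.
rewrite (bigD1 (inord s)) //= inordK ?ltnS ?leq_addr // addKn IH big1 ?addr0 // => i ne.
case: (ltnP s i) => si; first by rewrite (nth_default 0) ?mul0r //; apply: leq_trans sc _.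
rewrite [X in _ * X](nth_default 0) ?mulr0 //; apply: leq_trans sz _.
have : (i < s)%N.
  rewrite ltn_neqAle si andbT; apply: contra ne => /eqP e; apply/eqP/val_inj.
  by rewrite /= inordK ?ltnS ?leq_addr // e.
by lia.
Qed.

Lemma coef0_expr c n : (c ^+ n)`_0 = c`_0 ^+ n.
Proof. by elim: n => [|n IH]; rewrite ?expr0 ?coefC // !exprS coefM big_ord1 IH. Qed.

Lemma nil_exp K y u z N : subspace K -> (forall z, K z -> K (y * z - z * y)) ->
  expad y u z -> K (u ^+ N) -> K (z ^+ N).
Proof.
move=> hK Kad [c [<- <- hc]] K0; apply: (expad_in (y := y)) (K0) => //.
exists (c ^+ N); split; [| exact: horner1X | exact: adpolyX].
exact: coef0_expr.
Qed.

Lemma nil_top1 K y u0 u1 N : subspace K -> (forall z, K z -> K (y * z - z * y)) ->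
  y * u0 - u0 * y = u1 -> y * u1 - u1 * y = 0 -> K (u0 ^+ N) -> K (u1 ^+ N).
Proof.
move=> hK Kad e0 e1 K0; have hc : adpoly y (qpoly u0 u1 0).
  by apply: adpoly_quad; rewrite ?e0 ?e1 ?mul0rn ?mulr0 ?mul0r ?subrr.
have sz : (size (qpoly u0 u1 0) <= 2)%N.
  by apply/leq_sizeP => -[|[|j]] //= _; rewrite /qpoly coefD coefMX coefD coefMX !coefC /= !addr0; case: j => //=; rewrite coefC.
rewrite -[u1](_ : (qpoly u0 u1 0)`_1 = _); last first.
  by rewrite /qpoly coefD coefMX coefD coefMX !coefC /= add0r addr0.
rewrite -(coef_expr_top _ sz); apply: (adpoly_coef hK Kad); first exact: adpolyX.
by rewrite coef0_expr qpoly0.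
Qed.

Lemma nil_top2 K y u0 u1 u2 N : subspace K -> (forall z, K z -> K (y * z - z * y)) ->
  y * u0 - u0 * y = u1 -> y * u1 - u1 * y = u2 *+ 2 -> y * u2 - u2 * y = 0 ->
  K (u0 ^+ N) -> K (u2 ^+ N).
Proof.
move=> hK Kad e0 e1 e2 K0; have hc : adpoly y (qpoly u0 u1 u2) by apply: adpoly_quad.
have sz : (size (qpoly u0 u1 u2) <= 3)%N.
  by apply/leq_sizeP => -[|[|[|j]]] //= _; rewrite /qpoly coefD coefMX coefD coefMX !coefC /= !addr0.
rewrite -[u2](_ : (qpoly u0 u1 u2)`_2 = _); last first.
  by rewrite /qpoly coefD coefMX coefD coefMX !coefC /= !addr0.
rewrite -(coef_expr_top _ sz); apply: (adpoly_coef hK Kad); first exact: adpolyX.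
by rewrite coef0_expr qpoly0.
Qed.
End AdPoly.

(** * The Lie algebra in terms of pairs of labels *)

(* The label (true, i) stands for the basis vector e_(i+1) of the natural representation and (false, i)
   for the dual vector e_(-i-1). *)
Notation label := (bool * nat)%type.

Definition lbs (k : nat) : seq label := [seq (b, i) | b <- [:: true; false], i <- iota 0 k].

Lemma mem_lbs k (a : label) : (a \in lbs k) = (a.2 < k)%N.
Proof.
apply/allpairsP/idP => [[[b i] /= [_ + ->]]|ak]; first by rewrite mem_iota.
by exists (a.1, a.2); case: a ak => [[] i] /= ik; rewrite mem_iota.
Qed.

Lemma uniq_lbs k : uniq (lbs k).
Proof. by apply: allpairs_uniq; rewrite ?iota_uniq // => -[b i] [b' i'] _ _ [-> ->]. Qed.

Lemma sum_lbs_delta (V : lmodType C) k (F : label -> V) a : (a.2 < k)%N ->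
  \sum_(e <- lbs k) (e == a)%:R *: F e = F a.
Proof.
move=> ak; rewrite (bigD1_seq a) ?mem_lbs ?uniq_lbs //= eqxx scale1r big1 ?addr0 // => e /negPf ->.
by rewrite scale0r.
Qed.

Lemma sum_lbs_delta1 k (F : label -> C) a : (a.2 < k)%N ->
  \sum_(e <- lbs k) (e == a)%:R * F e = F a.
Proof. by move=> ak; rewrite -(@sum_lbs_delta C^o k F a ak). Qed.

Section Relations.
Variable symp : bool.

Definition eps : C := if symp then -1 else 1.
Definition om (a b : label) : C :=
  if (a.2 == b.2) && (a.1 != b.1) then (if a.1 then 1 else eps) else 0.
Definition star (a : label) : label := (~~ a.1, a.2).

Lemma eps2 : eps * eps = 1.
Proof. by rewrite /eps; case: symp; rewrite ?mulrNN mulr1. Qed.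

Lemma starK a : star (star a) = a.
Proof. by case: a => [[] i]. Qed.

Lemma om_sym a b : om b a = eps * om a b.
Proof.
rewrite /om eq_sym [b.1 == _]eq_sym; case: (a.2 =P b.2) => //=; last by rewrite mulr0.
by move: a.1 b.1 => [] [] _ //=; rewrite ?mulr0 ?mulr1 ?eps2.
Qed.

Lemma om_eq0 a b : b != star a -> om a b = 0.
Proof.
move: a b => [b i] [c j] h; rewrite /om /=; case: ifP => // /andP [/eqP e n].
by case/eqP: h; rewrite /star /= e; congr pair; case: b c n => [] [].
Qed.

Lemma om_ef i : om (true, i) (false, i) = 1. Proof. by rewrite /om /= eqxx. Qed.
Lemma om_fe i : om (false, i) (true, i) = eps. Proof. by rewrite /om /= eqxx. Qed.
Lemma om_same b i j : om (b, i) (b, j) = 0. Proof. by rewrite /om /= eqxx andbF. Qed.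
Lemma om_ne b c i j : i != j -> om (b, i) (c, j) = 0.
Proof. by rewrite /om /= => /negPf ->. Qed.

Definition natact (c d a e : label) : C :=
  om d a * (e == c)%:R - eps * om c a * (e == d)%:R.

Definition Ugen (B : algType C) (X : label -> label -> B) (D : pred label) : B -> Prop :=
  gsub (fun z => exists2 t : label * label, D t.1 && D t.2 & z = X t.1 t.2).
Definition below k : pred label := fun a => (a.2 < k)%N.

Section Fixed.
Variable B : algType C.
Implicit Types (X : label -> label -> B) (v w : label -> C).

Definition relX (k : nat) X :=
  (forall a b, (a.2 < k)%N -> (b.2 < k)%N -> X b a = - eps *: X a b) /\
  (forall a b c d, (a.2 < k)%N -> (b.2 < k)%N -> (c.2 < k)%N -> (d.2 < k)%N ->
     X a b * X c d - X c d * X a b =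
       om b c *: X a d - (eps * om b d) *: X a c - (eps * om a c) *: X b d + om a d *: X b c).

Section XV.
Variables (k : nat) (X : label -> label -> B).
Hypothesis hX : relX k X.

Lemma brX c d a b : (c.2 < k)%N -> (d.2 < k)%N -> (a.2 < k)%N -> (b.2 < k)%N ->
  X c d * X a b - X a b * X c d =
  (om d a *: X c b - (eps * om c a) *: X d b) + (om d b *: X a c - (eps * om c b) *: X a d).
Proof.
case: hX => h1 h2 ck dk ak bk; rewrite h2 // (h1 a c) // (h1 a d) // !scalerA.
rewrite (_ : eps * om d b * - eps = - om d b); last by rewrite mulrN mulrAC eps2 mul1r.
rewrite scaleNr opprK [om c b * _]mulrN [om c b * _]mulrC scaleNr -!addrA; congr (_ + _).
by rewrite addrCA.
Qed.

Lemma brX_natact c d a b : (c.2 < k)%N -> (d.2 < k)%N -> (a.2 < k)%N -> (b.2 < k)%N ->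
  X c d * X a b - X a b * X c d =
  \sum_(e <- lbs k) natact c d a e *: X e b + \sum_(e <- lbs k) natact c d b e *: X a e.
Proof.
have nE F (f : label) : (c.2 < k)%N -> (d.2 < k)%N ->
    \sum_(e <- lbs k) natact c d f e *: F e = om d f *: F c - (eps * om c f) *: F d :> B.
  move=> ck dk; rewrite /natact; under eq_bigr do rewrite scalerBl -[in X in X - _]scalerA -[in X in _ - X]scalerA.
  by rewrite sumrB -!scaler_sumr (sum_lbs_delta F ck) (sum_lbs_delta F dk).
by move=> ck dk ak bk; rewrite brX // nE // (nE (fun e => X a e)).
Qed.

Definition XV v w : B := \sum_(a <- lbs k) \sum_(b <- lbs k) (v a * w b) *: X a b.

Definition delta (a e : label) : C := (e == a)%:R.

Lemma XV_delta a b : (a.2 < k)%N -> (b.2 < k)%N -> XV (delta a) (delta b) = X a b.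
Proof.
move=> ak bk; rewrite /XV /delta.
under eq_bigr do (under eq_bigr do rewrite -scalerA; rewrite -scaler_sumr (sum_lbs_delta _ bk)).
exact: (sum_lbs_delta (fun e => X e b)).
Qed.

Lemma eq_XV v v' w w' : (forall a, (a.2 < k)%N -> v a = v' a) ->
  (forall a, (a.2 < k)%N -> w a = w' a) -> XV v w = XV v' w'.
Proof.
move=> ev ew; rewrite /XV; apply: eq_big_seq => a; rewrite mem_lbs => ak.
by apply: eq_big_seq => b; rewrite mem_lbs => bk; rewrite ev ?ew.
Qed.

Lemma XVDl v v' w : XV (fun a => v a + v' a) w = XV v w + XV v' w.
Proof.
rewrite /XV -big_split; apply: eq_bigr => a _ /=.
by rewrite -big_split; apply: eq_bigr => b _ /=; rewrite mulrDl scalerDl.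
Qed.

Lemma XVDr v w w' : XV v (fun a => w a + w' a) = XV v w + XV v w'.
Proof.
rewrite /XV -big_split; apply: eq_bigr => a _ /=.
by rewrite -big_split; apply: eq_bigr => b _ /=; rewrite mulrDr scalerDl.
Qed.

Lemma XV0l v w : (forall a, (a.2 < k)%N -> v a = 0) -> XV v w = 0.
Proof.
move=> v0; rewrite /XV big_seq big1 // => a; rewrite mem_lbs => ak.
by rewrite big1 // => b _; rewrite v0 // mul0r scale0r.
Qed.

Lemma XV0r v w : (forall a, (a.2 < k)%N -> w a = 0) -> XV v w = 0.
Proof.
move=> w0; rewrite /XV big1 // => a _; rewrite big_seq big1 // => b; rewrite mem_lbs => bk.
by rewrite w0 // mulr0 scale0r.
Qed.

Section Derivation.
Variables (y : B) (eta : label -> label -> C).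
Hypothesis heta : forall a b, (a.2 < k)%N -> (b.2 < k)%N ->
  y * X a b - X a b * y =
  \sum_(e <- lbs k) eta a e *: X e b + \sum_(e <- lbs k) eta b e *: X a e.

Definition apv v e := \sum_(a <- lbs k) v a * eta a e.

Lemma ad_XV v w : y * XV v w - XV v w * y = XV (apv v) w + XV v (apv w).
Proof.
have -> : XV (apv v) w = \sum_(a <- lbs k) \sum_(b <- lbs k) (v a * w b) *: \sum_(e <- lbs k) eta a e *: X e b.
  rewrite [LHS](_ : _ = \sum_(e <- lbs k) \sum_(b <- lbs k) \sum_(a <- lbs k) (v a * w b) *: (eta a e *: X e b)).
    rewrite exchange_big /= [RHS]exchange_big /=; apply: eq_bigr => b _.
    by rewrite exchange_big /=; apply: eq_bigr => a _; rewrite scaler_sumr.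
  apply: eq_bigr => e _; apply: eq_bigr => b _; rewrite /apv mulr_suml scaler_suml.
  by apply: eq_bigr => a _; rewrite scalerA mulrAC.
have -> : XV v (apv w) = \sum_(a <- lbs k) \sum_(b <- lbs k) (v a * w b) *: \sum_(e <- lbs k) eta b e *: X a e.
  apply: eq_bigr => a _.
  rewrite [LHS](_ : _ = \sum_(e <- lbs k) \sum_(b <- lbs k) (v a * w b) *: (eta b e *: X a e)).
    by rewrite exchange_big /=; apply: eq_bigr => b _; rewrite scaler_sumr.
  apply: eq_bigr => e _; rewrite /apv mulr_sumr scaler_suml.
  by apply: eq_bigr => b _; rewrite scalerA mulrA.
rewrite /XV mulr_sumr mulr_suml -sumrB -big_split; apply: eq_big_seq => a; rewrite mem_lbs => ak /=.
rewrite mulr_sumr mulr_suml -sumrB -big_split; apply: eq_big_seq => b; rewrite mem_lbs => bk /=.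
by rewrite -scalerAl -scalerAr -scalerBr heta // scalerDr.
Qed.

Lemma expad_XV v w :
  (forall e, (e.2 < k)%N -> apv (apv v) e = 0) -> (forall e, (e.2 < k)%N -> apv (apv w) e = 0) ->
  expad y (XV v w) (XV (fun a => v a + apv v a) (fun a => w a + apv w a)).
Proof.
move=> v0 w0; rewrite XVDl !XVDr.
rewrite (_ : _ + _ = XV v w + (XV (apv v) w + XV v (apv w)) + XV (apv v) (apv w)); last first.
  by rewrite [XV (apv v) w + XV v _]addrC !addrA.
apply: expad_quad; first exact: ad_XV.
  by rewrite mulrDr mulrDl opprD addrACA !ad_XV (XV0l _ v0) (XV0r _ w0) add0r addr0 mulr2n.
by rewrite ad_XV (XV0l _ v0) (XV0r _ w0) addr0.
Qed.
End Derivation.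
End XV.

Lemma natact_ij i j a e : i != j ->
  eps * natact (true, j) (false, i) a e =
  (a == (true, i))%:R * (e == (true, j))%:R - (a == (false, j))%:R * (e == (false, i))%:R.
Proof.
move=> ij; rewrite /natact mulrBr !mulrA eps2 mul1r; congr (_ * _ - _ * _).
  case: a => [[] l]; rewrite /om /= ?andbF ?andbT ?mulr0 // eq_sym !xpair_eqE /=.
  by case: (l == i); rewrite ?mulr0 ?eps2.
case: a => [[] l]; rewrite /om /= ?andbF ?andbT // eq_sym !xpair_eqE /=.
by case: (l == j).
Qed.

Definition shear i j v (e : label) : C :=
  v (true, i) * (e == (true, j))%:R - v (false, j) * (e == (false, i))%:R.

Lemma expad_shear k X (s : C) i j v w : relX k X -> (i < k)%N -> (j < k)%N -> i != j ->
  expad ((s * eps) *: X (true, j) (false, i)) (XV k X v w)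
    (XV k X (fun a => v a + s * shear i j v a) (fun a => w a + s * shear i j w a)).
Proof.
move=> hX ik jk ij.
pose eta a e := (s * eps) * natact (true, j) (false, i) a e.
have heta a b : (a.2 < k)%N -> (b.2 < k)%N ->
    (s * eps) *: X (true, j) (false, i) * X a b - X a b * ((s * eps) *: X (true, j) (false, i)) =
    \sum_(e <- lbs k) eta a e *: X e b + \sum_(e <- lbs k) eta b e *: X a e.
  move=> ak bk; rewrite -scalerAl -scalerAr -scalerBr (brX_natact hX) // scalerDr !scaler_sumr.
  by congr (_ + _); apply: eq_bigr => e _; rewrite scalerA.
have apvE u e : apv k eta u e = s * shear i j u e.
  rewrite /apv /eta; under eq_bigr do rewrite -mulrA natact_ij // mulrCA mulrBr 2!mulrA.
  rewrite -mulr_sumr; congr (_ * _); rewrite sumrB /shear.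
  under eq_bigr do rewrite [u _ * _]mulrC -mulrA.
  under [X in _ - X]eq_bigr do rewrite [u _ * _]mulrC -mulrA.
  by rewrite !sum_lbs_delta1.
rewrite (_ : (fun a => v a + _) = (fun a => v a + apv k eta v a)); last by apply/funext => a; rewrite apvE.
rewrite (_ : (fun a => w a + _) = (fun a => w a + apv k eta w a)); last by apply/funext => a; rewrite apvE.
have sh0 u e : apv k eta (apv k eta u) e = 0.
  rewrite apvE /shear !apvE /shear !xpair_eqE !eqxx /= [j == i]eq_sym (negPf ij).
  by rewrite !(mulr0, mul0r, subr0, sub0r, oppr0).
by apply: expad_XV.
Qed.

Definition swap_index (i j : nat) : nat -> nat := fun l => if l == i then j else if l == j then i else l.
Definition relabel (f : nat -> nat) (a : label) : label := (a.1, f a.2).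

Lemma rotation i j a : i != j -> a.2 != j ->
  let S v e := v e + 1 * shear i j v e in
  let S' v e := v e + (-1) * shear j i v e in
  forall e, S (S' (S (delta a))) e = delta (relabel (swap_index i j) a) e.
Proof.
move=> ij aj /= e; have ji : (j == i) = false by rewrite eq_sym (negPf ij).
rewrite /shear /delta /relabel /swap_index.
case: a aj => [b l]; case: e => [b' l'] /= lj; rewrite !xpair_eqE /= !eqxx (negPf ij) ji.
rewrite [i == l]eq_sym [j == l]eq_sym (negPf lj).
case: b; case: b'; rewrite /= ?eqxx /= ?andbF ?(mulr0, mul0r, addr0, add0r, subr0, sub0r, mulr1, mul1r, oppr0, mulN1r, opprK);
  case: (l =P i) => [li|_] /=; rewrite ?(mulr0, mul0r, addr0, add0r, subr0, sub0r, mulr1, mul1r, oppr0, mulN1r, opprK) //.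
all: by rewrite li ?subrr ?mul0r ?addr0 addrAC subrr add0r.
Qed.

(* The product exp(y) exp(-y') exp(y) of inner automorphisms exchanges the indices [i] and [j] up to signs,
   and no sign occurs on an element in which the index [j] is absent. *)
Lemma swap_index_in k X (K : B -> Prop) (phi : B -> B) i j u :
  relX k X -> (i < k)%N -> (j < k)%N -> i != j ->
  subspace K -> (forall a b z, K z -> K (X a b * z - z * X a b)) ->
  alg_morph phi ->
  (forall a b, phi (X a b) = X (relabel (swap_index i j) a) (relabel (swap_index i j) b)) ->
  Ugen X (fun a => (a.2 < k)%N && (a.2 != j)) u ->
  K u -> K (phi u).
Proof.
move=> hX ik jk ij hK Kad [phiP phi1 phiM] phiX gu.
pose y := (1 * eps) *: X (true, j) (false, i).
pose y' := (-1 * eps) *: X (true, i) (false, j).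
have KZ s a b z : K z -> K (s *: X a b * z - z * (s *: X a b)).
  by move=> Kz; rewrite -scalerAl -scalerAr -scalerBr; apply: subspaceZ => //; apply: Kad.
suff [z1 [z2 [h1 h2 h3]]] : exists z1 z2, [/\ expad y u z1, expad y' z1 z2 & expad y z2 (phi u)].
  by move=> Ku; apply: expad_in h3 _ => //; [by move=> z; apply: KZ|];
     apply: expad_in h2 _ => //; [by move=> z; apply: KZ|]; apply: expad_in h1 _ => // z; apply: KZ.
elim: gu => {u} [|_ [[a b] /= /andP [/andP [ak aj] /andP [bk bj]] ->]|c u v _ [z1 [z2 [h1 h2 h3]]] _ [w1 [w2 [g1 g2 g3]]]|u v _ [z1 [z2 [h1 h2 h3]]] _ [w1 [w2 [g1 g2 g3]]]].
- by exists 1, 1; rewrite phi1; split; apply: expad1.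
- exists (XV k X (fun e => delta a e + 1 * shear i j (delta a) e) (fun e => delta b e + 1 * shear i j (delta b) e)).
  eexists; split; first by rewrite -(XV_delta _ ak bk); apply: expad_shear.
    by apply: expad_shear => //; rewrite eq_sym.
  have sk c : (c.2 < k)%N -> ((relabel (swap_index i j) c).2 < k)%N.
    by move=> ck; rewrite /= /swap_index; case: ifP => // _; case: ifP.
  rewrite phiX -(XV_delta _ (sk _ ak) (sk _ bk)).
  rewrite -(eq_XV _ (fun e _ => rotation ij aj e) (fun e _ => rotation ij bj e)).
  exact: expad_shear.
- exists (c *: z1 + w1), (c *: z2 + w2); rewrite phiP.
  by split; apply: expadP.
- exists (z1 * w1), (z2 * w2); rewrite phiM.
  by split; apply: expadM.
Qed.
End Fixed.
End Relations.

Lemma epsF : eps false = 1. Proof. by []. Qed.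
Lemma epsT : eps true = -1. Proof. by []. Qed.

Section MatrixIndices.
Variables (symp : bool) (n : nat).
Implicit Types (i j : 'I_(n + n)) (M : 'M[C]_(n + n)).
Local Notation eps := (eps symp).
Local Notation om := (om symp).

Definition lb i : label := if (i < n)%N then (false, n - i.+1)%N else (true, i - n)%N.
Definition sg i : C := if (i < n)%N then 1 else eps.

Lemma lb_lt i : ((lb i).2 < n)%N.
Proof. by rewrite /lb; have := ltn_ord i; case: ifP => /=; lia. Qed.

Lemma lb_inj : injective lb.
Proof.
move=> i j; rewrite /lb => h; apply: val_inj => /=; have := ltn_ord i; have := ltn_ord j.
by move: h; case: ifP => a; case: ifP => b //= -[]; lia.
Qed.

Lemma lb_surj (a : label) : (a.2 < n)%N -> exists i, lb i = a.
Proof.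
case: a => [[] l] /= ln.
  have h : (n + l < n + n)%N by lia.
  by exists (Ordinal h); rewrite /lb /= ltnNge leq_addr /= addKn.
have h : (n - l.+1 < n + n)%N by lia.
by exists (Ordinal h); rewrite /lb /= ifT; [congr pair|]; lia.
Qed.

Lemma lb_rev i : lb (rev_ord i) = star (lb i).
Proof.
have := ltn_ord i; rewrite /lb /star /=; case: ifP; case: ifP => /=; move=> *; congr pair; lia.
Qed.

Lemma sg2 i : sg i * sg i = 1.
Proof. by rewrite /sg; case: ifP; rewrite ?mulr1 ?eps2. Qed.

Lemma sg_rev i : eps * sg i * sg (rev_ord i) = 1.
Proof.
have := ltn_ord i; rewrite /sg /=; case: ifP; case: ifP => /=; rewrite ?mulr1 ?eps2 //; lia.
Qed.

Lemma om_lb i j : om (lb i) (lb j) = (j == rev_ord i)%:R * sg j.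
Proof.
case: eqP => [->|ne].
  rewrite lb_rev mul1r /om /star /sg /= eqxx /=.
  have -> : (n + n - i.+1 < n)%N = ~~ (i < n)%N by apply/idP/idP; have := ltn_ord i; lia.
  by rewrite /lb; case: (i < n)%N.
rewrite mul0r om_eq0 // -lb_rev; apply/eqP => /lb_inj; exact: ne.
Qed.

Lemma FmatE i j : Fmat symp n i j = (j == rev_ord i)%:R * sg i.
Proof.
rewrite mxE /lab /sg; have hi := ltn_ord i; have hj := ltn_ord j.
have -> : (j == rev_ord i) = (j + i.+1 == n + n)%N.
  by rewrite -val_eqE /=; apply/eqP/eqP; lia.
case: (ltnP i n) => i_n; case: (ltnP j n) => j_n; rewrite /= ?i_n ?j_n.
- rewrite (_ : (_ == 0) = false); last by apply/eqP; lia.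
  by case: (@eqP nat); rewrite ?mul0r //; lia.
- rewrite (_ : (_ == 0) = (j + i.+1 == n + n)%N); last by apply/eqP/eqP; lia.
  rewrite (_ : (0 < _) = false); last by apply/negbTE; lia.
  by rewrite andbF; case: eqP; rewrite ?mul1r ?mul0r.
- rewrite (_ : (_ == 0) = (j + i.+1 == n + n)%N); last by apply/eqP/eqP; lia.
  rewrite (_ : (0 < _)); last by lia.
  by rewrite andbT; case: eqP; rewrite ?mul1r ?mul0r.
- rewrite (_ : (_ == 0) = false); last by apply/eqP; lia.
  by case: (@eqP nat); rewrite ?mul0r //; lia.
Qed.

Lemma gmatP M : gmat symp M <-> forall i j, M i j * sg j + sg i * M (rev_ord j) (rev_ord i) = 0.
Proof.
have e i j : (M *m Fmat symp n + Fmat symp n *m M^T) i (rev_ord j) =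
    M i j * sg j + sg i * M (rev_ord j) (rev_ord i).
  rewrite !mxE (bigD1 j) //= FmatE eqxx mul1r big1 ?addr0; last first.
    move=> l lj; rewrite FmatE; case: eqP; rewrite ?mul0r ?mulr0 //.
    by move=> /(congr1 (@rev_ord _)); rewrite !rev_ordK => e; rewrite e eqxx in lj.
  rewrite (bigD1 (rev_ord i)) //= FmatE eqxx mul1r mxE big1 ?addr0 // => l li.
  by rewrite FmatE (negPf li) !mul0r.
split=> [h i j|h]; first by rewrite -e h mxE.
by apply/matrixP => i j; rewrite -[j]rev_ordK e h mxE.
Qed.

Definition Xmat (a b : label) : 'M[C]_(n + n) := \matrix_(i, j) natact symp a b (lb j) (lb i).

Lemma XmatE i j p q :
  Xmat (lb i) (lb (rev_ord j)) p q = sg j * ((p == i) && (q == j))%:R - 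
    eps * sg (rev_ord i) * ((p == rev_ord j) && (q == rev_ord i))%:R.
Proof.
rewrite mxE /natact !om_lb rev_ordK !(inj_eq lb_inj); congr (_ - _).
  case: (p == i); case: (q =P j) => [->|] /=; rewrite ?(mul0r, mulr0, mul1r, mulr1) //.
case: (p == rev_ord j); case: (q =P rev_ord i) => [->|] /=; rewrite ?(mul0r, mulr0, mul1r, mulr1) //.
Qed.

Lemma Xmat_gmat a b : (a.2 < n)%N -> (b.2 < n)%N -> gmat symp (Xmat a b).
Proof.
move=> /lb_surj [i <-] /lb_surj [j' <-]; rewrite -[j']rev_ordK; move: (rev_ord j') => j {j'}.
apply/gmatP => p q; rewrite !XmatE.
rewrite !(inj_eq rev_ord_inj) [rev_ord q == i](can2_eq (@rev_ordK _) (@rev_ordK _)).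
rewrite [rev_ord p == j](can2_eq (@rev_ordK _) (@rev_ordK _)).
have s1 := sg2 i; have s2 := sg2 j; have r1 := sg_rev i; have r2 := sg_rev j.
rewrite [(q == rev_ord i) && _]andbC [(q == j) && _]andbC.
have zA : ((p == i) && (q == j))%:R * (sg j * sg q - sg p * (eps * sg (rev_ord i))) = 0.
  case: (p =P i) => [->|_]; rewrite ?mul0r //; case: (q =P j) => [->|_]; rewrite ?mul0r //=.
  by ring: s2 r1.
have zB : ((p == rev_ord j) && (q == rev_ord i))%:R * (sg p * sg j - eps * sg (rev_ord i) * sg q) = 0.
  case: (p =P rev_ord j) => [->|_]; rewrite ?mul0r //; case: (q =P rev_ord i) => [->|_]; rewrite ?mul0r //=.
  have s3 := sg2 (rev_ord i); have ee := eps2 symp.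
  have r3 : sg (rev_ord j) * sg j = eps by rewrite -[LHS]mul1r -{1}ee; ring: r2.
  by ring: s3 r3.
by have := congr2 +%R zA zB; rewrite addr0 => <-; ring.
Qed.

Lemma Xmat_span M : gmat symp M ->
  M = \sum_i \sum_l (2%:R^-1 * (M i l * sg l)) *: Xmat (lb i) (lb (rev_ord l)).
Proof.
move=> /gmatP hM; apply/matrixP => p q; rewrite summxE.
under eq_bigr do rewrite summxE.
under eq_bigr do under eq_bigr do rewrite mxE XmatE mulrBr.
under eq_bigr do rewrite sumrB.
rewrite sumrB (bigD1 p) //= [X in _ + X - _]big1 ?addr0; last first.
  by move=> i /negPf ip; rewrite big1 // => l _; rewrite eq_sym ip mulr0 mulr0.
rewrite (bigD1 q) //= [X in _ + X - _]big1 ?addr0; last first.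
  by move=> i /negPf ip; rewrite eq_sym ip andbF mulr0 mulr0.
rewrite (bigD1 (rev_ord q)) //= [X in _ - (_ + X)]big1 ?addr0; last first.
  move=> i /negPf ip; rewrite big1 // => l _; rewrite (_ : q == _ = false) ?andbF ?mulr0 //.
  by rewrite -(inj_eq rev_ord_inj) rev_ordK eq_sym ip.
rewrite (bigD1 (rev_ord p)) //= [X in _ - (_ + X)]big1 ?addr0; last first.
  move=> i /negPf ip; rewrite (_ : p == _ = false) /= ?mulr0 ?mulr0 //.
  by rewrite -(inj_eq rev_ord_inj) rev_ordK eq_sym ip.
rewrite !rev_ordK !eqxx /= !mulr1.
have h := hM p q; have s2 := sg2 q; have s1 := sg_rev p; have s3 := sg2 p.
have two : (2%:R : C) != 0 by rewrite pnatr_eq0.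
apply: (mulfI two); rewrite mulrBr !mulrA divff // !mul1r.
have -> : M (rev_ord q) (rev_ord p) = - (sg p * (M p q * sg q)).
  by move/eqP: h; rewrite addr_eq0 => /eqP ->; rewrite mulrN opprK mulrA s3 mul1r.
by ring: s1 s2 s3.
Qed.
End MatrixIndices.

(** * The universal enveloping algebra *)

Section Subalgebra.
Variables (B : algType C) (S : B -> Prop).

Definition gsub_pred : {pred B} := fun x => `[< gsub S x >].

Lemma gsub_pred_closed : GRing.subalg_closed gsub_pred.
Proof.
split=> [|a u v|u v]; rewrite ?unfold_in /gsub_pred; first by apply/asboolP; apply: gsub1.
  by move=> /asboolP hu /asboolP hv; apply/asboolP; apply: gsubP.
by move=> /asboolP hu /asboolP hv; apply/asboolP; apply: gsubM.
Qed.
HB.instance Definition _ := GRing.isSubalgClosed.Build C B gsub_pred gsub_pred_closed.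

Definition gsub_type := {x | gsub_pred x}.
HB.instance Definition _ := SubType.on gsub_type.
HB.instance Definition _ := [Choice of gsub_type by <:].
HB.instance Definition _ := [SubChoice_isSubAlgebra of gsub_type by <:].
End Subalgebra.

Section UniversalEnveloping.
Variables (symp : bool) (A : algType C) (iota : forall n : nat, 'M[C]_(n + n) -> A).
Hypothesis Hu : is_univ_env symp iota.
Local Notation eps := (eps symp).

Lemma lie_family_lin (B : algType C) (f : forall n, 'M[C]_(n + n) -> B) : lie_family symp f ->
  forall n (I : Type) (r : seq I) (F : I -> C) (G : I -> 'M[C]_(n + n)),
  (forall i, gmat symp (G i)) ->
  gmat symp (\sum_(i <- r) F i *: G i) /\ f n (\sum_(i <- r) F i *: G i) = \sum_(i <- r) F i *: f n (G i).
Proof.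
move=> [flin _ _] n I r F G hG.
have g0 : @gmat symp n 0 by rewrite /gmat mul0mx trmx0 mulmx0 addr0.
have f0 : f n 0 = 0.
  by have := flin n 1 _ _ g0 g0; rewrite !scale1r addr0 => /(congr1 (fun z => z - f n 0)); rewrite addrK subrr.
elim: r => [|i r [IH1 IH2]]; first by rewrite !big_nil.
rewrite !big_cons; split; last by rewrite flin ?IH2.
rewrite /gmat linearP /= mulmxDl mulmxDr -scalemxAl -scalemxAr addrACA -scalerDr (hG i) scaler0 add0r.
exact: IH1.
Qed.

Lemma emb_Xmat n a b : (a.2 < n)%N -> (b.2 < n)%N -> emb (Xmat symp n a b) = Xmat symp n.+1 a b.
Proof.
move=> an bn; apply/matrixP => i j; rewrite !mxE.
have lbE (l : 'I_(n.+1 + n.+1)) (l' : 'I_(n + n)) : (0 < l)%N -> l' = l.-1 :> nat -> lb l' = lb l.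
  rewrite /lb => l0 ->; have -> : (l.-1 < n)%N = (l < n.+1)%N by apply/idP/idP; lia.
  by case: ifP => h; congr pair; lia.
have natact0l e f : (e.2 < n)%N = false -> natact symp a b e f = 0.
  move=> en; rewrite /natact !om_eq0 ?mulr0 ?mul0r ?subr0 //.
    by apply/eqP => e_; rewrite e_ /= an in en.
  by apply/eqP => e_; rewrite e_ /= bn in en.
have natact0r e f : (f.2 < n)%N = false -> natact symp a b e f = 0.
  move=> en; have fx x : (x.2 < n)%N -> (f == x) = false by move=> xn; apply/eqP => e_; rewrite e_ xn in en.
  by rewrite /natact !fx // !mulr0 subr0.
have out (l : 'I_(n.+1 + n.+1)) : (0 < l)%N && (l.-1 < n + n)%N = false -> ((lb l).2 < n)%N = false.
  by have := ltn_ord l; rewrite /lb; case: ifP => /=; lia.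
case: insubP => [i' _ i'E|hi]; last by rewrite [RHS]natact0r // out // (negPf hi) andbF.
case: insubP => [j' _ j'E|hj]; last by rewrite [RHS]natact0l // out // (negPf hj) andbF.
case: (posnP i) => [i0|i0]; first by rewrite /= [RHS]natact0r // out // i0.
case: (posnP j) => [j0|j0] /=; first by rewrite [RHS]natact0l // out // j0.
by rewrite mxE (lbE i i') // (lbE j j').
Qed.

Definition Xg (a b : label) : A := iota (Xmat symp (maxn a.2 b.2).+1 a b).

Lemma iota_Xmat n a b : (a.2 < n)%N -> (b.2 < n)%N -> iota (Xmat symp n a b) = Xg a b.
Proof.
move=> an bn; have : ((maxn a.2 b.2).+1 <= n)%N by rewrite gtn_max an.
rewrite /Xg; elim: n {an bn} => // n IH; rewrite leq_eqVlt => /predU1P [<- //|].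
rewrite ltnS => h; rewrite -IH //; move: h; rewrite gtn_max => /andP [an bn].
by rewrite -emb_Xmat //; case: Hu => -[_ _ ->] //; apply: Xmat_gmat.
Qed.

Lemma iota_span n M : gmat symp M ->
  iota M = \sum_i \sum_l (2%:R^-1 * (M i l * sg symp l)) *: Xg (@lb n i) (lb (rev_ord l)).
Proof.
move=> hM; rewrite [in LHS](Xmat_span hM); case: Hu => hl _.
rewrite pair_big /= (lie_family_lin hl _ _ _).2 => [|p]; last by apply: Xmat_gmat; apply: lb_lt.
by rewrite pair_big; apply: eq_bigr => p _; rewrite iota_Xmat //; apply: lb_lt.
Qed.

Lemma sum_lb_delta n (F : label -> C) (a : label) : (a.2 < n)%N ->
  \sum_(l < n + n) (lb l == a)%:R * F (lb l) = F a.
Proof.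
move=> /lb_surj [i <-]; rewrite (bigD1 i) //= eqxx mul1r big1 ?addr0 // => l /negPf li.
by rewrite (inj_eq (@lb_inj n)) li mul0r.
Qed.

Lemma natact_comp n a b c d e f : (c.2 < n)%N -> (d.2 < n)%N ->
  \sum_(l < n + n) natact symp a b (lb l) f * natact symp c d e (lb l) =
  om symp d e * natact symp a b c f - eps * om symp c e * natact symp a b d f.
Proof.
move=> cn dn; rewrite {2}/natact; under eq_bigr do rewrite mulrBr.
rewrite sumrB; congr (_ - _).
  under eq_bigr do rewrite mulrC mulrAC -mulrA mulrC -mulrA.
  under eq_bigr do rewrite [X in _ * X]mulrC.
  by rewrite -[RHS](@sum_lb_delta n (fun l => om symp d e * natact symp a b l f)) //; apply: eq_bigr => l _; ring.
by rewrite -[RHS](@sum_lb_delta n (fun l => eps * om symp c e * natact symp a b l f)) //; apply: eq_bigr => l _; ring.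
Qed.

Lemma relX_Xg k : relX symp k Xg.
Proof.
case: (Hu) => -[flin fbr _] _.
have fZ n a M : gmat symp M -> iota (n := n) (a *: M) = a *: iota M.
  move=> hM; have := (lie_family_lin Hu.1 [:: tt] (fun _ => a) (fun _ => hM)).2.
  by rewrite !big_seq1.
split=> [a b ak bk|a b c d ak bk ck dk].
  rewrite -!(@iota_Xmat k) // -fZ; last exact: Xmat_gmat.
  congr iota; apply/matrixP => i j; rewrite !mxE /natact.
  by have e2 := eps2 symp; ring: e2.
rewrite -!(@iota_Xmat k) // -fbr; [|exact: Xmat_gmat|exact: Xmat_gmat].
rewrite -!scaleNr -!addrA.
have gX x y : (x.2 < k)%N -> (y.2 < k)%N -> gmat symp (Xmat symp k x y) by move=> *; apply: Xmat_gmat.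
pose F := [:: (om symp b c, (a, d)); (- (eps * om symp b d), (a, c)); (- (eps * om symp a c), (b, d)); (om symp a d, (b, c))].
pose G (i : 'I_4) := Xmat symp k (nth (0, (a, b)) F i).2.1 (nth (0, (a, b)) F i).2.2.
have hG i : gmat symp (G i) by case: i => -[|[|[|[|i]]]] // hi; apply: gX.
have := (lie_family_lin Hu.1 (index_enum 'I_4) (fun i => (nth (0, (a, b)) F i).1) hG).2.
rewrite !big_ord_recl !big_ord0 /= !addr0 => <-; congr iota.
apply/matrixP => i j; rewrite !mxE.
under eq_bigr do rewrite 2!mxE; under [X in _ - X]eq_bigr do rewrite 2!mxE.
rewrite !natact_comp // /natact.
rewrite [om symp c a]om_sym [om symp c b]om_sym [om symp d a]om_sym [om symp d b]om_sym.
by have e2 := eps2 symp; ring: e2.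
Qed.

Lemma alg_morph_ext (B : algType C) (phi psi : A -> B) :
  alg_morph phi -> alg_morph psi -> (forall a b, phi (Xg a b) = psi (Xg a b)) -> phi =1 psi.
Proof.
have morph_sum (th : A -> B) : alg_morph th -> forall (I : Type) (r : seq I) (F : I -> C) (G : I -> A),
    th (\sum_(i <- r) F i *: G i) = \sum_(i <- r) F i *: th (G i).
  move=> [tP _ _] I r F G.
  have t0 : th 0 = 0.
    by have := tP 1 0 0; rewrite !scale1r addr0 => /(congr1 (fun z => z - th 0)); rewrite addrK subrr.
  by elim: r => [|i r IH]; rewrite ?big_nil ?big_cons ?tP ?IH.
have famm (th : A -> B) : alg_morph th -> lie_family symp (fun n M => th (@iota n M)).
  move=> [tP t1 tM]; case: Hu => -[flin fbr femb] _; split=> [n a M M' hM hM'|n M M' hM hM'|n M hM].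
  - by rewrite flin ?tP.
  - by rewrite fbr // -[in LHS]scaleN1r addrC tP !tM scaleN1r addrC.
  - by rewrite femb.
move=> hphi hpsi e; case: (Hu) => _ /(_ B _ (famm _ hpsi)) [th [_ _ uniq]] x.
rewrite (uniq _ hphi) ?(uniq _ hpsi) // => n M hM.
rewrite (iota_span hM) pair_big /= !morph_sum //.
by apply: eq_bigr => p _; rewrite e.
Qed.

Section FromRelations.
Variables (B : algType C) (Y : label -> label -> B).
Hypothesis hY : forall k, relX symp k Y.

Definition famY n (M : 'M[C]_(n + n)) : B :=
  \sum_i \sum_l (2%:R^-1 * (M i l * sg symp l)) *: Y (lb i) (lb (rev_ord l)).

Lemma famY_Xmat n a b : (a.2 < n)%N -> (b.2 < n)%N -> famY (Xmat symp n a b) = Y a b.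
Proof.
move=> /lb_surj [i <-] /lb_surj [j' <-]; rewrite -[j']rev_ordK; move: (rev_ord j') => j {j'}.
rewrite /famY; under eq_bigr do under eq_bigr do rewrite XmatE mulrBl mulrBr scalerBl.
under eq_bigr do rewrite sumrB.
rewrite sumrB (bigD1 i) //= [X in _ + X - _]big1 ?addr0; last first.
  by move=> p /negPf pi; rewrite big1 // => q _; rewrite pi !(mulr0, mul0r) scale0r.
rewrite (bigD1 j) //= [X in _ + X - _]big1 ?addr0; last first.
  by move=> q /negPf qj; rewrite qj andbF !(mulr0, mul0r) scale0r.
rewrite (bigD1 (rev_ord j)) //= [X in _ - (_ + X)]big1 ?addr0; last first.
  by move=> p /negPf pi; rewrite big1 // => q _; rewrite pi !(mulr0, mul0r) scale0r.
rewrite (bigD1 (rev_ord i)) //= [X in _ - (_ + X)]big1 ?addr0; last first.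
  by move=> q /negPf qj; rewrite qj andbF !(mulr0, mul0r) scale0r.
rewrite !eqxx !mulr1 rev_ordK -mulrA !sg2 !mulr1.
rewrite ((hY n).1 (lb i) (lb (rev_ord j))) ?lb_lt // !scalerA -scalerBl mulrN opprK -mulrA eps2.
by rewrite (_ : _ + _ = 1) ?scale1r //; field; rewrite ?pnatr_eq0.
Qed.

Lemma famY_ad n M p q : gmat symp M ->
  famY M * Y (@lb n p) (lb q) - Y (lb p) (lb q) * famY M =
  \sum_i M i p *: Y (lb i) (lb q) + \sum_i M i q *: Y (lb p) (lb i).
Proof.
move=> /gmatP hM.
have sw i l : M (rev_ord l) (rev_ord i) = - (sg symp i * (M i l * sg symp l)).
  by move/eqP: (hM i l); rewrite addr_eq0 => /eqP ->; rewrite mulrN opprK mulrA sg2 mul1r.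
have half (F : 'I_(n + n) -> B) r :
    \sum_i \sum_l (2%:R^-1 * (M i l * sg symp l)) *: (om symp (lb (rev_ord l)) (lb r) *: F i
       - (eps * om symp (lb i) (lb r)) *: F (rev_ord l)) = \sum_i M i r *: F i.
  under eq_bigr do under eq_bigr do rewrite scalerBr !scalerA.
  under eq_bigr do rewrite sumrB.
  rewrite sumrB.
  have -> : \sum_i \sum_l (2%:R^-1 * (M i l * sg symp l) * om symp (lb (rev_ord l)) (lb r)) *: F i =
      2%:R^-1 *: \sum_i M i r *: F i.
    rewrite scaler_sumr; apply: eq_bigr => i _; rewrite (bigD1 r) //= big1 ?addr0; last first.
      by move=> l /negPf lr; rewrite om_lb rev_ordK eq_sym lr mul0r mulr0 scale0r.
    by rewrite om_lb rev_ordK eqxx mul1r scalerA -!mulrA sg2 mulr1.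
  have -> : \sum_i \sum_l (2%:R^-1 * (M i l * sg symp l) * (eps * om symp (lb i) (lb r))) *: F (rev_ord l) =
      - (2%:R^-1 *: \sum_i M i r *: F i).
    rewrite (bigD1 (rev_ord r)) //= [X in _ + X]big1 ?addr0; last first.
      move=> i ir; rewrite big1 // => l _; rewrite om_lb (_ : r == _ = false) ?(mul0r, mulr0, scale0r) //.
      by rewrite -(inj_eq rev_ord_inj) rev_ordK eq_sym (negPf ir).
    rewrite scaler_sumr -sumrN [RHS](reindex_inj rev_ord_inj) /=; apply: eq_bigr => l _.
    rewrite om_lb rev_ordK eqxx mul1r scalerA -scaleNr; congr (_ *: _).
    have -> : M (rev_ord l) r = M (rev_ord l) (rev_ord (rev_ord r)) by rewrite rev_ordK.
    rewrite sw -mulrN opprK -!mulrA; congr (_ * _).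
    have s := sg_rev symp (rev_ord r); rewrite rev_ordK in s.
    have s2 := sg2 symp (rev_ord r).
    have -> : eps * sg symp r = sg symp (rev_ord r).
      by rewrite -[LHS]mulr1 -s2 -[RHS]mul1r -s; ring.
    by ring.
  rewrite opprK -scalerDr -mulr2n -scaler_nat scalerA mulVf ?scale1r //.
  by rewrite pnatr_eq0.
rewrite -(half (fun i => Y (lb i) (lb q)) p) -(half (fun i => Y (lb p) (lb i)) q).
rewrite /famY mulr_suml mulr_sumr -sumrB -big_split /=; apply: eq_bigr => i _.
rewrite mulr_suml mulr_sumr -sumrB -big_split /=; apply: eq_bigr => l _.
by rewrite -scalerAl -scalerAr -scalerBr -scalerDr (brX (hY n)) ?lb_lt.
Qed.

Lemma famY_lie : lie_family symp famY.
Proof.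
have famYP n a (M M' : 'M[C]_(n + n)) : famY (a *: M + M') = a *: famY M + famY M'.
  rewrite /famY scaler_sumr -big_split; apply: eq_bigr => i _ /=.
  rewrite scaler_sumr -big_split; apply: eq_bigr => l _ /=.
  by rewrite scalerA -scalerDl !mxE; congr (_ *: _); ring.
split=> [n a M M' _ _|n M M' hM hM'|n M hM]; first exact: famYP.
  have adM p q := @famY_ad n M p q hM; move: (famY M) adM => fM adM.
  rewrite [famY M' in RHS](_ : _ = \sum_i \sum_l (2%:R^-1 * (M' i l * sg symp l)) *: Y (lb i) (lb (rev_ord l))) //.
  rewrite mulr_suml mulr_sumr -sumrB.
  under [RHS]eq_bigr do rewrite mulr_suml mulr_sumr -sumrB.
  under [RHS]eq_bigr do under eq_bigr do rewrite -scalerAl -scalerAr -scalerBr adM scalerDr.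
  under [RHS]eq_bigr do rewrite big_split.
  rewrite big_split /=.
  have -> : famY (M *m M' - M' *m M) = famY (M *m M') - famY (M' *m M).
    by rewrite addrC -scaleN1r famYP scaleN1r addrC.
  congr (_ + _).
    rewrite /famY [RHS]exchange_big /= [LHS]exchange_big /=; apply: eq_bigr => l _.
    under [RHS]eq_bigr do rewrite scaler_sumr.
    rewrite exchange_big; apply: eq_bigr => i _ /=; rewrite mxE mulr_suml mulr_sumr scaler_suml.
    by apply: eq_bigr => j _; rewrite scalerA; congr (_ *: _); ring.
  rewrite /famY -sumrN; apply: eq_bigr => i _; rewrite -sumrN.
  under [RHS]eq_bigr do rewrite scaler_sumr.
  rewrite [RHS]exchange_big [LHS](reindex_inj rev_ord_inj); apply: eq_bigr => l _ /=.
  rewrite rev_ordK -scaleNr mxE mulr_suml mulr_sumr -sumrN scaler_suml; apply: eq_bigr => j _.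
  rewrite scalerA; congr (_ *: _).
  move/gmatP: hM => /(_ j (rev_ord l)); rewrite rev_ordK => h.
  have -> : M l (rev_ord j) = - (sg symp j * (M j (rev_ord l) * sg symp (rev_ord l))).
    by move/eqP: h; rewrite addr_eq0 => /eqP ->; rewrite mulrN opprK mulrA sg2 mul1r.
  have s2 := sg2 symp j; ring: s2.
rewrite [in RHS](Xmat_span hM).
have famZ n' (I : Type) (r : seq I) (F : I -> C) (G : I -> 'M[C]_(n' + n')) :
    famY (\sum_(i <- r) F i *: G i) = \sum_(i <- r) F i *: famY (G i).
  elim: r => [|i r IH]; last by rewrite !big_cons famYP IH.
  rewrite !big_nil /famY big1 // => i _; rewrite big1 // => j _.
  by rewrite mxE !(mul0r, mulr0) scale0r.
have embP (a : C) (P Q : 'M[C]_(n + n)) : emb (a *: P + Q) = a *: emb P + emb Q.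
  apply/matrixP => i j; rewrite !mxE; case: insub => [i'|]; last by rewrite mulr0 addr0.
  case: insub => [j'|]; last by rewrite mulr0 addr0.
  by case: ifP; rewrite ?mulr0 ?addr0 // !mxE.
have embZ (I : Type) (r : seq I) (F : I -> C) (G : I -> 'M[C]_(n + n)) :
    emb (\sum_(i <- r) F i *: G i) = \sum_(i <- r) F i *: emb (G i).
  elim: r => [|i r IH]; last by rewrite !big_cons embP IH.
  rewrite !big_nil; apply/matrixP => i j; rewrite !mxE; case: insub => [i'|] //.
  by case: insub => [j'|] //; case: ifP; rewrite // mxE.
rewrite {1}(Xmat_span hM) pair_big /= embZ !famZ; apply: eq_bigr => p _.
by rewrite emb_Xmat ?famY_Xmat // ?(leq_trans (lb_lt _)) // lb_lt.
Qed.

Lemma univ_morph : exists phi : A -> B, alg_morph phi /\ forall a b, phi (Xg a b) = Y a b.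
Proof.
case: (Hu) => hl /(_ B famY famY_lie) [phi [hphi hX _]]; exists phi; split=> // a b.
have an : (a.2 < (maxn a.2 b.2).+1)%N by rewrite ltnS leq_maxl.
have bn : (b.2 < (maxn a.2 b.2).+1)%N by rewrite ltnS leq_maxr.
by rewrite /Xg hX ?famY_Xmat //; apply: Xmat_gmat.
Qed.
End FromRelations.

Lemma psi_exists (f : nat -> nat) : injective f ->
  exists phi : A -> A, alg_morph phi /\ forall a b, phi (Xg a b) = Xg (relabel f a) (relabel f b).
Proof.
move=> f_inj; apply: (@univ_morph A (fun a b => Xg (relabel f a) (relabel f b))) => k.
have omf a b : om symp (relabel f a) (relabel f b) = om symp a b by rewrite /om /= (inj_eq f_inj).
split=> [a b _ _|a b c d _ _ _ _].
  pose m := (maxn (f a.2) (f b.2)).+1.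
  by apply: (relX_Xg m).1; rewrite /= /m ltnS ?leq_maxl ?leq_maxr.
pose m := (maxn (maxn (f a.2) (f b.2)) (maxn (f c.2) (f d.2))).+1.
by rewrite (relX_Xg m).2 ?omf // /m /= ltnS !leq_max leqnn ?orbT.
Qed.

Lemma UsubE n x : Usub symp iota n x <-> Ugen Xg (below n) x.
Proof.
rewrite /Usub gen_subalgE; split; apply: gsub_bind => z.
  move=> [M [hM ->]]; rewrite (iota_span hM); apply: gsub_sum => i _; apply: gsub_sum => l _.
  by apply: gsubZ; apply: gsub_sub; exists (lb i, lb (rev_ord l)); rewrite /= ?/below ?lb_lt.
move=> [[a b] /= /andP [an bn] ->]; apply: gsub_sub; exists (Xmat symp n a b).
by rewrite iota_Xmat //; split=> //; apply: Xmat_gmat.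
Qed.

Lemma Xg_gen x : exists k, Ugen Xg (below k) x.
Proof.
pose S z := exists a b, z = Xg a b.
have gX a b : gsub_pred S (Xg a b) by apply/asboolP; apply: gsub_sub; exists a, b.
pose Y a b : gsub_type S := Sub (Xg a b) (gX a b).
have [|phi [hphi phiX]] := @univ_morph (gsub_type S) Y.
  move=> k; have [h1 h2] := relX_Xg k; split=> [a b ak bk|a b c d ak bk ck dk]; apply: val_inj => /=.
    exact: h1.
  exact: h2.
have /(_ x) e : (fun z => val (phi z)) =1 id.
  apply: alg_morph_ext => //; last by move=> a b; rewrite phiX.
  by case: hphi => [pP p1 pM]; split=> [a u v||u v]; rewrite ?pP ?p1 ?pM.
have /asboolP : gsub_pred S x by rewrite -e; apply: valP.
elim=> {e x} [|_ [a [b ->]]|c u v _ [k1 h1] _ [k2 h2]|u v _ [k1 h1] _ [k2 h2]].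
- by exists 0%N; apply: gsub1.
- exists (maxn a.2 b.2).+1; apply: gsub_sub; exists (a, b) => //.
  by rewrite /below /= !ltnS leq_maxl leq_maxr.
- have mono k k' z : (k <= k')%N -> Ugen Xg (below k) z -> Ugen Xg (below k') z.
    move=> kk; apply: gsub_bind => _ [t /andP [t1 t2] ->]; apply: gsub_sub; exists t => //.
    by rewrite /below !(leq_trans _ kk).
  by exists (maxn k1 k2); apply: gsubP; [apply: mono h1|apply: mono h2]; rewrite ?leq_maxl ?leq_maxr.
- have mono k k' z : (k <= k')%N -> Ugen Xg (below k) z -> Ugen Xg (below k') z.
    move=> kk; apply: gsub_bind => _ [t /andP [t1 t2] ->]; apply: gsub_sub; exists t => //.
    by rewrite /below !(leq_trans _ kk).
  by exists (maxn k1 k2); apply: gsubM; [apply: mono h1|apply: mono h2]; rewrite ?leq_maxl ?leq_maxr.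
Qed.
End UniversalEnveloping.

(** * Highest weight functionals *)

Inductive Pol (k : nat) : ((nat -> C) -> C) -> Prop :=
| Pol_const c : Pol k (fun=> c)
| Pol_var i : (i < k)%N -> Pol k (fun lam => lam i)
| Pol_add p q : Pol k p -> Pol k q -> Pol k (fun lam => p lam + q lam)
| Pol_mul p q : Pol k p -> Pol k q -> Pol k (fun lam => p lam * q lam).

Lemma Pol_opp k p : Pol k p -> Pol k (fun lam => - p lam).
Proof.
move=> hp; rewrite (_ : (fun lam => _) = fun lam => (-1) * p lam).
  by apply: Pol_mul => //; apply: Pol_const.
by apply/funext => lam; rewrite mulN1r.
Qed.

Lemma Pol_sub k p q : Pol k p -> Pol k q -> Pol k (fun lam => p lam - q lam).
Proof. by move=> hp hq; apply: Pol_add => //; apply: Pol_opp. Qed.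

Lemma Pol_ext k p lam lam' : Pol k p -> (forall i, (i < k)%N -> lam i = lam' i) -> p lam = p lam'.
Proof. by move=> hp e; elim: hp => //= [p' q _ -> _ ->|p' q _ -> _ ->]. Qed.

Section Weights.
Variable symp : bool.
Local Notation eps := (eps symp).
Local Notation om := (om symp).

(* The height of a weight with respect to the Borel subalgebra for which larger indices are larger;
   in both types the simple roots are exactly the roots of grade 2. *)
Definition gr (a : label) : int := if a.1 then (a.2.*2 + symp)%:Z else - (a.2.*2 + symp)%:Z.
Definition gr2 (t : label * label) : int := gr t.1 + gr t.2.
Definition wt (i : nat) (a : label) : C := if a.2 == i then (if a.1 then 1 else -1) else 0.

Lemma gr2E t : gr2 t = gr t.1 + gr t.2. Proof. by []. Qed.
Lemma grE b i : gr (b, i) = if b then (i.*2 + symp)%:Z else - (i.*2 + symp)%:Z. Proof. by []. Qed.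

Lemma gr_star a : gr (star a) = - gr a.
Proof. by rewrite /gr /star /=; case: a.1 => //=; rewrite opprK. Qed.

Section Algebra.
Variables (B : algType C) (k : nat) (X : label -> label -> B).
Hypothesis hX : relX symp k X.

Definition hel (i : nat) : B := eps *: X (true, i) (false, i).
Lemma helE i : hel i = eps *: X (true, i) (false, i). Proof. by []. Qed.
Definition Xp (t : label * label) : B := X t.1 t.2.
Definition below2 : pred (label * label) := fun t => (below k t.1) && (below k t.2).
Definition inU : B -> Prop := Ugen X (below k).

Lemma inU_X a b : (a.2 < k)%N -> (b.2 < k)%N -> inU (X a b).
Proof. by move=> ak bk; apply: gsub_sub; exists (a, b) => //; rewrite /= /below ak. Qed.

Lemma inU_hel i : (i < k)%N -> inU (hel i).
Proof. by move=> ik; apply: gsubZ; apply: inU_X. Qed.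

Lemma inU_word w : all below2 w -> inU (wprod Xp w).
Proof.
elim: w => [_|t w IH /= /andP [/andP [t1 t2] hw]]; first by rewrite wprod_nil; apply: gsub1.
by rewrite wprod_cons; apply: gsubM; [apply: inU_X|apply: IH].
Qed.

Lemma hel_br i a b : (i < k)%N -> (a.2 < k)%N -> (b.2 < k)%N ->
  hel i * X a b - X a b * hel i = (wt i a + wt i b) *: X a b.
Proof.
move=> ik ak bk; rewrite /hel -scalerAl -scalerAr -scalerBr (brX hX) // scalerDr scalerDl.
congr (_ + _).
  rewrite scalerBr !scalerA mulrA eps2 mul1r /wt; case: a ak => [[] l] /= lk; rewrite /om /= ?andbF ?andbT.
    by rewrite eq_sym; case: eqP => [->|_]; rewrite ?(mulr0, scale0r) ?subr0 ?eps2.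
  by rewrite eq_sym; case: eqP => [->|_]; rewrite ?(mulr0, scale0r) ?subr0 ?sub0r // scale1r scaleN1r.
rewrite scalerBr !scalerA mulrA eps2 mul1r /wt; case: b bk => [[] l] /= lk; rewrite /om /= ?andbF ?andbT.
  by rewrite eq_sym; case: eqP => [->|_]; rewrite ?(mulr0, scale0r) ?subr0 ?eps2.
by rewrite eq_sym; case: eqP => [->|_]; rewrite ?(mulr0, scale0r) ?subr0 ?sub0r // scale1r scaleN1r.
Qed.

Lemma X_zero t : below2 t -> gr2 t = 0 ->
  exists c i, (i < k)%N /\ Xp t = c *: hel i.
Proof.
case: t => [[b i] [b' j]] /andP /= [ik jk]; rewrite /below /= in ik jk.
rewrite /gr2 /gr /Xp /hel /=; case: b; case: b' => e.
- have [i0 j0] : i = 0%N /\ j = 0%N by lia.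
  have s0 : symp = false by move: e; rewrite i0 j0; case: symp.
  exists 0, i; split=> //; subst i j; rewrite scale0r.
  have := hX.1 (true, 0%N) (true, 0%N) ik jk.
  rewrite s0 epsF scaleN1r => /eqP; rewrite -subr_eq0 opprK -mulr2n -scaler_nat scaler_eq0.
  by rewrite pnatr_eq0 /= => /eqP.
- have -> : j = i by lia.
  by exists eps, i; rewrite scalerA eps2 scale1r.
- have -> : j = i by lia.
  exists (-1), i; split=> //; rewrite scalerA mulN1r; apply: hX.1 => //.
- have [i0 j0] : i = 0%N /\ j = 0%N by lia.
  have s0 : symp = false by move: e; rewrite i0 j0; case: symp.
  exists 0, i; split=> //; subst i j; rewrite scale0r.
  have := hX.1 (false, 0%N) (false, 0%N) ik jk.
  rewrite s0 epsF scaleN1r => /eqP; rewrite -subr_eq0 opprK -mulr2n -scaler_nat scaler_eq0.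
  by rewrite pnatr_eq0 /= => /eqP.
Qed.

Lemma Xp_bracket s t : below2 s -> below2 t ->
  lspan (fun z => exists2 r, below2 r & z = Xp r) (Xp s * Xp t - Xp t * Xp s).
Proof.
case: s t => [a b] [c d] /andP /= [ak bk] /andP /= [ck dk].
rewrite /Xp /= hX.2 //.
have sp x y e : below k x -> below k y -> lspan (fun z => exists2 r, below2 r & z = Xp r) (e *: X x y).
  by move=> xk yk; apply: lspanZ; apply: lspan_sub; exists (x, y); rewrite /below2 //= xk.
by apply: lspanD; [apply: lspanB; [apply: lspanB|]|]; apply: sp.
Qed.

Definition hw_rank (t : label * label) : nat :=
  if gr2 t < 0 then 0%N else if gr2 t == 0 then 1%N else 2%N.

Record hwf (f : B -> C) (lam : nat -> C) : Prop := Hwf {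
  hwf_lin : forall c u v, inU u -> inU v -> f (c *: u + v) = c * f u + f v;
  hwf_neg : forall t u, below2 t -> gr2 t < 0 -> inU u -> f (Xp t * u) = 0;
  hwf_pos : forall t u, below2 t -> 0 < gr2 t -> inU u -> f (u * Xp t) = 0;
  hwf_hel : forall i u, (i < k)%N -> inU u -> f (hel i * u) = lam i * f u }.

Section Functional.
Variables (f : B -> C) (lam : nat -> C).
Hypothesis hf : hwf f lam.

Lemma hwf0 : f 0 = 0.
Proof.
have /= := hwf_lin hf (-1) (gsub1 _) (gsub1 _).
by rewrite scaleN1r addNr mulN1r addNr.
Qed.
Lemma hwfZ c u : inU u -> f (c *: u) = c * f u.
Proof.
move=> hu; have /= := hwf_lin hf c hu (gsub0 _).
by rewrite addr0 hwf0 addr0.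
Qed.
Lemma hwfD u v : inU u -> inU v -> f (u + v) = f u + f v.
Proof. by move=> hu hv; have := hwf_lin hf 1 hu hv; rewrite scale1r mul1r. Qed.
Lemma hwfB u v : inU u -> inU v -> f (u - v) = f u - f v.
Proof.
move=> hu hv; have := hwf_lin hf (-1) hv hu.
by rewrite scaleN1r mulN1r addrC => ->; rewrite addrC.
Qed.
End Functional.

(* Sorted words with a letter of nonzero grade are killed: a negative letter sits at the left end,
   a positive one at the right end. *)
Lemma sorted_word_cases w : all below2 w -> sorted (relpre hw_rank leq) w ->
  [\/ all (fun t => gr2 t == 0) w,
      exists t w', [/\ w = t :: w', below2 t, gr2 t < 0 & all below2 w'] |
      exists t w', [/\ w = rcons w' t, below2 t, 0 < gr2 t & all below2 w']].
Proof.
case: w => [|t w] hw srt; first by apply: Or31.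
case: (ltgtP (gr2 t) 0) => [tneg|tpos|t0].
- by apply: Or32; exists t, w; case/andP: hw.
- apply: Or33; case/lastP: w hw srt => [|w s] hw srt.
    by exists t, [::]; case/andP: hw.
  exists s, (t :: w); move: hw; rewrite /= all_rcons => /and3P [ht hs hw].
  split=> //; last by rewrite ht.
  have tr : transitive (relpre hw_rank leq) by move=> x y z; apply: leq_trans.
  have /allP /(_ s) := order_path_min tr srt.
  rewrite mem_rcons mem_head /= => /(_ isT).
  rewrite {1}/hw_rank ltNge (ltW tpos) /= gt_eqF // /hw_rank.
  by case: ltgtP.
elim: w t t0 hw srt => [|s w IH] t t0 hw srt.
  by apply: Or31; rewrite /= t0 eqxx.
case/and3P: hw => ht hs hw; move: srt => /= /andP [ts srt].
case: (ltgtP (gr2 s) 0) => [sneg|spos|s0].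
- by move: ts; rewrite /hw_rank sneg t0 ltxx eqxx.
- apply: Or33; case/lastP: w hw srt {IH} => [|w r] hw srt.
    by exists s, [:: t]; rewrite /= ht.
  have {}hw : all below2 (rcons w r) := hw.
  exists r, (t :: s :: w); move: hw; rewrite all_rcons => /andP [hr hw].
  split=> //; last by apply/and3P.
  have tr : transitive (relpre hw_rank leq) by move=> x y z; apply: leq_trans.
  have /allP /(_ r) := order_path_min tr srt.
  rewrite mem_rcons mem_head /= => /(_ isT).
  rewrite {1}/hw_rank ltNge (ltW spos) /= gt_eqF // /hw_rank.
  by case: ltgtP.
case: (IH s s0) => /=; rewrite ?hs ?hw //.
- by move=> h; apply: Or31; move: h; rewrite t0 eqxx /= ?s0 ?eqxx.
- by move=> [r [w' [[<- _] _ rneg _]]]; rewrite s0 ltxx in rneg.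
move=> [r [w' [e hr rpos hw']]]; apply: Or33; exists r, (t :: w').
by rewrite e /= ht.
Qed.

Lemma pbw_hw u : inU u -> lspan (fun z => exists w, [/\ all below2 w, sorted (relpre hw_rank leq) w & z = wprod Xp w]) u.
Proof.
move=> hu; apply: (pbw_sorted (D := below2)) => //; exact: Xp_bracket.
Qed.

Lemma harish_chandra u : inU u ->
  exists p, Pol k p /\ forall f lam, hwf f lam -> f u = p lam * f 1.
Proof.
move=> hu; have [] : exists p, Pol k p /\ forall f lam, hwf f lam -> f u = p lam * f 1 /\ inU u; last first.
  by move=> p [hp h]; exists p; split=> // f lam /h [].
apply: (lspan_ind_lin (P := fun u => exists p, Pol k p /\ forall f lam, hwf f lam -> f u = p lam * f 1 /\ inU u)) (pbw_hw hu).
- exists (fun=> 0); split; first exact: Pol_const.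
  by move=> f lam hf; rewrite mul0r (hwf0 hf); split=> //; apply: gsub0.
- move=> c v w [p [hp ep]] [q [hq eq]]; exists (fun lam => c * p lam + q lam); split.
    by apply: Pol_add => //; apply: Pol_mul => //; apply: Pol_const.
  move=> f lam hf; have [e1 h1] := ep f lam hf; have [e2 h2] := eq f lam hf.
  by split; [rewrite (hwf_lin hf) // e1 e2 mulrDl mulrA | apply: gsubP].
move=> _ [w [hw srt ->]].
case: (sorted_word_cases hw srt) => [w0|[t [w' [-> ht tneg hw']]]|[t [w' [-> ht tpos hw']]]].
- elim: w hw w0 {srt} => [_ _|t w IH /= /andP [ht hw] /andP [/eqP t0 w0]].
    exists (fun=> 1); split; first exact: Pol_const.
    by move=> f lam _; rewrite wprod_nil mul1r; split=> //; apply: gsub1.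
  have [p [hp ep]] := IH hw w0; have [c [i [ik e]]] := X_zero ht t0.
  exists (fun lam => c * lam i * p lam); split.
    by apply: Pol_mul => //; apply: Pol_mul; [apply: Pol_const|apply: Pol_var].
  move=> f lam hf; have [e1 h1] := ep f lam hf; rewrite wprod_cons e -scalerAl.
  have h2 : inU (hel i * wprod Xp w) by apply: gsubM => //; apply: inU_hel.
  by rewrite (hwfZ hf) // (hwf_hel hf) // e1 !mulrA; split=> //; apply: gsubZ.
- exists (fun=> 0); split; first exact: Pol_const.
  move=> f lam hf; have h := inU_word hw'; rewrite wprod_cons (hwf_neg hf) // mul0r; split=> //.
  by apply: gsubM => //; case/andP: ht => *; apply: inU_X.
- exists (fun=> 0); split; first exact: Pol_const.
  move=> f lam hf; have h := inU_word hw'.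
  rewrite -cats1 wprod_cat {2 4}/wprod big_seq1 (hwf_pos hf) // mul0r; split=> //.
  by apply: gsubM => //; case/andP: ht => *; apply: inU_X.
Qed.

Definition Act (I : B -> Prop) (lam : nat -> C) :=
  exists f, [/\ hwf f lam, f 1 = 1 & forall u, inU u -> I u -> f u = 0].

(* All properties of a highest weight functional are polynomial conditions on the weight. *)
Lemma Act_closed I lam :
  (forall p, Pol k p -> (forall mu, Act I mu -> p mu = 0) -> p lam = 0) -> Act I lam.
Proof.
move=> hcl.
have /choice [P hP] : forall u, exists p, inU u -> Pol k p /\ forall f mu, hwf f mu -> f u = p mu * f 1.
  move=> u; case: (pselect (inU u)) => [/harish_chandra [p hp]|nu]; first by exists p.
  by exists (fun=> 0).
have PA u mu f : inU u -> hwf f mu -> f 1 = 1 -> P u mu = f u.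
  by move=> /hP [_ h] hf f1; rewrite (h _ _ hf) f1 mulr1.
have PP u : inU u -> Pol k (P u) by case/hP.
have cl q : Pol k q -> (forall mu f, hwf f mu -> f 1 = 1 -> (forall u, inU u -> I u -> f u = 0) -> q mu = 0) -> q lam = 0.
  by move=> hq h; apply: hcl => // mu [f [hf f1 fI]]; apply: h hf f1 fI.
have XU t : below2 t -> inU (Xp t) by case/andP => *; apply: inU_X.
exists (fun u => P u lam); split; last first.
- by move=> u hu Iu; apply: (cl (P u)) => [|mu f hf f1 fI]; [exact: PP|rewrite (PA _ _ f) // fI].
- apply/eqP; rewrite -subr_eq0; apply/eqP; apply: (cl (fun mu => P 1 mu - 1)).
    by apply: Pol_sub; [apply: PP; apply: gsub1|apply: Pol_const].
  by move=> mu f hf f1 fI; rewrite (PA _ _ f) ?f1 ?subrr //; apply: gsub1.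
split.
- move=> c u v hu hv; apply/eqP; rewrite -subr_eq0; apply/eqP.
  have huv : inU (c *: u + v) by apply: gsubP.
  apply: (cl (fun mu => P (c *: u + v) mu - (c * P u mu + P v mu))).
    by apply: Pol_sub; [exact: PP|apply: Pol_add; [apply: Pol_mul; [exact: Pol_const|exact: PP]|exact: PP]].
  by move=> mu f hf f1 fI; rewrite !(PA _ _ f) // (hwf_lin hf) // subrr.
- move=> t u ht tneg hu; have h : inU (Xp t * u) by apply: gsubM => //; apply: XU.
  apply: (cl (P (Xp t * u))); first exact: PP.
  by move=> mu f hf f1 fI; rewrite (PA _ _ f) // (hwf_neg hf).
- move=> t u ht tpos hu; have h : inU (u * Xp t) by apply: gsubM => //; apply: XU.
  apply: (cl (P (u * Xp t))); first exact: PP.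
  by move=> mu f hf f1 fI; rewrite (PA _ _ f) // (hwf_pos hf).
move=> i u ik hu; have h : inU (hel i * u) by apply: gsubM => //; apply: inU_hel.
apply/eqP; rewrite -subr_eq0; apply/eqP; apply: (cl (fun mu => P (hel i * u) mu - mu i * P u mu)).
  by apply: Pol_sub; [exact: PP|apply: Pol_mul; [exact: Pol_var|exact: PP]].
by move=> mu f hf f1 fI; rewrite !(PA _ _ f) // (hwf_hel hf) // subrr.
Qed.
End Algebra.
End Weights.

Section Sl2.
Variables (B : algType C) (E F H : B).
Hypotheses (hEF : E * F - F * E = H) (hHE : H * E - E * H = E *+ 2) (hHF : H * F - F * H = - (F *+ 2)).

Let arith (V : zmodType) (a w : V) n :
  a + (a - w *+ n.+2) *+ n.+1 = (a - w *+ n.+1) *+ n.+2.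
Proof. by rewrite !mulrnBl -!mulrnA addrA -mulrS [(n.+2 * _)%N]mulnC. Qed.

Lemma sl2_En_F n : E ^+ n.+1 * F = F * E ^+ n.+1 + (H * E ^+ n - E ^+ n *+ n) *+ n.+1.
Proof.
have EF : E * F = F * E + H by rewrite -hEF addrC subrK.
have EH : E * H = H * E - E *+ 2 by rewrite -hHE opprB addrC subrK.
elim: n => [|n IH]; first by rewrite !expr1 expr0 mulr1 mulr0n subr0 EF.
rewrite exprS -mulrA IH mulrDr mulrA EF mulrDl -mulrA -exprS -addrA; congr (_ + _).
rewrite -arith; congr (_ + _); rewrite mulrnAr; congr (_ *+ _).
by rewrite mulrBr mulrA EH mulrBl mulrnAr mulrnAl -mulrA -!exprS -addrA -opprD -mulrnDr.
Qed.

Lemma sl2_E_Fn n : E * F ^+ n.+1 = F ^+ n.+1 * E + (F ^+ n * H - F ^+ n *+ n) *+ n.+1.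
Proof.
have EF : E * F = F * E + H by rewrite -hEF addrC subrK.
have HF : H * F = F * H - F *+ 2 by rewrite -hHF addrC subrK.
elim: n => [|n IH]; first by rewrite !expr1 expr0 mul1r mulr0n subr0 EF.
rewrite exprSr mulrA IH mulrDl -mulrA EF mulrDr mulrA -exprSr -addrA; congr (_ + _).
rewrite -arith; congr (_ + _); rewrite mulrnAl; congr (_ *+ _).
by rewrite mulrBl -mulrA HF mulrBr mulrnAl mulrnAr mulrA -!exprSr -addrA -opprD -mulrnDr.
Qed.
End Sl2.

Section LeftIdeal.
Variables (B : algType C) (U Z : B -> Prop).
Hypotheses (hU : subspace U) (hU1 : U 1) (hUM : forall u v, U u -> U v -> U (u * v)).
Hypotheses (hZ : subspace Z) (hUZ : forall u z, U u -> Z z -> Z (u * z)).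

Let UX u n : U u -> U (u ^+ n).
Proof. by move=> hu; elim: n => [|n IH]; rewrite ?expr0 // exprS; apply: hUM. Qed.

(* On the cyclic module [B / Z] the vector [1] is killed by [p ^ a] and [q ^ b]; expanding
   [p ^ i q ^ b] isolates the top coefficient of [exp (t ad p) q ^ b]. *)
Lemma chain_nil p q (c : {poly B}) m a b : U p -> U q -> (forall i, U c`_i) ->
  adpoly p c -> c`_0 = q -> (size c <= m.+1)%N ->
  c`_m * p = p * c`_m -> c`_m * q = q * c`_m ->
  Z (p ^+ a) -> Z (q ^+ b) -> Z (c`_m ^+ (a * b)).
Proof.
move=> hp hq hc hpc c0 sc tp tq Za Zb.
pose D j := (c ^+ b)`_j.
have UD j : U (D j).
  rewrite /D; elim: (b) j => [|n IH] j; first by rewrite expr0 coefC; case: eqP => _ //; case: hU.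
  by rewrite exprS coefM; apply: subspace_sum => // i _; apply: hUM.
have Dtop : D (m * b)%N = c`_m ^+ b by apply: coef_expr_top.
have Dbig j : (m * b < j)%N -> D j = 0.
  move=> mj; apply: nth_default; apply: leq_trans mj.
  exact: size_exprS_leq.
have pD j : p * D j = D j * p + D j.+1 *+ j.+1.
  have := congr1 (fun r : {poly B} => r`_j) (adpolyX b hpc).
  rewrite coef_deriv coefB coefCM coefMC -/(D j) -/(D j.+1) => ->.
  by rewrite addrC subrK.
have expand i : p ^+ i * D 0%N = \sum_(j < i.+1) D j * p ^+ (i - j) *+ (i ^_ j).
  elim: i => [|i IH]; first by rewrite big_ord1 expr0 mul1r mulr1.
  rewrite exprS -mulrA IH mulr_sumr.
  have -> : \sum_(j < i.+1) p * (D j * p ^+ (i - j) *+ i ^_ j) =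
      \sum_(j < i.+1) D j * p ^+ (i.+1 - j) *+ i ^_ j +
      \sum_(j < i.+1) D j.+1 * p ^+ (i - j) *+ (j.+1 * i ^_ j).
    rewrite -big_split; apply: eq_bigr => j _ /=.
    by rewrite mulrnAr mulrA pD mulrDl mulrnDl -mulrA -exprS -subSn ?leq_ord // mulrnAl mulrnA.
  rewrite [RHS]big_ord_recl [X in X + _]big_ord_recl /= -addrA; congr (_ + _).
  rewrite [RHS]big_ord_recr big_ord_recr /= addrA -big_split /=; congr (_ + _).
    apply: eq_bigr => j _; rewrite /bump /= add1n subSS -mulrnDr; congr (_ *+ _).
    by rewrite ffactSS ffactnSr mulnC -mulnDl; congr (_ * _)%N; have := ltn_ord j; lia.
have step s w : U w -> Z (p ^+ s.+1 * w) -> Z (q ^+ b * w) -> Z (c`_m ^+ b * (p ^+ s * w)).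
  move=> hw Zs Zq; pose i := (m * b + s)%N.
  have mi : (m * b < i.+1)%N by rewrite /i; lia.
  have Zi : Z (p ^+ i * D 0%N * w).
    by rewrite /D coef0_expr c0 -mulrA; apply: hUZ => //; apply: UX.
  rewrite expand mulr_suml (bigD1 (Ordinal mi)) //= in Zi.
  have Zr : Z (\sum_(j < i.+1 | j != Ordinal mi) D j * p ^+ (i - j) *+ (i ^_ j) * w).
    apply: subspace_sum => // j ne; rewrite mulrnAl -scaler_nat; apply: subspaceZ => //.
    case: (ltngtP (m * b)%N j) => [h|h|h].
    - by rewrite Dbig // !mul0r; case: hZ.
    - have -> : (i - j = (i - j - s.+1) + s.+1)%N by rewrite /i in h *; lia.
      by rewrite exprD -!mulrA; apply: hUZ => //; apply: hUZ => //; apply: UX.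
    - by move: ne; rewrite -val_eqE /= h eqxx.
  have := subspaceB hZ Zi Zr; rewrite addrK Dtop mulrnAl.
  have -> : (i - m * b = s)%N by rewrite /i; lia.
  rewrite -scaler_nat => /(subspaceZ hZ ((i ^_ (m * b))%:R)^-1).
  rewrite scalerA mulVf ?scale1r -?mulrA // pnatr_eq0 -lt0n ffact_gt0 /i; lia.
have main s w : U w -> Z (p ^+ s * w) -> Z (q ^+ b * w) -> Z (c`_m ^+ (s * b) * w).
  elim: s w => [|s IH] w hw; first by rewrite mul0n.
  move=> Zp Zq; rewrite mulSn addnC exprD -mulrA; apply: IH.
  - by apply: hUM => //; apply: UX.
  - rewrite mulrA (commrX b (commr_sym (commrX s tp))) -mulrA.
    exact: step.
  - rewrite mulrA (commrX b (commr_sym (commrX b tq))) -mulrA.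
    by apply: hUZ => //; apply: UX.
by rewrite -[_ ^+ _]mulr1; apply: main; rewrite ?mulr1.
Qed.
End LeftIdeal.

Section Dominant.
Variable symp : bool.
Local Notation eps := (eps symp).
Local Notation om := (om symp).
Local Notation gr := (gr symp).
Local Notation gr2 := (gr2 symp).
Variables (B : algType C) (k : nat) (X : label -> label -> B).
Hypothesis hX : relX symp k X.
Local Notation U := (inU k X).
Local Notation Xp := (Xp X).
Local Notation hel := (hel symp X).
Variables (f : B -> C) (lam : nat -> C).
Hypothesis hf : hwf symp k X f lam.

Definition leftann z := U z /\ forall u, U u -> f (u * z) = 0.

Lemma subspaceU : subspace U.
Proof. by split; [exact: gsub0 | move=> a u z; apply: gsubP]. Qed.

Lemma subspace_leftann : subspace leftann.
Proof.
split; first by split=> [|u hu]; [exact: gsub0|rewrite mulr0 (hwf0 hf)].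
move=> a y z [Uy hy] [Uz hz]; split=> [|u hu]; first exact: gsubP.
rewrite mulrDr -scalerAr (hwf_lin hf) ?hy ?hz ?mulr0 ?addr0 //; exact: gsubM.
Qed.

Lemma leftann_mul u z : U u -> leftann z -> leftann (u * z).
Proof.
move=> Uu [Uz hz]; split=> [|v hv]; first exact: gsubM.
by rewrite mulrA hz //; apply: gsubM.
Qed.

Lemma leftann_pos t : below2 k t -> 0 < gr2 t -> leftann (Xp t).
Proof.
move=> ht tpos; split=> [|u hu]; first by case/andP: ht => *; apply: inU_X.
exact: (hwf_pos hf).
Qed.

Lemma hel_comm i j : (i < k)%N -> (j < k)%N -> hel i * hel j = hel j * hel i.
Proof.
move=> ik jk; have e := @hel_br symp B k X hX i (true, j) (false, j) ik jk jk.
have -> : hel j = eps *: X (true, j) (false, j) by [].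
rewrite -(scalerAr eps (hel i)) -(scalerAl eps _ (hel i)); congr (_ *: _); apply/eqP; rewrite -subr_eq0 e.
by rewrite /wt /=; case: (j == i); rewrite ?subrr ?addr0 scale0r.
Qed.

Lemma hwf_hel_right i u : (i < k)%N -> U u -> f (u * hel i) = lam i * f u.
Proof.
move=> ik hu; have Uh := inU_hel symp X ik.
suff [] : f (u * hel i) = lam i * f u /\ U u by [].
apply: (lspan_ind_lin (P := fun u => f (u * hel i) = lam i * f u /\ U u)) (pbw_hw hX hu).
- by rewrite mul0r (hwf0 hf) mulr0; split=> //; apply: gsub0.
- move=> c v w [ev Uv] [ew Uw]; split; last exact: gsubP.
  rewrite mulrDl -scalerAl !(hwf_lin hf) ?ev ?ew //; try exact: gsubM.
  by ring.
move=> _ [w [hw srt ->]]; have Uw := inU_word X hw; split=> //.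
case: (sorted_word_cases hw srt) => [w0|[t [w' [we ht tneg hw']]]|[t [w' [we ht tpos hw']]]].
- have -> : wprod Xp w * hel i = hel i * wprod Xp w.
    elim: w hw w0 {srt Uw} => [_ _|t w IH /= /andP [ht hw] /andP [/eqP t0 w0]].
      by rewrite wprod_nil mulr1 mul1r.
    rewrite wprod_cons -mulrA IH // !mulrA; congr (_ * _).
    have [c [j [jk ->]]] := X_zero hX ht t0.
    by rewrite -(scalerAl c _ (hel i)) -(scalerAr c (hel i)) hel_comm.
  by rewrite (hwf_hel hf).
- rewrite we wprod_cons -mulrA !(hwf_neg hf) ?mulr0 //; try exact: inU_word.
  by apply: gsubM => //; apply: inU_word.
- have Uw' := inU_word X hw'.
  rewrite we -cats1 wprod_cat {2 4}/wprod !big_seq1 -mulrA.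
  case: t {we} ht tpos => a b /[dup] ht /andP [/= ak bk] tpos.
  have -> : Xp (a, b) * hel i = (hel i - (wt i a + wt i b)%:A) * Xp (a, b).
    by rewrite mulrBl mulr_algl /Xp /= -(hel_br hX) // opprB addrC subrK.
  rewrite mulrA !(hwf_pos hf) ?mulr0 //; apply: gsubM => //.
  by apply: gsubB => //; apply: gsubZ; apply: gsub1.
Qed.

Lemma sl2_dominant (E F H : B) l N : E * F - F * E = H -> H * E - E * H = E *+ 2 ->
  U E -> U F -> U H -> (forall u, U u -> f (F * u) = 0) -> (forall u, U u -> f (H * u) = l * f u) ->
  f 1 != 0 -> f (E ^+ N * F ^+ N) = 0 -> exists2 n, (n < N)%N & l = n%:R.
Proof.
move=> hEF hHE UE UF UH hF hH f1.
have UF' n m : U (E ^+ n * F ^+ m) by gsub_closed.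
have step n : f (E ^+ n.+1 * F ^+ n.+1) = (l - n%:R) * n.+1%:R * f (E ^+ n * F ^+ n).
  rewrite [F ^+ n.+1]exprS mulrA (sl2_En_F hEF hHE) mulrDl -mulrA (hwfD hf); [|by gsub_closed|by gsub_closed].
  rewrite hF ?add0r; last by gsub_closed.
  rewrite mulrnAl -scaler_nat mulrBl mulrnAl -scaler_nat -!mulrA.
  rewrite (hwfZ hf); last by gsub_closed.
  rewrite (hwfB hf); [|by gsub_closed|by gsub_closed].
  rewrite hH // (hwfZ hf) //; ring.
elim: N => [|N IH]; first by rewrite mulr1 => e; rewrite e eqxx in f1.
rewrite step => /eqP; rewrite !mulf_eq0 subr_eq0 pnatr_eq0 orbF /=.
case/orP => [/eqP ->|/eqP /IH [n nN ->]]; first by exists N.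
by exists n => //; apply: ltnW.
Qed.
End Dominant.

(** * Nilpotent root vectors *)

Section Chains.
Variables (B : algType C) (U Z : B -> Prop).
Hypotheses (hU : subspace U) (hU1 : U 1) (hUM : forall u v, U u -> U v -> U (u * v)).
Hypotheses (hZ : subspace Z) (hUZ : forall u z, U u -> Z z -> Z (u * z)).

Lemma qpoly_coefs (u0 u1 u2 : B) i : (qpoly u0 u1 u2)`_i = if i is i'.+1 then if i' is i''.+1 then if i'' is 0 then u2 else 0 else u1 else u0.
Proof.
rewrite /qpoly coefD coefMX coefD coefMX !coefC.
by case: i => [|[|[|i]]] /=; rewrite ?(addr0, add0r).
Qed.

Lemma chain2_nil p q u1 u2 a b : U p -> U q -> U u1 -> U u2 ->
  p * q - q * p = u1 -> p * u1 - u1 * p = u2 *+ 2 -> u2 * p = p * u2 -> u2 * q = q * u2 ->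
  Z (p ^+ a) -> Z (q ^+ b) -> Z (u2 ^+ (a * b)).
Proof.
move=> hp hq h1 h2 e0 e1 e2 e3.
have -> : u2 = (qpoly q u1 u2)`_2 by rewrite qpoly_coefs.
apply: (chain_nil hU hU1 hUM hZ hUZ hp hq); rewrite ?qpoly_coefs //.
- by move=> i; rewrite qpoly_coefs; case: i => [|[|[|i]]] //; case: hU.
- by apply: adpoly_quad; rewrite // e2 subrr.
- by apply/leq_sizeP => -[|[|[|j]]] //= _; rewrite qpoly_coefs.
Qed.

Lemma chain1_nil p q z a b : U p -> U q -> U z ->
  p * q - q * p = z -> z * p = p * z -> z * q = q * z ->
  Z (p ^+ a) -> Z (q ^+ b) -> Z (z ^+ (a * b)).
Proof.
move=> hp hq hz e0 e1 e2.
have -> : z = (qpoly q z 0)`_1 by rewrite qpoly_coefs.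
apply: (chain_nil hU hU1 hUM hZ hUZ hp hq); rewrite ?qpoly_coefs //.
- by move=> i; rewrite qpoly_coefs; case: i => [|[|[|i]]] //; case: hU.
- by apply: adpoly_quad; rewrite // ?e1 ?subrr ?mul0rn ?mulr0 ?mul0r ?subrr.
- by apply/leq_sizeP => -[|[|[|j]]] //= _; rewrite qpoly_coefs.
Qed.
End Chains.

Section SimpleRoots.
Variable symp : bool.
Local Notation eps := (eps symp).
Local Notation om := (om symp).
Local Notation gr := (gr symp).
Local Notation gr2 := (gr2 symp).
Variables (B : algType C) (k : nat) (X : label -> label -> B).
Hypothesis hX : relX symp k X.
Local Notation U := (inU k X).
Local Notation Xp := (Xp X).
Local Notation hel := (hel symp X).
Local Notation e_ i := ((true, i) : label).
Local Notation f_ i := ((false, i) : label).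

Lemma gr_inj_up x y : gr x = gr y -> x = y \/ [/\ symp = false, x.2 = 0%N & y.2 = 0%N].
Proof.
move: x y => [b i] [c j]; rewrite !grE; case: symp; rewrite /= ?addn0 ?addn1; case: b; case: c => h.
all: try by left; congr pair; lia.
all: try by exfalso; lia.
all: by right; split=> //; lia.
Qed.

Lemma X_diag a : symp = false -> below k a -> X a a = 0.
Proof.
move=> s0 ak; have := hX.1 a a ak ak; rewrite s0 epsF scaleN1r => /eqP.
rewrite -subr_eq0 opprK -mulr2n -scaler_nat scaler_eq0 pnatr_eq0 /= => /eqP //.
Qed.

Definition opp_letter (s : label * label) : label * label := (star s.1, star s.2).
Definition same_letter (s t : label * label) := (t == s) || (t == (s.2, s.1)).

Lemma ad_simple s t : below2 k s -> gr2 s = -2 -> below2 k t -> 0 < gr2 t -> ~~ same_letter (opp_letter s) t ->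
  lspan (fun z => exists r, [/\ below2 k r, 0 < gr2 r, ~~ same_letter (opp_letter s) r & z = Xp r])
    (Xp t * Xp s - Xp s * Xp t).
Proof.
case: s t => [c d] [a b] /andP /= [ck dk] gs /andP /= [ak bk] tpos nt.
set S := (fun z => _).
have L x y z : (y = c /\ z = d) \/ (y = d /\ z = c) -> below k x -> 0 < gr2 (x, star y) ->
    ~~ same_letter (opp_letter (c, d)) (x, star y) -> lspan S (X x z).
  move=> yz xk xpos nx.
  have g2 : gr y + gr z = -2 by case: yz gs => -[-> ->]; rewrite gr2E /= 1?addrC.
  have zk : below k z by case: yz => -[_ ->].
  have ge0 : gr x + gr z = gr2 (x, star y) - 2 by rewrite gr2E /= gr_star; lia.
  have even_gr : exists m : int, gr2 (x, star y) = m *+ 2.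
    rewrite gr2E; case: (x) => [[] i]; case: (y) => [[] j]; rewrite /star !grE /=;
    [exists (i%:Z - j%:Z)|exists (i%:Z + j%:Z + symp%:Z)|exists (- (i%:Z + j%:Z + symp%:Z))|exists (j%:Z - i%:Z)];
    by rewrite mulr2n; case: symp => /=; lia.
  case: even_gr => m em; rewrite em in ge0 xpos.
  have [m1|m1] : m = 1 \/ 1 < m by lia.
    have xz : gr x = gr (star z) by rewrite gr_star; lia.
    case: (gr_inj_up xz) => [xE|[s0 x0 z0]].
      case/negP: nx; rewrite /same_letter /opp_letter xE /=.
      by case: yz => -[-> ->]; rewrite eqxx ?orbT.
    have [xz'|xz'] : x = z \/ x = star z.
      move: x z x0 z0 {nx xk zk xz yz g2 ge0 em} => [b1 i] [b2 j] /= -> ->.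
      by case: b1; case: b2; [left|right|right|left].
    - by rewrite xz' X_diag //; apply: lspan0.
    case/negP: nx; rewrite /same_letter /opp_letter xz' /=.
    by case: yz => -[-> ->]; rewrite eqxx ?orbT.
  apply: lspan_sub; exists (x, z); split=> //; first by rewrite /below2 /= xk.
    by rewrite gr2E /= ge0; lia.
  have gz w : w = c \/ w = d -> z <> star w.
    have ns u : u <> star u by case: u => [[] ?].
    have gN u v : gr u + gr v = -2 -> u <> star v by move=> + uv; rewrite uv gr_star addNr.
    rewrite gr2E /= in gs; have gs' : gr d + gr c = -2 by rewrite addrC.
    by case: yz => -[_ ->]; case=> ->; [exact: gN gs'|exact: ns|exact: ns|exact: gN gs].
  apply/negP; rewrite /same_letter /opp_letter /= => /orP [] /eqP [_ h].
    by apply: (gz d) => //; right.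
  by apply: (gz c) => //; left.
have sym x y : ~~ same_letter (opp_letter (c, d)) (x, y) -> ~~ same_letter (opp_letter (c, d)) (y, x).
  by rewrite /same_letter /= orbC !xpair_eqE => h; rewrite ![(y == _) && _]andbC.
have tpos' : 0 < gr2 (b, a) by move: tpos; rewrite gr2E /= addrC.
have omP x y : y = star x \/ om x y = 0.
  by case: (y =P star x) => [|/eqP]; [left|right; apply: om_eq0].
rewrite /Xp /= hX.2 //; apply: lspanD; [apply: lspanB; [apply: lspanB|]|].
- case: (omP b c) => [cE|->]; last by rewrite scale0r; apply: lspan0.
  have e : star c = b by rewrite cE starK.
  by apply: lspanZ; apply: (L a c d); rewrite ?e //; left.
- case: (omP b d) => [cE|->]; last by rewrite mulr0 scale0r; apply: lspan0.
  have e : star d = b by rewrite cE starK.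
  by apply: lspanZ; apply: (L a d c); rewrite ?e //; right.
- case: (omP a c) => [cE|->]; last by rewrite mulr0 scale0r; apply: lspan0.
  have e : star c = a by rewrite cE starK.
  by apply: lspanZ; apply: (L b c d); rewrite ?e //; [left|apply: sym].
- case: (omP a d) => [cE|->]; last by rewrite scale0r; apply: lspan0.
  have e : star d = a by rewrite cE starK.
  by apply: lspanZ; apply: (L b d c); rewrite ?e //; [right|apply: sym].
Qed.

Lemma ad_hel i t : (i < k)%N -> below2 k t ->
  hel i * Xp t = Xp t * hel i + (wt i t.1 + wt i t.2) *: Xp t.
Proof. by move=> ik /andP [ak bk]; rewrite -(hel_br hX) // addrC subrK. Qed.

Lemma wt_e i j : wt i (e_ j) = (j == i)%:R.
Proof. by rewrite /wt /=; case: (j == i). Qed.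
Lemma wt_f i j : wt i (f_ j) = - (j == i)%:R.
Proof. by rewrite /wt /=; case: (j == i); rewrite ?oppr0. Qed.

Let abel (V : zmodType) (A A' p q : V) : A + p - (A' + q) - (A - A') = p - q.
Proof. by rewrite opprD addrACA [A - A' + _]addrC addrK. Qed.
Let abelD (V : zmodType) (A A' p q : V) : A + p + (A' + q) - (A + A') = p + q.
Proof. by rewrite addrACA [A + A' + _]addrC addrK. Qed.

Lemma sl2_gl i : (i.+1 < k)%N ->
  [/\ Xp (e_ i.+1, f_ i) * (- eps *: Xp (f_ i.+1, e_ i)) - (- eps *: Xp (f_ i.+1, e_ i)) * Xp (e_ i.+1, f_ i) = hel i.+1 - hel i,
   (hel i.+1 - hel i) * Xp (e_ i.+1, f_ i) - Xp (e_ i.+1, f_ i) * (hel i.+1 - hel i) = Xp (e_ i.+1, f_ i) *+ 2 &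
   (hel i.+1 - hel i) * Xp (f_ i.+1, e_ i) - Xp (f_ i.+1, e_ i) * (hel i.+1 - hel i) = - (Xp (f_ i.+1, e_ i) *+ 2)].
Proof.
move=> ik; have ik' : (i < k)%N by apply: ltnW.
have ne : i != i.+1 by lia.
have ne' : i.+1 != i by lia.
split.
- rewrite -scalerAr -scalerAl -scalerBr /Xp /= hX.2 // !om_same om_ef om_fe !helE.
  rewrite !scale0r sub0r addr0 eps2 scale1r mulr1 (hX.1 (e_ i) (f_ i)) // scalerA mulrN eps2 scaleN1r opprK.
  by rewrite scalerDr scalerN !scaleNr opprK.
- rewrite mulrBl mulrBr !ad_hel ?abel //=; try by rewrite /below2 /below /= ?ik ?ik'.
  by rewrite -scalerBl !wt_e !wt_f !eqxx (negPf ne) (negPf ne') oppr0 addr0 add0r opprK -scaler_nat.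
- rewrite mulrBl mulrBr !ad_hel ?abel //=; try by rewrite /below2 /below /= ?ik ?ik'.
  by rewrite -scalerBl !wt_e !wt_f !eqxx (negPf ne) (negPf ne') addr0 oppr0 add0r -opprD scaleNr -scaler_nat.
Qed.

Lemma sl2_sp : symp -> (0 < k)%N ->
  [/\ Xp (e_ 0, e_ 0) * ((- 4%:R^-1) *: Xp (f_ 0, f_ 0)) - ((- 4%:R^-1) *: Xp (f_ 0, f_ 0)) * Xp (e_ 0, e_ 0) = hel 0,
   hel 0 * Xp (e_ 0, e_ 0) - Xp (e_ 0, e_ 0) * hel 0 = Xp (e_ 0, e_ 0) *+ 2 &
   hel 0 * Xp (f_ 0, f_ 0) - Xp (f_ 0, f_ 0) * hel 0 = - (Xp (f_ 0, f_ 0) *+ 2)].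
Proof.
move=> sp k0; have e1 : eps = -1 by rewrite sp.
split=> //.
- rewrite -scalerAr -scalerAl -scalerBr /Xp /= hX.2 // !om_ef mulr1 e1 helE e1.
  rewrite !scale1r !scaleN1r !opprK (_ : _ + _ + _ + _ = 4%:R *: X (e_ 0) (f_ 0)).
    by rewrite scalerA mulNr mulVf ?pnatr_eq0 // scaleN1r.
  by rewrite scaler_nat !mulrS mulr0n addr0 !addrA.
- rewrite ad_hel ?/below2 ?/below /= ?k0 // addrC addKr !wt_e eqxx -natrD scaler_nat //.
- rewrite ad_hel ?/below2 ?/below /= ?k0 // addrC addKr !wt_f eqxx -opprD -natrD scaleNr scaler_nat //.
Qed.

Lemma sl2_o : ~~ symp -> (1 < k)%N ->
  [/\ Xp (e_ 1, e_ 0) * ((-1) *: Xp (f_ 1, f_ 0)) - ((-1) *: Xp (f_ 1, f_ 0)) * Xp (e_ 1, e_ 0) = hel 1 + hel 0,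
   (hel 1 + hel 0) * Xp (e_ 1, e_ 0) - Xp (e_ 1, e_ 0) * (hel 1 + hel 0) = Xp (e_ 1, e_ 0) *+ 2 &
   (hel 1 + hel 0) * Xp (f_ 1, f_ 0) - Xp (f_ 1, f_ 0) * (hel 1 + hel 0) = - (Xp (f_ 1, f_ 0) *+ 2)].
Proof.
move=> /negPf so k1; have k0 : (0 < k)%N by apply: ltnW.
have e1 : eps = 1 by rewrite so.
split=> //.
- rewrite -scalerAr -scalerAl -scalerBr /Xp /= hX.2 // !om_ef !om_ne // mulr1 e1 !helE e1.
  by rewrite !scale1r !scale0r sub0r addr0 -opprD scaleN1r opprK.
- rewrite mulrDl mulrDr !ad_hel ?abelD //=; try by rewrite /below2 /below /= ?k1 ?k0.
  by rewrite -scalerDl !wt_e /= addr0 add0r -natrD scaler_nat.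
- rewrite mulrDl mulrDr !ad_hel ?abelD //=; try by rewrite /below2 /below /= ?k1 ?k0.
  by rewrite -scalerDl !wt_f /= oppr0 addr0 add0r -opprD -natrD scaleNr scaler_nat.
Qed.
End SimpleRoots.

Section Dominance.
Variable symp : bool.
Local Notation eps := (eps symp).
Local Notation om := (om symp).
Local Notation gr := (gr symp).
Local Notation gr2 := (gr2 symp).
Variables (B : algType C) (k : nat) (X : label -> label -> B).
Hypothesis hX : relX symp k X.
Local Notation U := (inU k X).
Local Notation Xp := (Xp X).
Local Notation hel := (hel symp X).
Local Notation e_ i := ((true, i) : label).
Local Notation f_ i := ((false, i) : label).
Variables (f : B -> C) (lam : nat -> C).
Hypothesis hf : hwf symp k X f lam.
Local Notation Z := (leftann k X f).

Let ZU u z : U u -> Z z -> Z (u * z) := @leftann_mul B k X f u z.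
Let Zsub : subspace Z := subspace_leftann hf.

Lemma below2_letter b i c j : (i < k)%N -> (j < k)%N -> below2 k ((b, i), (c, j)).
Proof. by move=> ik jk; rewrite /below2 /below /= ik jk. Qed.

Lemma U_letter t : below2 k t -> U (Xp t).
Proof. by case/andP => *; apply: inU_X. Qed.

Lemma simple_nil s c H n : below2 k s -> gr2 s = -2 -> c != 0 ->
  Xp (opp_letter s) * (c *: Xp s) - (c *: Xp s) * Xp (opp_letter s) = H ->
  H * Xp s - Xp s * H = - (Xp s *+ 2) -> U H ->
  (forall u, U u -> f (u * H) = n%:R * f u) -> Z (Xp s ^+ n.+1).
Proof.
move=> hs gs c0 hEF hHF UH fH; set E := Xp (opp_letter s).
have hE : below2 k (opp_letter s) by [].
have Us := U_letter hs; have UE := U_letter hE.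
have Epos : 0 < gr2 (opp_letter s).
  by move: gs; rewrite !gr2E /= !gr_star => gs; lia.
have Zpos t m : below2 k t -> 0 < gr2 t -> ~~ same_letter (opp_letter s) t -> Z (Xp t * Xp s ^+ m).
  elim: m t => [|m IH] t ht tpos nt; first by rewrite mulr1; apply: (leftann_pos hf).
  have -> : Xp t * Xp s ^+ m.+1 = Xp s * (Xp t * Xp s ^+ m) + (Xp t * Xp s - Xp s * Xp t) * Xp s ^+ m.
    by rewrite mulrBl exprS !mulrA addrC subrK.
  apply: (subspaceD Zsub); first by apply: ZU => //; apply: IH.
  have := ad_simple hX hs gs ht tpos nt.
  apply: (lspan_ind_lin (P := fun z => Z (z * Xp s ^+ m))).
  - by rewrite mul0r; case: Zsub.
  - by move=> a u v hu hv; rewrite mulrDl -scalerAl; apply: Zsub.2.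
  - by move=> _ [r [hr rpos nr ->]]; apply: IH.
have ZE : Z (E * Xp s ^+ n.+1).
  have cn : c ^+ n.+1 != 0 by rewrite expf_neq0.
  have -> : Xp s ^+ n.+1 = (c ^+ n.+1)^-1 *: (c *: Xp s) ^+ n.+1.
    by rewrite exprZn scalerA mulVf ?scale1r.
  rewrite -scalerAr; apply: (subspaceZ Zsub).
  have hHF' : H * (c *: Xp s) - (c *: Xp s) * H = - ((c *: Xp s) *+ 2).
    by rewrite -scalerAr -scalerAl -scalerBr hHF scalerN scalerMnr.
  rewrite (sl2_E_Fn hEF hHF'); apply: (subspaceD Zsub).
    by apply: ZU; [apply: gsubX; apply: gsubZ|apply: (leftann_pos hf)].
  rewrite -scaler_nat; apply: (subspaceZ Zsub); split=> [|u hu]; first by gsub_closed.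
  have UF : U ((c *: Xp s) ^+ n) by gsub_closed.
  rewrite mulrBr mulrnAr mulrA -scaler_nat (hwfB hf); [|by gsub_closed|by gsub_closed].
  by rewrite fH ?(hwfZ hf) ?subrr //; gsub_closed.
have UXn : U (Xp s ^+ n.+1) by gsub_closed.
split=> // u hu; suff [] : f (u * Xp s ^+ n.+1) = 0 /\ U u by [].
apply: (lspan_ind_lin (P := fun u => f (u * Xp s ^+ n.+1) = 0 /\ U u)) (pbw_hw hX hu).
- by rewrite mul0r (hwf0 hf); split=> //; apply: gsub0.
- move=> a v w [e1 h1] [e2 h2]; split; last exact: gsubP.
  by rewrite mulrDl -scalerAl (hwf_lin hf) ?e1 ?e2 ?mulr0 ?addr0 //; gsub_closed.
move=> _ [w [hw srt ->]]; have Uw := inU_word X hw; split=> //.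
case: (sorted_word_cases hw srt) => [w0|[t [w' [we ht tneg hw']]]|[t [w' [we ht tpos hw']]]].
- elim: w hw w0 {srt Uw} => [_ _|t w IH /= /andP [ht hw] /andP [/eqP t0 w0]].
    by rewrite wprod_nil mul1r exprS (hwf_neg hf) ?gs //; apply: gsubX.
  have Uw := inU_word X hw; have [a [i [ik e]]] := X_zero hX ht t0.
  rewrite wprod_cons -mulrA e -scalerAl (hwfZ hf) ?(hwf_hel hf) ?IH ?mulr0 //; first by gsub_closed.
  by apply: gsubM; [apply: inU_hel|gsub_closed].
- by rewrite we wprod_cons -mulrA (hwf_neg hf) //; apply: gsubM => //; apply: inU_word.
have Uw' := inU_word X hw'.
rewrite we -cats1 wprod_cat {2}/wprod big_seq1 -mulrA.
case st: (same_letter (opp_letter s) t); last by apply: (Zpos t n.+1 ht tpos (negbT st)).2.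
case/orP: st => /eqP ->; first exact: ZE.2.
have -> : Xp (((opp_letter s).2), ((opp_letter s).1)) = - eps *: E.
  by case/andP: hE => h1 h2; apply: hX.1.
by rewrite -scalerAl -scalerAr (hwfZ hf) ?ZE.2 ?mulr0 //; gsub_closed.
Qed.

Variables (d : nat -> nat) (n0 : nat).
Hypothesis hd : forall i, (i.+1 < k)%N -> lam i.+1 - lam i = (d i)%:R.
Hypothesis hn0 : (if symp then lam 0%N else lam 1%N + lam 0%N) = n0%:R.
Hypothesis k3 : (2 < k)%N.

Lemma bnd u b : (u < k)%N -> below k (b, u). Proof. by []. Qed.

Lemma simple_gl_nil i : (i.+1 < k)%N -> Z (X (f_ i.+1) (e_ i) ^+ (d i).+1).
Proof.
move=> ik; have ik' : (i < k)%N by apply: ltnW.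
have [h1 h2 h3] := sl2_gl hX ik.
have U1 := inU_hel symp X ik; have U2 := inU_hel symp X ik'.
apply: (@simple_nil (f_ i.+1, e_ i) (- eps)) h1 h3 _ _.
- exact: below2_letter.
- by rewrite gr2E !grE /=; lia.
- by rewrite oppr_eq0 -sqrf_eq0 expr2 eps2 oner_eq0.
- exact: gsubB.
move=> u hu; rewrite mulrBr (hwfB hf); [|by gsub_closed|by gsub_closed].
by rewrite !(hwf_hel_right hX hf) // -mulrBl hd.
Qed.

Lemma simple_low_nil : Z (X (f_ (nat_of_bool (~~ symp))) (f_ 0) ^+ n0.+1).
Proof.
have k0 : (0 < k)%N by lia. have k1 : (1 < k)%N by lia.
have U0 := inU_hel symp X k0; have U1 := inU_hel symp X k1.
case: (boolP symp) => sp /=.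
  have [h1 h2 h3] := sl2_sp hX sp k0.
  apply: (@simple_nil (f_ 0, f_ 0) (- 4%:R^-1)) h1 h3 _ _ => //.
  - exact: below2_letter.
  - by rewrite gr2E !grE /= sp.
  - by rewrite oppr_eq0 invr_eq0 pnatr_eq0.
  by move=> u hu; rewrite (hwf_hel_right hX hf) // -hn0 sp.
have [h1 h2 h3] := sl2_o hX sp k1.
apply: (@simple_nil (f_ 1, f_ 0) (- 1)) h1 h3 _ _.
- exact: below2_letter.
- by rewrite gr2E !grE /= (negPf sp).
- by rewrite oppr_eq0 oner_eq0.
- exact: gsubD.
move=> u hu; rewrite mulrDr (hwfD hf); [|by gsub_closed|by gsub_closed].
by rewrite !(hwf_hel_right hX hf) // -mulrDl -hn0 (negPf sp).
Qed.

Definition gl_bound s t := (\prod_(s <= l < t) (d l).+1)%N.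

Let c1 := @chain1_nil B U Z (subspaceU k X) (gsub1 _) (fun u v => @gsubM B _ u v) Zsub ZU.
Let c2 := @chain2_nil B U Z (subspaceU k X) (gsub1 _) (fun u v => @gsubM B _ u v) Zsub ZU.

Lemma gl_nil s t : (s < t < k)%N -> Z (X (f_ t) (e_ s) ^+ gl_bound s t).
Proof.
elim: t => // t IH /andP [st tk]; have tk' : (t < k)%N by apply: ltnW.
move: st; rewrite ltnS leq_eqVlt => /predU1P [->|st].
  by rewrite /gl_bound big_nat1; apply: simple_gl_nil.
have sk : (s < k)%N by apply: ltn_trans st _.
rewrite /gl_bound big_nat_recr ?(ltnW st) //= mulnC.
have n1 : t != t.+1 by lia. have n2 : s != t by lia. have n3 : s != t.+1 by lia.
have n4 : t != s by lia. have n5 : t.+1 != s by lia. have n6 : t.+1 != t by lia.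
apply: c1 (simple_gl_nil tk) (IH _); rewrite ?st //; try exact: inU_X.
- by rewrite (brX hX) // om_ef !om_same !om_ne // !(mulr0, scale0r, subr0, addr0) scale1r.
- by apply/esym/eqP; rewrite -subr_eq0 (brX hX) // !om_same !om_ne // !(mulr0, scale0r, subr0, addr0).
- by apply/esym/eqP; rewrite -subr_eq0 (brX hX) // !om_same !om_ne // !(mulr0, scale0r, subr0, addr0).
Qed.

Definition low_letter : label * label := if symp then (f_ k.-1, f_ k.-1) else (f_ k.-1, f_ k.-2).
Definition low_bound : nat :=
  if symp then gl_bound 0 k.-1 * n0.+1 else gl_bound 0 k.-2 * (gl_bound 1 k.-1 * n0.+1).

Lemma low_nil : Z (Xp low_letter ^+ low_bound).
Proof.
have k0 : (0 < k)%N by lia. have k1 : (1 < k)%N by lia.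
rewrite /low_letter /low_bound; set t := k.-1; set t' := k.-2.
have tk : (t < k)%N by rewrite /t; lia. have tk' : (t' < k)%N by rewrite /t'; lia.
have n1 : 0%N != t by rewrite /t; lia. have n2 : t != 0%N by rewrite eq_sym.
have n3 : 1%N != t by rewrite /t; lia. have n4 : t != 1%N by rewrite eq_sym.
have n5 : t' != t by rewrite /t /t'; lia. have n6 : t != t' by rewrite eq_sym.
have n7 : t' != 0%N by rewrite /t'; lia. have n8 : 0%N != t' by rewrite eq_sym.
have hlow := simple_low_nil.
case: (boolP symp) hlow => sp /= hlow.
  have hp : Z (X (f_ t) (e_ 0) ^+ gl_bound 0 t) by apply: gl_nil; rewrite /t; lia.
  have sy : X (f_ 0) (f_ t) = X (f_ t) (f_ 0).
    by rewrite (hX.1 (f_ t) (f_ 0)) // sp epsT opprK scale1r.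
  apply: (@c2 _ _ (X (f_ t) (f_ 0) *+ 2) (X (f_ t) (f_ t))) hp hlow; try exact: inU_X.
  - by apply: gsubMn; apply: inU_X.
  - by rewrite (brX hX) // om_ef !om_same // !(mulr0, scale0r, subr0) !scale1r sy -mulr2n.
  - rewrite mulrnAr mulrnAl -mulrnBl (brX hX) // om_ef !om_same !om_ne //.
    by rewrite !(mulr0, scale0r, oppr0, addr0, add0r, scale1r).
  - by apply/esym/eqP; rewrite -subr_eq0 (brX hX) // !om_same !om_ne // !(mulr0, scale0r, subr0, addr0).
  - by apply/esym/eqP; rewrite -subr_eq0 (brX hX) // !om_same // !(mulr0, scale0r, subr0, addr0).
have hp : Z (X (f_ t) (e_ 1) ^+ gl_bound 1 t) by apply: gl_nil; rewrite /t; lia.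
have hp' : Z (X (f_ t') (e_ 0) ^+ gl_bound 0 t') by apply: gl_nil; rewrite /t'; lia.
have ef : eps = 1 by rewrite (negPf sp).
have h1 : Z (X (f_ t) (f_ 0) ^+ (gl_bound 1 t * n0.+1)).
  apply: c1 hp hlow; try exact: inU_X.
  - by rewrite (brX hX) // om_ef !om_same !om_ne // !(mulr0, scale0r, subr0, addr0) scale1r.
  - by apply/esym/eqP; rewrite -subr_eq0 (brX hX) // !om_same !om_ne // !(mulr0, scale0r, subr0, addr0).
  - by apply/esym/eqP; rewrite -subr_eq0 (brX hX) // !om_same // !(mulr0, scale0r, subr0, addr0).
apply: c1 hp' h1; try exact: inU_X.
- by rewrite (brX hX) // om_ef !om_same !om_ne // !(mulr0, scale0r, oppr0, addr0, add0r, scale1r).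
- by apply/esym/eqP; rewrite -subr_eq0 (brX hX) // !om_same !om_ne // !(mulr0, scale0r, subr0, addr0).
- by apply/esym/eqP; rewrite -subr_eq0 (brX hX) // !om_same // !(mulr0, scale0r, subr0, addr0).
Qed.

Lemma below2_low : below2 k low_letter.
Proof. by rewrite /low_letter; case: symp; apply: below2_letter; lia. Qed.

Lemma low_comm t : below2 k t -> gr2 t < 0 -> Xp t * Xp low_letter = Xp low_letter * Xp t.
Proof.
case: t => a b /andP /= [ak bk] tneg; apply/eqP; rewrite -subr_eq0.
have omz x z : om x z != 0 -> x = star z.
  by move=> h; apply/eqP; apply: contraNT h => xz; rewrite om_sym om_eq0 ?mulr0.
have big x : below k x -> gr2 (x, e_ k.-1) < 0 -> False.
  by rewrite gr2E /below; case: x => [[] i] /= ik; rewrite !grE => h; move: (nat_of_bool symp) h; lia.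
have big' x : symp = false -> below k x -> gr2 (x, e_ k.-2) < 0 -> x = f_ k.-1.
  move=> s0; rewrite gr2E /below; case: x => [[] i] /= ik; rewrite !grE s0 => h; first by lia.
  by congr pair; lia.
have sw x y : gr2 (x, y) = gr2 (y, x) by rewrite !gr2E addrC.
have z1 x : below k x -> (gr2 (a, b) = gr2 (x, e_ k.-1) -> False) by move=> xk e; apply: (big x xk); rewrite -e.
have oa : om a (f_ k.-1) = 0.
  by apply/eqP; apply: contraT => /omz aE; case: (z1 b bk); rewrite aE sw.
have ob : om b (f_ k.-1) = 0.
  by apply/eqP; apply: contraT => /omz bE; case: (z1 a ak); rewrite bE.
rewrite /Xp /low_letter; case: (boolP symp) => sp /=.
  by rewrite hX.2 ?oa ?ob ?(mulr0, scale0r, subr0, addr0) // /=; lia.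
have sf : symp = false by apply/negbTE.
have kk : (k.-1 < k)%N /\ (k.-2 < k)%N by lia.
rewrite hX.2 ?oa ?ob ?(mulr0, scale0r, subr0, add0r, sub0r); try by case: kk.
have Xf : X (f_ k.-1) (f_ k.-1) = 0 by apply: (X_diag hX) => //; case: kk.
have ta : (om b (f_ k.-2)) *: X a (f_ k.-1) = 0.
  case: (eqVneq (om b (f_ k.-2)) 0) => [->|/omz bE]; first by rewrite scale0r.
  by rewrite (big' a) ?Xf ?scaler0 //; move: tneg; rewrite bE.
have tb : (om a (f_ k.-2)) *: X b (f_ k.-1) = 0.
  case: (eqVneq (om a (f_ k.-2)) 0) => [->|/omz aE]; first by rewrite scale0r.
  by rewrite (big' b) ?Xf ?scaler0 //; move: tneg; rewrite aE sw.
by rewrite -scalerA ta tb scaler0 oppr0 addr0.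
Qed.

Theorem low_bikilled u u' : U u -> U u' -> f (u * Xp low_letter ^+ low_bound * u') = 0.
Proof.
move=> hu hu'; set y := Xp low_letter; set N := low_bound.
have Uy : U y := U_letter below2_low.
have UyN : U (y ^+ N) by gsub_closed.
have comm t : below2 k t -> gr2 t < 0 -> y ^+ N * Xp t = Xp t * y ^+ N.
  by move=> ht tneg; apply: commr_sym; apply: commrX; apply: low_comm.
suff [] : (forall u, U u -> f (u * y ^+ N * u') = 0) /\ U u' by move=> h _; apply: h.
apply: (lspan_ind_lin (P := fun u' => (forall u, U u -> f (u * y ^+ N * u') = 0) /\ U u')) (pbw_hw hX hu').
- by split; [move=> v _; rewrite mulr0 (hwf0 hf)|exact: gsub0].
- move=> a v w [e1 h1] [e2 h2]; split; last exact: gsubP.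
  by move=> z hz; rewrite mulrDr -scalerAr (hwf_lin hf) ?e1 ?e2 ?mulr0 ?addr0 //; gsub_closed.
move=> _ [w [hw srt ->]]; split; last exact: inU_word.
elim: w hw srt => [_ _|t w IH hw srt] v hv.
  by rewrite wprod_nil mulr1; apply: low_nil.2.
have [ht hw0] : below2 k t /\ all (below2 k) w by case/andP: hw.
have srt0 : sorted (relpre (hw_rank symp) leq) w by apply: path_sorted srt.
have Uw := inU_word X hw0; have Ut := U_letter ht.
have {}IH := IH hw0 srt0.
case: (sorted_word_cases hw srt) => [/= /andP [/eqP t0 _]|[t1 [w' [[<- _] _ tneg _]]]|[t1 [w' [we ht1 tpos hw']]]].
- have [a [i [ik e]]] := X_zero hX ht t0; have Uh := inU_hel symp X ik.
  have [c hc] : exists c, y ^+ N * hel i = (hel i + c%:A) * y ^+ N.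
    elim: N {UyN comm v hv IH} => [|N [c hc]]; first by exists 0; rewrite scale0r addr0 mulr1 mul1r.
    exists (c - (wt i low_letter.1 + wt i low_letter.2)); rewrite exprS -mulrA hc mulrA mulrDr.
    have -> : y * hel i = hel i * y - (wt i low_letter.1 + wt i low_letter.2) *: y.
      by rewrite (ad_hel hX ik below2_low) addrK.
    rewrite mulr_algr.
    rewrite [RHS]mulrA; congr (_ * _).
    by rewrite mulrDl mulr_algl scalerBl addrA addrAC.
  rewrite wprod_cons e -scalerAl -scalerAr (hwfZ hf); last by gsub_closed.
  rewrite mulrA -(mulrA v) hc mulrA IH ?mulr0 //.
  by gsub_closed.
- by rewrite wprod_cons mulrA -(mulrA v) comm // mulrA IH //; gsub_closed.
rewrite we -cats1 wprod_cat {2}/wprod big_seq1 mulrA (hwf_pos hf) //.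
by have Uw' := inU_word X hw'; gsub_closed.
Qed.
End Dominance.

(** * Complete reducibility *)

Section MatrixLemmas.

Lemma common_eigenrow n (As : seq 'M[C]_n) (W : 'M[C]_n) : W != 0 ->
  (forall A, A \in As -> stablemx W A) -> {in As &, forall A B, A *m B = B *m A} ->
  exists v : 'rV_n, [/\ v != 0, (v <= W)%MS & forall A, A \in As -> exists c, v *m A = c *: v].
Proof.
move=> W0 st cm; have r0 : (0 < \rank W)%N by rewrite lt0n mxrank_eq0.
have [A B|v v0 /allP hv] := @common_eigenvector C _ [seq restrictmx W A | A <- As] r0.
  move=> /mapP [A' hA ->] /mapP [B' hB ->].
  by rewrite /comm_mx -!conjmxM ?inE ?stablemx_row_base ?st // cm.
exists (v *m row_base W); split.
- by rewrite mulmx_free_eq0 ?row_base_free.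
- by rewrite mulmx_sub // eq_row_base.
move=> A hA; have := hv _ (map_f _ hA); rewrite stablemx_restrict ?st //.
by move=> /sub_rVP [c ->]; exists c.
Qed.

Variable n : nat.
Implicit Types (M E F H : 'M[C]_n.+1) (v : 'rV[C]_n.+1).

Lemma eigen_shift M (u : nat -> 'rV[C]_n.+1) c s : s != 0 ->
  (forall j, u j *m M = (c + j%:R * s) *: u j) -> exists j, u j = 0.
Proof.
move=> s0 hu; apply: contrapT => h.
have nz j : u j != 0 by apply/eqP => e; apply: h; exists j.
pose rs := [seq c + j%:R * s | j <- iota 0 n.+2].
have p0 : char_poly M != 0 by rewrite monic_neq0 // char_poly_monic.
have urs : uniq rs.
  rewrite map_inj_uniq ?iota_uniq // => i j /addrI /(mulIf s0) /eqP.
  by rewrite eqr_nat => /eqP.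
have ars : all (root (char_poly M)) rs.
  apply/allP => _ /mapP [j _ ->]; rewrite -eigenvalue_root_char; apply/eigenvalueP.
  by exists (u j).
by have := max_poly_roots p0 ars urs; rewrite size_char_poly size_map size_iota ltnn.
Qed.

Definition realeig M := forall c v, v != 0 -> v *m M = c *: v -> c \is Num.real.

Lemma realeig_add M M' : M *m M' = M' *m M -> realeig M -> realeig M' -> realeig (M + M').
Proof.
move=> cm rM rM' c v v0 hv.
pose W := eigenspace (M + M') c.
have vW : (v <= W)%MS by apply/eigenspaceP.
have W0 : W != 0 by apply: contraNneq v0 => W0; move: vW; rewrite W0 submx0.
have [|A|u [u0 uW hu]] := common_eigenrow (As := [:: M]) W0.
- move=> A; rewrite inE => /eqP ->; apply: comm_mx_stable_eigenspace.
  by rewrite /comm_mx mulmxDl mulmxDr cm.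
- by move=> B; rewrite !inE => /eqP -> /eqP ->.
have [a ha] := hu M (mem_head _ _).
have := eigenspaceP uW; rewrite mulmxDr ha => e.
have hb : u *m M' = (c - a) *: u by rewrite scalerBl -e addrC addKr.
by rewrite -(subrK a c) rpredD ?(rM' _ _ u0 hb) ?(rM _ _ u0 ha).
Qed.

Lemma realeigZ (r : C) M : r \is Num.real -> realeig M -> realeig (r *: M).
Proof.
move=> rr rM c v v0; rewrite -scalemxAr.
case: (eqVneq r 0) => [->|r0]; first by rewrite scale0r => /esym/eqP; rewrite scaler_eq0 (negPf v0) orbF => /eqP ->.
move=> /(congr1 (fun x => r^-1 *: x)); rewrite !scalerA mulVf // scale1r => /(rM _ _ v0).
by rewrite realMr ?realV ?invr_eq0 ?unfold_in //= => h; rewrite -(mulKf r0 c) mulrC; move: h; rewrite mulrC => h; rewrite rpredM.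
Qed.

Lemma sl2_realeig E F H : E * F - F * E = H -> H * E - E * H = E *+ 2 ->
  H * F - F * H = - (F *+ 2) -> realeig H.
Proof.
move=> hEF hHE hHF c v v0 hv.
have two : - 2%:R != 0 :> C by rewrite oppr_eq0 pnatr_eq0.
have two' : 2%:R != 0 :> C by rewrite pnatr_eq0.
have EH : E * H = H * E - E *+ 2 by rewrite -hHE opprB addrC subrK.
have FH : F * H = H * F + F *+ 2.
  by apply/esym/eqP; rewrite -subr_eq0 addrAC hHF addNr.
have vE (w : 'rV[C]_n.+1) a : w *m H = a *: w -> (w *m E) *m H = (a - 2%:R) *: (w *m E).
  move=> e; rewrite -mulmxA (EH : E *m H = _) mulmxBr mulmxA e -scalemxAl scalerBl.
  by congr (_ - _); rewrite -scaler_nat -scalemxAr.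
have vF (w : 'rV[C]_n.+1) a : w *m H = a *: w -> (w *m F) *m H = (a + 2%:R) *: (w *m F).
  move=> e; rewrite -mulmxA (FH : F *m H = _) mulmxDr mulmxA e -scalemxAl scalerDl.
  by congr (_ + _); rewrite -scaler_nat -scalemxAr.
have [j hj] : exists j, v *m E ^+ j = 0.
  apply: (@eigen_shift H _ c (- 2%:R)) => // j.
  elim: j => [|j IH]; first by rewrite mul0r addr0 mulmx1.
  rewrite exprSr mulmxA (vE _ _ IH) -mulmxA; congr (_ *: _).
  by rewrite -[in RHS]natr1; ring.
have [w [c' [w0 wE wH [m cE]]]] : exists (w : 'rV[C]_n.+1) c', [/\ w != 0, w *m E = 0, w *m H = c' *: w & exists m : nat, c' = c - m%:R * 2%:R].
  elim: j v c v0 hv hj => [|j IH] v c v0 hv.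
    by rewrite mulmx1 => e; rewrite e eqxx in v0.
  case: (eqVneq (v *m E) 0) => [e _|e].
    by exists v, c; split=> //; exists 0%N; rewrite mul0r subr0.
  rewrite exprS mulmxA => hj; have [w [c' [w0 wE wH [m cE]]]] := IH _ _ e (vE _ _ hv) hj.
  by exists w, c'; split=> //; exists m.+1; rewrite cE -natr1; ring.
have wFH i : w *m F ^+ i *m H = (c' + i%:R * 2%:R) *: (w *m F ^+ i).
  elim: i => [|i IH]; first by rewrite mul0r addr0 mulmx1.
  rewrite exprSr mulmxA (vF _ _ IH) -mulmxA; congr (_ *: _).
  by rewrite -[in RHS]natr1; ring.
have [N hN] : exists N, w *m F ^+ N = 0 by apply: (eigen_shift two' wFH).
have {N hN} [N [N0 hN]] : exists N, w *m F ^+ N != 0 /\ w *m F ^+ N.+1 = 0.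
  elim: N hN => [|N IH hN]; first by rewrite mulmx1 => e; rewrite e eqxx in w0.
  by case: (eqVneq (w *m F ^+ N) 0) => [/IH|h]; last by exists N.
have := congr1 (fun x => w *m x) (sl2_E_Fn hEF hHF N).
rewrite mulmxA wE mul0mx mulmxDr mulmxA hN mul0mx add0r -scaler_nat -scalemxAr.
rewrite mulmxBr mulmxA wFH -scaler_nat -scalemxAr -scalerBl scalerA => /esym/eqP.
rewrite scaler_eq0 (negPf N0) orbF mulf_eq0 pnatr_eq0 /= => /eqP e.
have -> : c = m%:R * 2%:R - N%:R.
  have : c' = - N%:R by apply/eqP; rewrite -subr_eq0 opprK; apply/eqP; rewrite -e; ring.
  by rewrite cE => /eqP; rewrite subr_eq => /eqP ->; rewrite addrC.
by rewrite rpredB // ?rpredM ?realn.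
Qed.

Lemma trig_form M : exists P D : 'M[C]_n.+1,
  [/\ P \in unitmx, is_trig_mx D & D = P *m M *m invmx P].
Proof.
have [P Pu] := Schur M (ltn0Sn n); have Pun := unitarymx_unit Pu.
by rewrite /similar_to /= => h; exists P, (conjmx P M); split=> //; exact: conjumx.
Qed.

Lemma trig_diag_eigen M P D i : P \in unitmx -> is_trig_mx D -> D = P *m M *m invmx P ->
  exists2 v : 'rV[C]_n.+1, v != 0 & v *m M = D i i *: v.
Proof.
move=> Pu Dt DE; have : eigenvalue D (D i i).
  by rewrite eigenvalue_root_char char_poly_trig // /root horner_prod (bigD1 i) //= hornerXsubC subrr mul0r.
move=> /eigenvalueP [v hv v0]; exists (v *m P).
  by apply: contraNneq v0 => /(congr1 (fun x => x *m invmx P)); rewrite mulmxK // mul0mx => ->.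
by rewrite scalemxAl -hv DE !mulmxA mulmxKV.
Qed.

Lemma trig_tr M P D : P \in unitmx -> D = P *m M *m invmx P -> \tr M = \tr D.
Proof. by move=> Pu ->; rewrite mxtrace_mulC mulmxA mulVmx // mul1mx. Qed.

Lemma trig_nil M P D : P \in unitmx -> is_trig_mx D -> D = P *m M *m invmx P ->
  (forall i, D i i = 0) -> M ^+ n.+1 = 0.
Proof.
move=> Pu Dt DE D0.
have Dn : D ^+ n.+1 = 0.
  have := Cayley_Hamilton D; rewrite char_poly_trig //.
  under eq_bigr do rewrite D0 subr0.
  by rewrite prodr_const card_ord rmorphXn /= horner_mx_X.
have Dj j : D ^+ j = P *m M ^+ j *m invmx P.
  elim: j => [|j IH]; first by rewrite !expr0 mulmx1 mulmxV.
  by rewrite !exprS IH {1}DE -!mulmxE !mulmxA mulmxKV.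
by move: (Dj n.+1); rewrite Dn => /(congr1 (fun x => invmx P *m x *m P)); rewrite mulmx0 mul0mx !mulmxA mulVmx // mul1mx mulmxKV.
Qed.

Lemma tr_sq M : realeig M -> 0 <= \tr (M *m M) /\ (\tr (M *m M) = 0 -> M ^+ n.+1 = 0).
Proof.
move=> rM; have [P [D [Pu Dt DE]]] := trig_form M.
have rD i : D i i \is Num.real by have [v v0 hv] := trig_diag_eigen i Pu Dt DE; apply: rM v0 hv.
have -> : \tr (M *m M) = \sum_i D i i ^+ 2.
  rewrite (trig_tr (D := D *m D) Pu); last by rewrite DE !mulmxA mulmxKV.
  apply: eq_bigr => i _; rewrite mxE (bigD1 i) //= big1 ?addr0 ?expr2 // => j ji.
  have /is_trig_mxP Dz := Dt.
  case: (ltngtP i j) => [/Dz ->|/Dz ->|/val_inj e]; [by rewrite mul0r|by rewrite mulr0|].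
  by rewrite e eqxx in ji.
have ge i : true -> 0 <= D i i ^+ 2 by rewrite real_exprn_even_ge0.
split; first exact: sumr_ge0.
move=> /psumr_eq0P h; apply: (trig_nil Pu Dt DE) => i.
by apply/eqP; rewrite -sqrf_eq0; apply/eqP; apply: h.
Qed.

Lemma nil_tr0 M N : M ^+ N = 0 -> \tr M = 0.
Proof.
move=> MN; have [P [D [Pu Dt DE]]] := trig_form M.
rewrite (trig_tr Pu DE); apply: big1 => i _.
have [v v0 hv] := trig_diag_eigen i Pu Dt DE.
have : v *m M ^+ N = D i i ^+ N *: v.
  elim: (N) => [|m IH]; first by rewrite !expr0 mulmx1 scale1r.
  by rewrite !exprS mulmxA hv -scalemxAl IH scalerA.
by rewrite MN mulmx0 => /esym/eqP; rewrite scaler_eq0 (negPf v0) orbF expf_eq0 => /andP [_ /eqP].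
Qed.

Lemma nil_weight0 H M N (w : C) : H ^+ N = 0 -> w != 0 -> H * M - M * H = w *: M -> M = 0.
Proof.
move=> HN w0 hw.
suff h s i j : (N + N <= s + (i + j))%N -> H ^+ i * M * H ^+ j = 0.
  by have := h (N + N)%N 0%N 0%N; rewrite expr0 mul1r mulr1; apply; lia.
elim: s i j => [|s IH] i j le.
  case: (leqP N i) => hi; first by rewrite -(subnK hi) exprD HN mulr0 !mul0r.
  have hj : (N <= j)%N by lia.
  by rewrite -(subnKC hj) exprD HN mul0r mulr0.
apply/eqP; have := congr1 (fun x => H ^+ i * x * H ^+ j) hw.
rewrite mulrBr mulrBl !mulrA -exprSr -[_ * M * H * _]mulrA -exprS (IH i.+1 j) ?(IH i j.+1) ?subrr; try lia.
by rewrite -scalerAr -scalerAl => /esym/eqP; rewrite scaler_eq0 (negPf w0).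
Qed.
End MatrixLemmas.

Section Casimir.
Variable symp : bool.
Local Notation eps := (eps symp).
Local Notation om := (om symp).
Local Notation hel := (hel symp).
Local Notation nat_ := (natact symp).

Lemma perm_lbs_star k : perm_eq (map star (lbs k)) (lbs k).
Proof.
apply: uniq_perm; rewrite ?uniq_lbs ?(map_inj_uniq (can_inj starK)) ?uniq_lbs // => a.
rewrite mem_lbs -[a]starK (mem_map (can_inj starK)) mem_lbs //.
Qed.

Lemma sum_lbs_star (V : zmodType) k (F : label -> V) : \sum_(a <- lbs k) F (star a) = \sum_(a <- lbs k) F a.
Proof. by rewrite -[RHS](perm_big _ (perm_lbs_star k)) big_map. Qed.

Definition sgn_ (a : label) : C := om (star a) a.

Lemma sgn2 a : sgn_ a * sgn_ a = 1.
Proof. by case: a => [[] i]; rewrite /sgn_ /star /= ?om_ef ?om_fe ?mulr1 ?eps2. Qed.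
Lemma sgn_star a : sgn_ (star a) = eps * sgn_ a.
Proof. by rewrite /sgn_ starK om_sym. Qed.

Lemma om_sgn x y : om x y = (x == star y)%:R * sgn_ y.
Proof.
case: eqP => [->|/eqP h]; first by rewrite mul1r.
by rewrite mul0r om_eq0 //; apply: contra h => /eqP ->; rewrite starK.
Qed.

Lemma natact_invariant c d b e :
  sgn_ b * nat_ c d (star b) (star e) = - nat_ c d e b * sgn_ e.
Proof.
rewrite /natact !om_sgn !starK !sgn_star [d == b]eq_sym [c == b]eq_sym [d == star e]eq_sym [c == star e]eq_sym.
have sb := sgn2 b; have se := sgn2 e; have e2 := eps2 symp.
by ring: sb se e2.
Qed.

Section Ring.
Variables (B : algType C) (k : nat) (Z : label -> label -> B).
Hypothesis hZ : relX symp k Z.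

Definition YY (a b : label) : B := sgn_ b *: Z a (star b).
Definition casimir : B := \sum_(a <- lbs k) \sum_(b <- lbs k) YY a b * YY b a.

Lemma YY_br c d a b : (c.2 < k)%N -> (d.2 < k)%N -> (a.2 < k)%N -> (b.2 < k)%N ->
  Z c d * YY a b - YY a b * Z c d =
  \sum_(e <- lbs k) nat_ c d a e *: YY e b - \sum_(e <- lbs k) nat_ c d e b *: YY a e.
Proof.
move=> ck dk ak bk; rewrite /YY -scalerAr -scalerAl -scalerBr (brX_natact hZ) // scalerDr; congr (_ + _).
  by rewrite scaler_sumr; apply: eq_bigr => e _; rewrite !scalerA mulrC.
rewrite scaler_sumr -sumrN -[LHS]sum_lbs_star; apply: eq_bigr => e _ /=.
by rewrite [LHS]scalerA natact_invariant mulNr scaleNr scalerA.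
Qed.

Lemma casimir_central c d : (c.2 < k)%N -> (d.2 < k)%N -> Z c d * casimir = casimir * Z c d.
Proof.
move=> ck dk; apply/eqP; rewrite -subr_eq0; apply/eqP.
rewrite /casimir mulr_sumr mulr_suml -sumrB.
pose P a b e := nat_ c d a e *: (YY e b * YY b a).
pose Q a b e := nat_ c d e b *: (YY a e * YY b a).
transitivity (\sum_(a <- lbs k) \sum_(b <- lbs k) \sum_(e <- lbs k) (P a b e - Q a b e + (Q a e b - P e b a))).
  apply: eq_big_seq => a; rewrite mem_lbs => ak; rewrite mulr_sumr mulr_suml -sumrB.
  apply: eq_big_seq => b; rewrite mem_lbs => bk.
  rewrite [LHS](_ : _ = (Z c d * YY a b - YY a b * Z c d) * YY b a + YY a b * (Z c d * YY b a - YY b a * Z c d)).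
    rewrite !YY_br // mulrBl mulrBr !mulr_suml !mulr_sumr -!sumrB -big_split; apply: eq_bigr => e _ /=.
    congr (_ - _ + (_ - _)); rewrite /P /Q; [exact/esym/scalerAl|exact/esym/scalerAl|exact/esym/scalerAr|exact/esym/scalerAr].
  by rewrite mulrBl mulrBr !mulrA addrA subrK.
have sumP : \sum_(a <- lbs k) \sum_(b <- lbs k) \sum_(e <- lbs k) P e b a = \sum_(a <- lbs k) \sum_(b <- lbs k) \sum_(e <- lbs k) P a b e.
  rewrite exchange_big [RHS]exchange_big /=; apply: eq_bigr => b _; exact: exchange_big.
have sumQ : \sum_(a <- lbs k) \sum_(b <- lbs k) \sum_(e <- lbs k) Q a e b = \sum_(a <- lbs k) \sum_(b <- lbs k) \sum_(e <- lbs k) Q a b e.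
  by apply: eq_bigr => a _; exact: exchange_big.
under eq_bigr do under eq_bigr do rewrite big_split !sumrB.
under eq_bigr do rewrite big_split !sumrB.
by rewrite big_split !sumrB sumP sumQ /= addrC addrA subrK subrr.
Qed.

Definition wt_diff (a b : label) : C := (b == a)%:R - (b == star a)%:R.

Lemma YY_diag_ad a c d : (a.2 < k)%N -> (c.2 < k)%N -> (d.2 < k)%N ->
  YY a a * Z c d - Z c d * YY a a = (wt_diff a c + wt_diff a d) *: Z c d.
Proof.
move=> ak ck dk; rewrite /YY -scalerAr -scalerAl -scalerBr (brX hZ) //= !om_sgn scalerDr scalerDl.
have sa := sgn2 a; have e2 := eps2 symp.
have e1 F x : sgn_ a *: (((star a == star x)%:R * sgn_ x) *: F a - (eps * ((a == star x)%:R * sgn_ x)) *: F (star a)) = wt_diff a x *: F x :> B.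
  rewrite /wt_diff (inj_eq (can_inj starK)) [a == x]eq_sym.
  have -> : (a == star x) = (x == star a) by rewrite eq_sym -[x in RHS]starK (inj_eq (can_inj starK)).
  case: (x =P a) => [->|_].
    have -> : (a == star a) = false by case: a {ak sa} => [[] i].
    by rewrite mul1r mul0r mulr0 scale0r !subr0 scalerA sa.
  rewrite mul0r scale0r !sub0r; case: (x =P star a) => [->|_].
    rewrite mul1r sgn_star mulrA e2 mul1r scalerN scalerA sa scale1r scaleN1r //.
  by rewrite mul0r mulr0 !scale0r oppr0 !scaler0 ?scale0r // oppr0 scale0r.
by rewrite (e1 (fun a => Z a d)) (e1 (fun a => Z c a)).
Qed.

Lemma YY_star a : (a.2 < k)%N -> YY (star a) (star a) = - YY a a.
Proof.
move=> ak; rewrite /YY starK sgn_star (hZ.1 a (star a)) // scalerA mulrN mulrAC eps2 mul1r.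
by rewrite scaleNr.
Qed.

Lemma YY_comm a b : (a.2 < k)%N -> (b.2 < k)%N -> b != a -> b != star a ->
  YY a b * YY b a - YY b a * YY a b = YY a a - YY b b.
Proof.
move=> ak bk ba bsa; rewrite /YY -!scalerAl -!scalerAr !scalerA [sgn_ a * _]mulrC -scalerBr hZ.2 //=.
have sa := sgn2 a; have sb := sgn2 b; have e2 := eps2 symp.
rewrite !om_sgn !starK sgn_star.
have -> : (star b == a) = false by rewrite -[a]starK (inj_eq (can_inj starK)) (negPf bsa).
have -> : (a == star b) = false by rewrite eq_sym -[a]starK (inj_eq (can_inj starK)) (negPf bsa).
rewrite !eqxx !(mul1r, mul0r, mulr0, scale0r, subr0) (hZ.1 b (star b)) // !scalerDr !scalerA.
congr (_ + _); first by congr (_ *: _); ring: sb.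
by rewrite -scaleNr; congr (_ *: _); ring: sa e2.
Qed.

Lemma YY_comm_star a : (a.2 < k)%N ->
  YY a (star a) * YY (star a) a - YY (star a) a * YY a (star a) = (2%:R - 2%:R * eps) *: YY a a.
Proof.
move=> ak; rewrite /YY starK -!scalerAl -!scalerAr !scalerA [sgn_ a * _]mulrC -scalerBr hZ.2 //=.
have sa := sgn2 a; have e2 := eps2 symp.
rewrite !om_sgn !starK eqxx !mul1r sgn_star -!scaleNr -!scalerDl !scalerA.
by congr (_ *: _); ring: sa e2.
Qed.
End Ring.

End Casimir.

Section CasimirTrace.
Variable symp : bool.
Local Notation eps := (eps symp).
(* The trace argument uses of matrices only the following: [R] stands for having real eigenvalues. *)
Variables (B : algType C) (tr : B -> C) (R : B -> Prop).
Hypotheses (trP : forall a (x y : B), tr (a *: x + y) = a * tr x + tr y) (trC : forall x y, tr (x * y) = tr (y * x)).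
Hypothesis R_sl2 : forall E F H : B, E * F - F * E = H -> H * E - E * H = E *+ 2 -> H * F - F * H = - (F *+ 2) -> R H.
Hypothesis R_add : forall x y, x * y = y * x -> R x -> R y -> R (x + y).
Hypothesis R_scale : forall r x, r \is Num.real -> R x -> R (r *: x).
Hypothesis R_sq : forall x, R x -> 0 <= tr (x * x) /\ (tr (x * x) = 0 -> exists N, x ^+ N = 0).
Hypothesis R_wt : forall (x y : B) N w, x ^+ N = 0 -> w != 0 -> x * y - y * x = w *: y -> y = 0.
Variables (k : nat) (Z : label -> label -> B).
Hypotheses (hZ : relX symp k Z) (k2 : (1 < k)%N).
Local Notation Y := (YY symp Z).
Local Notation sgn_ := (sgn_ symp).

Let tr0 : tr 0 = 0.
Proof. by have := trP (-1) 0 0; rewrite scaler0 addr0 mulN1r addNr. Qed.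
Let trZ a x : tr (a *: x) = a * tr x.
Proof. by rewrite -[a *: x]addr0 trP tr0 addr0. Qed.
Let trB x y : tr (x - y) = tr x - tr y.
Proof. by rewrite addrC -scaleN1r trP mulN1r addrC. Qed.
Let tr_sum (I : Type) (r : seq I) (F : I -> B) : tr (\sum_(i <- r) F i) = \sum_(i <- r) tr (F i).
Proof. by elim: r => [|i r IH]; rewrite ?big_nil // !big_cons -[F i]scale1r trP mul1r IH scale1r. Qed.

(* tr ([E, F] H) = tr ([H, E] F) *)
Let tr_inv E F H : tr (H * (E * F - F * E)) = tr ((H * E - E * H) * F).
Proof. by rewrite mulrBr mulrBl !trB !mulrA (trC (H * F)) mulrA. Qed.

Let two0 : (2%:R : C) != 0. Proof. by rewrite pnatr_eq0. Qed.

Lemma H_ad a b : (a.2 < k)%N -> (b.2 < k)%N -> b != a -> b != star a ->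
  (Y a a - Y b b) * Y a b - Y a b * (Y a a - Y b b) = Y a b *+ 2 /\
  (Y a a - Y b b) * Y b a - Y b a * (Y a a - Y b b) = - (Y b a *+ 2).
Proof.
move=> ak bk ba bsa.
have ns x : (x == star x) = false by case: x => [[] i].
have sn x : (star x == x) = false by case: x => [[] i].
have ad x c d : (x.2 < k)%N -> (c.2 < k)%N -> (d.2 < k)%N ->
    Y x x * Y c d = Y c d * Y x x + (wt_diff x c + wt_diff x (star d)) *: Y c d.
  move=> xk ck dk; set w := wt_diff x c + wt_diff x (star d); have eZ : Y x x * Z c (star d) = Z c (star d) * Y x x + w *: Z c (star d).
    by rewrite -(YY_diag_ad hZ) // addrC subrK.
  have -> : Y c d = sgn_ d *: Z c (star d) by [].
  by rewrite -(scalerAr (sgn_ d) (Y x x)) -(scalerAl (sgn_ d) _ (Y x x)) eZ scalerDr !scalerA [sgn_ d * _]mulrC.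
have abel (V : zmodType) (A A' p q : V) : A + p - (A' + q) - (A - A') = p - q.
  by rewrite opprD addrACA [A - A' + _]addrC addrK.
have e1 : (b == a) = false := negbTE ba.
have e2 : (a == b) = false by rewrite eq_sym.
have e3 : (b == star a) = false := negbTE bsa.
have e4 : (star a == b) = false by rewrite eq_sym.
have e5 : (star b == a) = false by rewrite -[a]starK (inj_eq (can_inj starK)).
have e6 : (a == star b) = false by rewrite eq_sym.
have e7 : (star b == star a) = false by rewrite (inj_eq (can_inj starK)).
have e8 : (star a == star b) = false by rewrite eq_sym.
have ee := (e1, e2, e3, e4, e5, e6, e7, e8, ns, sn, eqxx).
split; rewrite mulrBl mulrBr !ad // abel -scalerBl -scaler_nat -?scaleNr; congr (_ *: _).
  by rewrite /wt_diff !ee /=; ring.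
by rewrite /wt_diff !ee /=; ring.
Qed.

Lemma H_real a b : (a.2 < k)%N -> (b.2 < k)%N -> b != a -> b != star a -> R (Y a a - Y b b).
Proof.
move=> ak bk ba bsa; have [h1 h2] := H_ad ak bk ba bsa.
exact: (R_sl2 (YY_comm hZ ak bk ba bsa) h1 h2).
Qed.

Lemma diag_real a : (a.2 < k)%N -> R (Y a a).
Proof.
move=> ak; have [b [bk ba bsa]] : exists b : label, [/\ (b.2 < k)%N, b != a & b != star a].
  by exists (true, nat_of_bool (a.2 == 0)%N); split=> /=; [lia|case: a {ak} => [[] [|i]]|case: a {ak} => [[] [|i]]].
have sbk : ((star b).2 < k)%N by [].
have h1 := H_real ak bk ba bsa.
have h2 : R (Y a a - Y (star b) (star b)).
  apply: H_real => //; first by apply: contra bsa => /eqP <-; rewrite starK.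
  by apply: contra ba => /eqP/(can_inj starK) ->.
have -> : Y a a = 2%:R^-1 *: ((Y a a - Y b b) + (Y a a - Y (star b) (star b))).
  by rewrite (YY_star hZ bk) opprK addrACA addNr addr0 -mulr2n -scaler_nat scalerA mulVf ?scale1r.
apply: R_scale; first by rewrite realV realn.
apply: R_add => //; rewrite (YY_star hZ bk) opprK.
have cm : Y a a * Y b b = Y b b * Y a a.
  have -> : Y b b = sgn_ b *: Z b (star b) by [].
  apply/eqP; rewrite -subr_eq0 -(scalerAr _ (Y a a)) -(scalerAl _ _ (Y a a)) -scalerBr (YY_diag_ad hZ) //.
  rewrite /wt_diff (inj_eq (can_inj starK)) (negPf ba) (negPf bsa).
  have -> : (star b == a) = false by apply/negbTE; apply: contra bsa => /eqP <-; rewrite starK.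
  by rewrite subrr addr0 scale0r scaler0.
by apply: commrD; apply: commr_sym; apply: commrB; rewrite ?/GRing.comm ?cm.
Qed.

Lemma casimir_tr0 : tr (casimir symp k Z) = 0 -> forall a b, (a.2 < k)%N -> (b.2 < k)%N -> Z a b = 0.
Proof.
have key a b : (a.2 < k)%N -> (b.2 < k)%N -> 0 <= tr (Y a b * Y b a).
  move=> ak bk; case: (eqVneq b a) => [->|ba]; first by have [] := R_sq (diag_real ak).
  case: (eqVneq b (star a)) => [->|bsa].
    have [p _] := R_sq (diag_real ak).
    suff -> : tr (Y a (star a) * Y (star a) a) = (1 - eps) * tr (Y a a * Y a a).
      by apply: mulr_ge0 => //; case: symp; rewrite ?epsT ?epsF ?subrr // opprK addr_ge0.
    apply: (mulfI two0); rewrite [RHS](_ : _ = (2%:R - 2%:R * eps) * tr (Y a a * Y a a)); last by ring.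
    rewrite -[RHS]trZ scalerAr -(YY_comm_star hZ) // tr_inv.
    have ns : (a == star a) = false by case: (a) => [[] i].
    have e : Y a a * Y a (star a) - Y a (star a) * Y a a = 2%:R *: Y a (star a).
      have -> : Y a (star a) = sgn_ (star a) *: Z a a by rewrite /YY starK.
      rewrite -(scalerAr _ (Y a a)) -(scalerAl _ _ (Y a a)) -scalerBr (YY_diag_ad hZ) //.
      by rewrite /wt_diff eqxx ns subr0 scalerA mulrC -scalerA.
    by rewrite e -(scalerAl 2%:R (Y a (star a))) trZ.
  have [p _] := R_sq (H_real ak bk ba bsa).
  have [h1 _] := H_ad ak bk ba bsa.
  suff e : tr ((Y a a - Y b b) * (Y a a - Y b b)) = 2%:R * tr (Y a b * Y b a).
    by rewrite e pmulr_rge0 ?ltr0n in p.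
  by rewrite -{2}(YY_comm hZ ak bk ba bsa) tr_inv h1 -scaler_nat -scalerAl trZ.
rewrite /casimir tr_sum => trc0.
have nz a b : (a.2 < k)%N -> (b.2 < k)%N -> tr (Y a b * Y b a) = 0.
  move=> ak bk.
  have step (F : label -> C) : (forall x, (x.2 < k)%N -> 0 <= F x) -> \sum_(x <- lbs k) F x = 0 -> forall x, (x.2 < k)%N -> F x = 0.
    move=> F0 + x xk; rewrite (bigD1_seq x) ?mem_lbs ?uniq_lbs //= => /eqP.
    rewrite paddr_eq0 ?F0 //; first by case/andP => /eqP.
    by rewrite big_seq_cond; apply: sumr_ge0 => y; rewrite mem_lbs => /andP [/F0].
  apply: (step (fun b => tr (Y a b * Y b a))) bk; first by move=> x xk; apply: key.
  apply: (step (fun a => \sum_(b <- lbs k) tr (Y a b * Y b a))) ak => [x xk|].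
    by rewrite big_seq; apply: sumr_ge0 => y; rewrite mem_lbs => yk; apply: key.
  by rewrite -[RHS]trc0; apply: eq_bigr => a' _; rewrite tr_sum.
have Y0 a b : (a.2 < k)%N -> (b.2 < k)%N -> b != a -> b != star a -> Y a b = 0.
  move=> ak bk ba bsa; have [_ p] := R_sq (H_real ak bk ba bsa); have [h1 _] := H_ad ak bk ba bsa.
  have [N hN] : exists N, (Y a a - Y b b) ^+ N = 0.
    by apply: p; rewrite -{2}(YY_comm hZ ak bk ba bsa) tr_inv h1 -scaler_nat -scalerAl trZ nz // mulr0.
  by apply: (R_wt hN two0); rewrite h1 scaler_nat.
have D0 a : (a.2 < k)%N -> Y a a = 0.
  move=> ak; have [_ p] := R_sq (diag_real ak).
  have [b [bk ba bsa]] : exists b : label, [/\ (b.2 < k)%N, b != a & b != star a].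
    by exists (true, nat_of_bool (a.2 == 0)%N); split=> /=; [lia|case: a {ak p} => [[] [|i]]|case: a {ak p} => [[] [|i]]].
  have e1 := YY_comm hZ ak bk ba bsa.
  have e2 := @YY_comm symp B k Z hZ a (star b) ak bk.
  rewrite Y0 // mul0r mulr0 subrr in e1.
  have bs : star b != a by apply: contra bsa => /eqP <-; rewrite starK.
  have bs' : star b != star a by apply: contra ba => /eqP/(can_inj starK) ->.
  have {e2} := e2 bs bs'; rewrite Y0 // mul0r mulr0 subrr (YY_star hZ bk) opprK => e2.
  have := congr2 +%R e1 e2; rewrite addr0 addrACA addNr addr0 -mulr2n -scaler_nat => /esym/eqP.
  by rewrite scaler_eq0 (negPf two0) => /eqP.
move=> a b ak bk; case: (eqVneq (star b) (star a)) => [/(can_inj starK) ->|bsa].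
  have ns : (a == star a) = false by case: (a) => [[] i].
  have := YY_diag_ad hZ ak ak ak; rewrite D0 // mul0r mulr0 subrr /wt_diff eqxx ns subr0 => /esym/eqP.
  by rewrite scaler_eq0 -natrD (negPf two0) => /eqP.
have sg0 : sgn_ (star b) != 0.
  by apply/eqP => e; have := sgn2 symp (star b); rewrite e mul0r => /eqP; rewrite eq_sym oner_eq0.
apply/eqP; have : Y a (star b) = 0.
  by case: (eqVneq (star b) a) => [->|ba]; [apply: D0|apply: Y0].
by rewrite /YY starK => /eqP; rewrite scaler_eq0 (negPf sg0).
Qed.
End CasimirTrace.

Section Reynolds.
Variable symp : bool.

Lemma casimir_tr0_mx n k (Z : label -> label -> 'M[C]_n.+1) : relX symp k Z -> (1 < k)%N ->
  \tr (casimir symp k Z) = 0 -> forall a b, (a.2 < k)%N -> (b.2 < k)%N -> Z a b = 0.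
Proof.
move=> hZ k2; apply: (casimir_tr0 (tr := mxtrace) (R := @realeig n)) hZ k2.
- by move=> a x y; rewrite linearP.
- exact: mxtrace_mulC.
- exact: sl2_realeig.
- by move=> x y xy; apply: realeig_add.
- by move=> r x; apply: realeigZ.
- by move=> x /tr_sq [h1 h2]; split=> // /h2; exists n.+1.
- by move=> x y N w; apply: nil_weight0.
Qed.

Lemma conjmx_sum (m n : nat) (W : 'M[C]_(m, n)) (I : Type) (r : seq I) (F : I -> 'M[C]_n) :
  conjmx W (\sum_(i <- r) F i) = \sum_(i <- r) conjmx W (F i).
Proof. by rewrite /conjmx mulmx_sumr mulmx_suml. Qed.

Lemma conjmxZ (m n : nat) (W : 'M[C]_(m, n)) c (F : 'M[C]_n) : conjmx W (c *: F) = c *: conjmx W F.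
Proof. by rewrite /conjmx -scalemxAr -scalemxAl. Qed.

Lemma conjmx_relX n r k (Z : label -> label -> 'M[C]_n.+1) (W : 'M[C]_(r.+1, n.+1)) : relX symp k Z ->
  (forall a b, (a.2 < k)%N -> (b.2 < k)%N -> stablemx W (Z a b)) ->
  relX symp k (fun a b => conjmx W (Z a b) : 'M[C]_r.+1).
Proof.
move=> [h1 h2] st.
have cD (F G : 'M[C]_n.+1) : conjmx W (F + G) = conjmx W F + conjmx W G by rewrite /conjmx mulmxDr mulmxDl.
have cB (F G : 'M[C]_n.+1) : conjmx W (F - G) = conjmx W F - conjmx W G by rewrite /conjmx mulmxBr mulmxBl.
have cM (F G : 'M[C]_n.+1) : stablemx W F -> stablemx W G -> conjmx W (F * G) = conjmx W F * conjmx W G :> 'M[C]_r.+1.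
  by move=> sF sG; rewrite -!mulmxE conjmxM ?inE.
split=> [a b ak bk|a b c d ak bk ck dk]; first by rewrite h1 // conjmxZ.
by rewrite -!cM ?st // -cB h2 // cD !cB !conjmxZ.
Qed.

Lemma reynolds n k (Z : label -> label -> 'M[C]_n.+1) : relX symp k Z -> (1 < k)%N ->
  exists Pi : 'M[C]_n.+1,
    (forall a b, (a.2 < k)%N -> (b.2 < k)%N -> Pi *m Z a b = 0) /\
    forall (v : 'rV[C]_n.+1) (S : 'M[C]_n.+1),
      (forall a b, (a.2 < k)%N -> (b.2 < k)%N -> (v *m Z a b <= S)%MS) ->
      (forall a b, (a.2 < k)%N -> (b.2 < k)%N -> stablemx S (Z a b)) ->
      (v *m Pi - v <= S)%MS.
Proof.
move=> hZ k2; pose T : 'M[C]_n.+1 := casimir symp k Z.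
have TZ a b : (a.2 < k)%N -> (b.2 < k)%N -> Z a b *m T = T *m Z a b.
  by move=> ak bk; apply: casimir_central.
have p0 : char_poly T != 0 by rewrite monic_neq0 // char_poly_monic.
have [m [q]] := multiplicity_XsubC (char_poly T) 0; rewrite p0 subr0 => /= q0 pE.
have /Bezout_eq1_coprimepP [[u1 u2] /= bez] : coprimep ('X^(m.+1)) q.
  by apply: coprimep_expl; rewrite coprimep_sym coprimepX.
pose Pi : 'M[C]_n.+1 := horner_mx T (u2 * q).
have PiZ a b : (a.2 < k)%N -> (b.2 < k)%N -> Z a b *m Pi = Pi *m Z a b.
  by move=> ak bk; apply: comm_mx_horner; apply: TZ.
have TPi : T ^+ m.+1 *m Pi = 0.
  have : horner_mx T ('X^(m.+1) * (u2 * q)) = 0.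
    have -> : 'X^(m.+1) * (u2 * q) = ('X * u2) * char_poly T by rewrite pE exprS; ring.
    by rewrite rmorphM /= Cayley_Hamilton mulr0.
  by rewrite rmorphM /= rmorphXn /= horner_mx_X.
exists Pi; split; last first.
  move=> v S vS st.
  have stT : stablemx S T /\ (v *m T <= S)%MS.
    have [s1 s2] : (forall a, (a.2 < k)%N -> forall b, (b.2 < k)%N -> stablemx S (YY symp Z a b * YY symp Z b a)) /\
       (forall a, (a.2 < k)%N -> forall b, (b.2 < k)%N -> (v *m (YY symp Z a b * YY symp Z b a) <= S)%MS).
      have stY a b : (a.2 < k)%N -> (b.2 < k)%N -> stablemx S (YY symp Z a b).
        by move=> ak bk; rewrite /YY -scalemxAr scalemx_sub // st.
      split=> a ak b bk; first by apply: stablemxM; apply: stY.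
      rewrite mulmxA; apply: submx_trans (stY b a bk ak); apply: submxMr.
      by rewrite /YY -scalemxAr scalemx_sub // vS.
    split; rewrite /T /casimir mulmx_sumr big_seq; apply: summx_sub => a; rewrite mem_lbs => ak;
      rewrite mulmx_sumr big_seq; apply: summx_sub => b; rewrite mem_lbs => bk; [exact: s1|exact: s2].
  have e : Pi = 1 - horner_mx T (u1 * 'X^m) * T :> 'M[C]_n.+1.
    have -> : horner_mx T (u1 * 'X^m) * T = horner_mx T (u1 * 'X^(m.+1)).
      by rewrite exprSr mulrA [RHS]rmorphM /= horner_mx_X.
    by rewrite -(rmorph1 (horner_mx T)) -rmorphB /= -bez addrC addKr.
  rewrite e mulmxBr mulmx1 addrAC subrr add0r -mulmxN.
  have -> : horner_mx T (u1 * 'X^m) * T = T *m horner_mx T (u1 * 'X^m).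
    by rewrite -mulmxE; apply/esym; apply: comm_mx_horner.
  rewrite mulmxN eqmx_opp mulmxA; apply: submx_trans (submxMr _ stT.2) _.
  exact: horner_mx_stable stT.1.
have stPi a b : (a.2 < k)%N -> (b.2 < k)%N -> stablemx (row_base Pi) (Z a b).
  by move=> ak bk; rewrite stablemx_row_base -PiZ // submxMl.
have stT : stablemx (row_base Pi) T.
  rewrite stablemx_row_base -[X in (X <= _)%MS](_ : T *m Pi = _) ?submxMl //.
  by apply: comm_mx_horner.
suff Z0 a b : (a.2 < k)%N -> (b.2 < k)%N -> row_base Pi *m Z a b = 0.
  move=> a b ak bk.
  have /submxP [D ->] : (Pi <= row_base Pi)%MS by rewrite eq_row_base.
  by rewrite -mulmxA Z0 // mulmx0.
move=> ak bk; have -> : row_base Pi *m Z a b = conjmx (row_base Pi) (Z a b) *m row_base Pi.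
  by rewrite /conjmx mulmxKpV // stPi.
move: stPi stT (row_base_free Pi) (eq_row_base Pi).
move: (row_base Pi); case: (\rank Pi) => [|r] W stPi stT Wfree WE.
  by rewrite [W]flatmx0 mulmx0.
have hZ' := conjmx_relX hZ stPi.
rewrite (casimir_tr0_mx hZ' k2 _ ak bk) ?mul0mx //.
have stY c d : (c.2 < k)%N -> (d.2 < k)%N -> stablemx W (YY symp Z c d).
  by move=> ck dk; rewrite /YY -scalemxAr scalemx_sub // stPi.
have -> : casimir symp k (fun a b => conjmx W (Z a b) : 'M[C]_r.+1) = conjmx W T.
  rewrite /T /casimir conjmx_sum; apply: eq_big_seq => c; rewrite mem_lbs => ck.
  rewrite conjmx_sum; apply: eq_big_seq => d; rewrite mem_lbs => dk.
  by rewrite conjmxM ?inE ?stY // /YY !conjmxZ.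
apply: (@nil_tr0 r _ m.+1).
have TX j : conjmx W T ^+ j *m W = W *m T ^+ j.
  elim: j => [|j IH]; first by rewrite !expr0 mul1mx mulmx1.
  by rewrite !exprS -!mulmxE -mulmxA IH mulmxA /conjmx mulmxKpV // -mulmxA.
apply: (row_free_inj Wfree); rewrite TX mul0mx.
have /submxP [D ->] : (W <= Pi)%MS by rewrite WE.
have cT : Pi *m T ^+ m.+1 = T ^+ m.+1 *m Pi.
  by apply: (@commrX _ Pi T); apply: commr_sym; apply: (@comm_mx_horner _ _ T T).
by rewrite -mulmxA cT TPi mulmx0.
Qed.
End Reynolds.

Section Rep.
Variables (symp : bool) (A : algType C) (X : label -> label -> A).
Hypothesis hX : forall k, relX symp k X.

Definition is_rep (k n : nat) (R : A -> 'M[C]_n.+1) :=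
  [/\ R 1 = 1,
      (forall c u v, inU k X u -> inU k X v -> R (c *: u + v) = c *: R u + R v) &
      (forall u v, inU k X u -> inU k X v -> R (u * v) = R u * R v)].

Section FromIdeal.
Variables (m : nat) (J : A -> Prop).
Local Notation U := (inU m X).
Hypothesis hJ : fincodim_ideal U J.
Hypothesis J1 : ~ J 1.

Let J0 : J 0. Proof. by case: hJ. Qed.
Let JP a x y : J x -> J y -> J (a *: x + y). Proof. by case: hJ => _ _ h _ _; apply: h. Qed.
Let subJ : subspace J. Proof. by split. Qed.
Let JM u x : U u -> J x -> J (u * x) /\ J (x * u). Proof. by case: hJ => _ _ _ h _; apply: h. Qed.

Definition spanning (d : nat) :=
  exists s : 'I_d -> A, (forall i, U (s i)) /\
    forall u, U u -> exists c : 'I_d -> C, J (u - \sum_i c i *: s i).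

Lemma spanning_exists : exists d, spanning d.
Proof.
case: hJ => _ _ _ _ [s [sU hs]]; exists (size s), (fun i => s`_i); split.
  by move=> i; apply: sU; apply: mem_nth.
by move=> u /hs [j [c [Jj ->]]]; exists (fun i => c i); rewrite addrK.
Qed.

Lemma minimal_spanning : exists d (s : 'I_d.+1 -> A),
  [/\ forall i, U (s i),
      (forall u, U u -> exists c : 'I_d.+1 -> C, J (u - \sum_i c i *: s i)) &
      (forall c : 'I_d.+1 -> C, J (\sum_i c i *: s i) -> forall i, c i = 0)].
Proof.
have ex : exists d, `[< spanning d >] by have [d hd] := spanning_exists; exists d; apply/asboolP.
case: (ex_minnP ex) => -[|d] /asboolP [s [sU hs]] mind.
  by case: J1; have [c] := hs _ (gsub1 _); rewrite big_ord0 subr0.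
exists d, s; split=> // c Jc i; apply: contrapT => ci.
suff : (d.+1 <= d)%N by rewrite ltnn.
apply: mind; apply/asboolP; exists (fun j => s (lift i j)); split=> [j|u /hs [c' hc']]; first exact: sU.
have ci0 : c i != 0 by apply/eqP.
exists (fun j => c' (lift i j) - c' i / c i * c (lift i j)).
have -> : u - \sum_j (c' (lift i j) - c' i / c i * c (lift i j)) *: s (lift i j) =
    (c' i / c i) *: (\sum_j c j *: s j) + (u - \sum_j c' j *: s j).
  under eq_bigr do rewrite scalerBl -scalerA.
  rewrite sumrB -scaler_sumr (bigD1_ord i) //= [\sum_j c' j *: s j](bigD1_ord i) //=.
  rewrite scalerDr scalerA mulfVK // opprB opprD.
  by rewrite [RHS](AC (2*(1*2)) ((1*4)*(3*(2*5)))) /= subrr add0r.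
exact: JP.
Qed.

Lemma rep_exists : exists (n : nat) (R : A -> 'M[C]_n.+1),
  is_rep m R /\ forall u, U u -> (R u = 0 <-> J u).
Proof.
have [d [s [sU hs free]]] := minimal_spanning.
have uniqc (c c' : 'I_d.+1 -> C) u : J (u - \sum_i c i *: s i) -> J (u - \sum_i c' i *: s i) -> forall i, c i = c' i.
  move=> h h' i; apply/eqP; rewrite -subr_eq0; apply/eqP.
  apply: (free (fun i => c i - c' i)); under eq_bigr do rewrite scalerBl.
  rewrite sumrB; have := subspaceB subJ h' h.
  by rewrite opprB addrC addrA subrK.
have /choice [R hR] : forall u, exists M : 'M[C]_d.+1, U u -> forall i, J (s i * u - \sum_j M i j *: s j).
  move=> u; case: (pselect (U u)) => [Uu|]; last by exists 0.
  have /choice [M hM] : forall i, exists c : 'I_d.+1 -> C, J (s i * u - \sum_j c j *: s j).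
    by move=> i; apply: hs; apply: gsubM; [apply: sU|].
  exists (\matrix_(i, j) M i j) => _ i; under eq_bigr do rewrite mxE.
  exact: hM.
have RE u (M : 'M[C]_d.+1) : U u -> (forall i, J (s i * u - \sum_j M i j *: s j)) -> R u = M.
  by move=> Uu hM; apply/matrixP => i j; apply: (uniqc _ _ (s i * u)); [apply: hR|].
have Rmul (c : 'I_d.+1 -> C) u : U u -> J ((\sum_i c i *: s i) * u - \sum_j (\sum_i c i * R u i j) *: s j).
  move=> Uu; have -> : \sum_j (\sum_i c i * R u i j) *: s j = \sum_i c i *: \sum_j R u i j *: s j.
    under eq_bigr do rewrite scaler_suml; rewrite exchange_big; apply: eq_bigr => i _ /=.
    by rewrite scaler_sumr; apply: eq_bigr => j _; rewrite scalerA.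
  rewrite mulr_suml -sumrB; apply: (subspace_sum subJ) => i _.
  by rewrite -scalerAl -scalerBr; apply: (subspaceZ subJ); apply: hR.
exists d, R; split; first split.
- apply: RE; first exact: gsub1.
  move=> i; rewrite mulr1 (bigD1 i) //= mxE eqxx scale1r big1 ?addr0 ?subrr // => j ji.
  by rewrite mxE eq_sym (negPf ji) scale0r.
- move=> c u v Uu Uv; apply: RE; first exact: gsubP.
  move=> i; under eq_bigr do rewrite !mxE scalerDl -scalerA.
  rewrite big_split /= -scaler_sumr mulrDr -scalerAr opprD addrACA -scalerBr.
  by apply: JP; apply: hR.
- move=> u v Uu Uv; apply: RE; first exact: gsubM.
  move=> i; under eq_bigr do rewrite -mulmxE mxE.
  rewrite (_ : _ - _ = (s i * u - \sum_j R u i j *: s j) * v +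
     ((\sum_j R u i j *: s j) * v - \sum_j (\sum_k R u i k * R v k j) *: s j)).
    by apply: (subspaceD subJ); [apply: (JM Uv (hR _ Uu i)).2|apply: Rmul].
  by rewrite mulrBl mulrA addrA subrK.
move=> u Uu; split=> [R0|Ju].
  have [c hc] := hs _ (gsub1 _); have := (JM Uu hc).2; rewrite mulrBl mul1r => h.
  have := subspaceD subJ h (Rmul c u Uu); rewrite addrA subrK.
  by rewrite big1 ?subr0 // => j _; rewrite big1 ?scale0r // => i _; rewrite R0 mxE mulr0.
apply: RE => // i; rewrite big1 ?subr0; first by apply: (JM (sU i) Ju).1.
by move=> j _; rewrite mxE scale0r.
Qed.
End FromIdeal.

Section RepTheory.
Variables (k n : nat) (R : A -> 'M[C]_n.+1).
Hypothesis hR : is_rep k R.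
Local Notation U := (inU k X).

Lemma rep_lin c u v : U u -> U v -> R (c *: u + v) = c *: R u + R v.
Proof. by case: hR => _ h _; apply: h. Qed.
Lemma rep_mul u v : U u -> U v -> R (u * v) = R u * R v.
Proof. by case: hR => _ _ h; apply: h. Qed.
Lemma rep0 : R 0 = 0.
Proof. by have := rep_lin (-1) (gsub1 _) (gsub1 _); rewrite !scaleN1r !addNr. Qed.
Lemma repZ c u : U u -> R (c *: u) = c *: R u.
Proof. by move=> hu; have := rep_lin c hu (gsub0 _); rewrite !addr0 rep0 addr0. Qed.
Lemma repD u v : U u -> U v -> R (u + v) = R u + R v.
Proof. by move=> hu hv; have := rep_lin 1 hu hv; rewrite !scale1r. Qed.
Lemma repB u v : U u -> U v -> R (u - v) = R u - R v.
Proof. by move=> hu hv; have := rep_lin (-1) hv hu; rewrite !scaleN1r addrC => ->; rewrite addrC. Qed.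

Lemma rep_relX : relX symp k (fun a b => R (X a b) : 'M[C]_n.+1).
Proof.
split=> [a b ak bk|a b c d ak bk ck dk].
  by rewrite (hX k).1 // repZ //; apply: inU_X.
have Uab x y : (x.2 < k)%N -> (y.2 < k)%N -> U (X x y) by apply: inU_X.
have UZ c' x y : (x.2 < k)%N -> (y.2 < k)%N -> U (c' *: X x y) by move=> *; apply: gsubZ; apply: inU_X.
rewrite -!rep_mul; try exact: Uab.
rewrite -repB; [|by apply: gsubM; apply: Uab|by apply: gsubM; apply: Uab].
rewrite (hX k).2 // repD; [|by apply: gsubB; [apply: gsubB|]; apply: UZ|exact: UZ].
rewrite repB; [|by apply: gsubB; apply: UZ|exact: UZ].
by rewrite repB ?repZ //; try exact: Uab; exact: UZ.
Qed.

Lemma stable_rep (r : nat) (W : 'M[C]_(r, n.+1)) :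
  (forall a b, (a.2 < k)%N -> (b.2 < k)%N -> stablemx W (R (X a b))) ->
  forall u, U u -> stablemx W (R u).
Proof.
move=> st u hu; suff [] : stablemx W (R u) /\ U u by [].
elim: hu => {u} [|_ [t /andP [t1 t2] ->]|c u v hu [su Uu] hv [sv Uv]|u v hu [su Uu] hv [sv Uv]].
- by case: hR => -> _ _; rewrite mulmx1; split=> //; apply: gsub1.
- by split; [apply: st|apply: inU_X].
- split; last exact: gsubP.
  by rewrite rep_lin //; apply: stablemxD => //; rewrite -scalemxAr scalemx_sub.
- by split; [rewrite rep_mul //; apply: stablemxM|apply: gsubM].
Qed.

Lemma comm_rep (P : 'M[C]_n.+1) :
  (forall a b, (a.2 < k)%N -> (b.2 < k)%N -> P *m R (X a b) = R (X a b) *m P) ->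
  forall u, U u -> P *m R u = R u *m P.
Proof.
move=> st u hu; suff [] : P *m R u = R u *m P /\ U u by [].
elim: hu => {u} [|_ [t /andP [t1 t2] ->]|c u v hu [su Uu] hv [sv Uv]|u v hu [su Uu] hv [sv Uv]].
- by case: hR => -> _ _; rewrite mulmx1 mul1mx; split=> //; apply: gsub1.
- by split; [apply: st|apply: inU_X].
- split; last exact: gsubP.
  by rewrite rep_lin // mulmxDr mulmxDl -scalemxAr -scalemxAl su sv.
- split; last exact: gsubM.
  by rewrite rep_mul // -mulmxE mulmxA su -mulmxA sv mulmxA.
Qed.

End RepTheory.
End Rep.

Section RelXMaps.
Variable symp : bool.

Lemma relX_hom (B B' : algType C) k (X : label -> label -> B) (phi : B -> B') : relX symp k X ->
  (forall c x y, phi (c *: x + y) = c *: phi x + phi y) ->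
  (forall x y, phi x * phi y - phi y * phi x = phi (x * y - y * x)) ->
  relX symp k (fun a b => phi (X a b)).
Proof.
move=> [h1 h2] phiP phiM.
have phi0 : phi 0 = 0 by have := phiP (-1) 0 0; rewrite scaler0 addr0 scaleN1r addNr.
have phiZ c x : phi (c *: x) = c *: phi x by rewrite -[c *: x]addr0 phiP phi0 addr0.
have phiD x y : phi (x + y) = phi x + phi y by rewrite -{1}[x]scale1r phiP scale1r.
have phiB x y : phi (x - y) = phi x - phi y by rewrite addrC -scaleN1r phiP scaleN1r addrC.
split=> [a b ak bk|a b c d ak bk ck dk]; first by rewrite h1 // phiZ.
by rewrite phiM h2 // phiD !phiB !phiZ.
Qed.

Lemma relX_add (B : algType C) k (X X' : label -> label -> B) : relX symp k X -> relX symp k X' ->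
  (forall a b c d, X a b * X' c d = X' c d * X a b) -> relX symp k (fun a b => X a b + X' a b).
Proof.
move=> [h1 h2] [h1' h2'] cm; split=> [a b ak bk|a b c d ak bk ck dk].
  by rewrite h1 // h1' // scalerDr.
rewrite !scalerDr !mulrDl !mulrDr.
have -> : X a b * X c d + X a b * X' c d + (X' a b * X c d + X' a b * X' c d) -
   (X c d * X a b + X c d * X' a b + (X' c d * X a b + X' c d * X' a b)) =
   (X a b * X c d - X c d * X a b) + (X' a b * X' c d - X' c d * X' a b).
  rewrite (cm a b c d) (cm c d a b) !opprD.
  by rewrite [LHS](AC ((2*2)*(2*2)) (((1*5)*(4*8))*((2*7)*(3*6)))) /= !subrr !addr0.
rewrite h2 // h2' // !opprD.
by rewrite [LHS](AC ((1*1*1*1)*(1*1*1*1)) ((1*5)*(2*6)*(3*7)*(4*8))).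
Qed.
End RelXMaps.

Section AdjointMatrices.
Variable n : nat.
Definition adjoint_dim := (n + n * n.+1)%N.
Definition rmul_mx (Z : 'M[C]_n.+1) : 'M[C]_adjoint_dim.+1 := (lin_mx (@mulmxr C n.+1 n.+1 n.+1 Z) : 'M[C]_(n.+1 * n.+1)).
Definition lmul_mx (Z : 'M[C]_n.+1) : 'M[C]_adjoint_dim.+1 := (lin_mx (@mulmx C n.+1 n.+1 n.+1 Z) : 'M[C]_(n.+1 * n.+1)).
Definition mxv (M : 'M[C]_n.+1) : 'rV[C]_adjoint_dim.+1 := (mxvec M : 'rV[C]_(n.+1 * n.+1)).
Definition vmx (v : 'rV[C]_adjoint_dim.+1) : 'M[C]_n.+1 := vec_mx (v : 'rV[C]_(n.+1 * n.+1)).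

Lemma mxvK M : vmx (mxv M) = M.
Proof. exact: (@mxvecK C n.+1 n.+1 M). Qed.
Lemma vmxK v : mxv (vmx v) = v.
Proof. exact: (@vec_mxK C n.+1 n.+1 v). Qed.
Lemma rmul_mxE M Z : mxv M *m rmul_mx Z = mxv (M *m Z).
Proof. exact: (@mul_vec_lin C n.+1 n.+1 n.+1 n.+1 (mulmxr Z) M). Qed.
Lemma lmul_mxE M Z : mxv M *m lmul_mx Z = mxv (Z *m M).
Proof. exact: (@mul_vec_lin C n.+1 n.+1 n.+1 n.+1 (mulmx Z) M). Qed.
Lemma mxvP c M M' : mxv (c *: M + M') = c *: mxv M + mxv M'.
Proof. exact: (linearP (@mxvec C n.+1 n.+1)). Qed.

Lemma mxv0 : mxv 0 = 0.
Proof. exact: (linear0 (@mxvec C n.+1 n.+1)). Qed.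
Lemma mxv_eq0 M : mxv M = 0 -> M = 0.
Proof. by move=> e; rewrite -(mxvK M) e -mxv0 mxvK. Qed.
Lemma mxvB M M' : mxv (M - M') = mxv M - mxv M'.
Proof. by rewrite addrC -scaleN1r mxvP scaleN1r addrC. Qed.

Lemma mxv_ext (L L' : 'M[C]_adjoint_dim.+1) : (forall M, mxv M *m L = mxv M *m L') -> L = L'.
Proof. by move=> e; apply/row_matrixP => i; rewrite !rowE -[delta_mx _ _]vmxK e. Qed.

Lemma mxv_mul M (L L' : 'M[C]_adjoint_dim.+1) : mxv M *m (L * L') = mxv M *m L *m L'.
Proof. exact: mulmxA. Qed.

Lemma rmul_mx_lin c x y : rmul_mx (c *: x + y) = c *: rmul_mx x + rmul_mx y.
Proof.
by apply: mxv_ext => M; rewrite [RHS]mulmxDr -scalemxAr !rmul_mxE mulmxDr -scalemxAr mxvP.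
Qed.

Lemma lmul_mx_lin c x y : lmul_mx (c *: x + y) = c *: lmul_mx x + lmul_mx y.
Proof.
by apply: mxv_ext => M; rewrite [RHS]mulmxDr -scalemxAr !lmul_mxE mulmxDl -scalemxAl mxvP.
Qed.

Lemma rmul_mxM x y : rmul_mx x * rmul_mx y = rmul_mx (x * y).
Proof. by apply: mxv_ext => M; rewrite mxv_mul !rmul_mxE -mulmxA. Qed.

Lemma lmul_mxM x y : lmul_mx x * lmul_mx y = lmul_mx (y * x).
Proof. by apply: mxv_ext => M; rewrite mxv_mul !lmul_mxE mulmxA. Qed.

Lemma lrmul_mx_comm x y : lmul_mx x * rmul_mx y = rmul_mx y * lmul_mx x.
Proof. by apply: mxv_ext => M; rewrite !mxv_mul !(rmul_mxE, lmul_mxE) mulmxA. Qed.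

Lemma rmul_mxB x y : rmul_mx (x - y) = rmul_mx x - rmul_mx y.
Proof. by rewrite addrC -scaleN1r rmul_mx_lin scaleN1r addrC. Qed.

Lemma lmul_mxB x y : lmul_mx (x - y) = lmul_mx x - lmul_mx y.
Proof. by rewrite addrC -scaleN1r lmul_mx_lin scaleN1r addrC. Qed.
End AdjointMatrices.
Opaque rmul_mx lmul_mx.

Section Projection.
Variables (symp : bool) (A : algType C) (X : label -> label -> A).
Hypothesis hX : forall k, relX symp k X.
Variables (k n : nat) (R : A -> 'M[C]_n.+1).
Hypothesis hR : is_rep X k R.
Hypothesis k2 : (1 < k)%N.
Local Notation U := (inU k X).

(* Averaging a linear projection over the adjoint action, by the Casimir operator. *)
Lemma stable_projection (N : 'M[C]_n.+1) :
  (forall a b, (a.2 < k)%N -> (b.2 < k)%N -> stablemx N (R (X a b))) ->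
  exists P : 'M[C]_n.+1, [/\ (P <= N)%MS, N *m P = N & forall u, U u -> P *m R u = R u *m P].
Proof.
move=> st; have hr := rep_relX hX hR.
pose rr (Z : 'M[C]_n.+1) := rmul_mx Z; pose ll (Z : 'M[C]_n.+1) := - lmul_mx Z.
have h1 : relX symp k (fun a b => rr (R (X a b))).
  by apply: (relX_hom hr) => [c x y|x y]; [exact: rmul_mx_lin|rewrite /rr !rmul_mxM; exact/esym/rmul_mxB].
have h2 : relX symp k (fun a b => ll (R (X a b))).
  apply: (relX_hom hr) => [c x y|x y]; first by rewrite /ll lmul_mx_lin opprD scalerN.
  rewrite /ll !mulrNN !lmul_mxM -opprB; congr (- _); exact/esym/lmul_mxB.
have had : relX symp k (fun a b => rr (R (X a b)) + ll (R (X a b))).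
  by apply: relX_add => // a b c d; rewrite /ll mulrN mulNr lrmul_mx_comm.
have adE a b M : mxv M *m (rr (R (X a b)) + ll (R (X a b))) = mxv (M *m R (X a b) - R (X a b) *m M).
  by rewrite mulmxDr mulmxN rmul_mxE lmul_mxE mxvB.
have [Pi [PiK PiS]] := reynolds had k2.
pose P0 := proj_mx N (N^C)%MS.
have P0s : (P0 <= N)%MS by rewrite -[P0]mul1mx proj_mx_sub.
have P0N (W : 'M[C]_n.+1) : (W <= N)%MS -> W *m P0 = W.
  by move=> WN; apply: proj_mx_id => //; apply: capmx_compl.
clearbody P0; pose S : 'M[C]_((adjoint_dim n).+1) := (kermx (rmul_mx (cokermx N)) :&: kermx (lmul_mx N))%MS.
have SP M : (mxv M <= S)%MS <-> (M <= N)%MS /\ N *m M = 0.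
  rewrite sub_capmx; split.
    case/andP => /sub_kermxP + /sub_kermxP; rewrite rmul_mxE lmul_mxE => /mxv_eq0 e1 /mxv_eq0 e2.
    by rewrite submxE e1.
  by rewrite submxE => -[/eqP e1 e2]; apply/andP; split; apply/sub_kermxP; rewrite ?rmul_mxE ?lmul_mxE ?e1 ?e2 mxv0.
have hS : (mxv P0 *m Pi - mxv P0 <= S)%MS.
  apply: PiS => a b ak bk.
    rewrite adE; apply/SP; split.
      apply: addmx_sub; last by rewrite eqmx_opp; apply: mulmx_sub.
      by apply: submx_trans (st a b ak bk); apply: submxMr.
    by have h := st a b ak bk; rewrite mulmxBr !mulmxA (P0N N) ?submx_refl // (P0N _ h) subrr.
  apply/rV_subP => w /submxP [D ->].
  rewrite mulmxA; set v := D *m S; have : (v <= S)%MS by apply: submxMl.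
  rewrite -(vmxK v) => /SP [v1 v2]; rewrite adE; apply/SP; split.
    apply: addmx_sub; last by rewrite eqmx_opp; apply: mulmx_sub.
    by apply: submx_trans (st a b ak bk); apply: submxMr.
  rewrite mulmxBr !mulmxA v2 mul0mx sub0r; have /submxP [D' ->] := st a b ak bk.
  by rewrite -mulmxA v2 mulmx0 oppr0.
move: hS; have -> : mxv P0 *m Pi - mxv P0 = mxv (vmx (mxv P0 *m Pi) - P0) by rewrite mxvB vmxK.
set P := vmx _ => /SP [q1 q2].
exists P; split.
- by rewrite -(subrK P0 P); apply: addmx_sub.
- by rewrite -(subrK P0 P) mulmxDr q2 add0r P0N.
apply: (comm_rep hR) => a b ak bk; apply/eqP; rewrite -subr_eq0; apply/eqP; apply: mxv_eq0.
by rewrite -adE /P vmxK -mulmxA PiK // mulmx0.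
Qed.
End Projection.

(** * Highest weight vectors *)

Section HighestWeightRows.
Variables (symp : bool) (A : algType C) (X : label -> label -> A).
Hypothesis hX : forall k, relX symp k X.
Variables (k n : nat) (R : A -> 'M[C]_n.+1).
Hypothesis hR : is_rep X k R.
Local Notation U := (inU k X).
Local Notation gr2 := (gr2 symp).
Local Notation hel := (hel symp X).
Local Notation Xp := (Xp X).
Implicit Types (v w : 'rV[C]_n.+1).

Lemma rep_mulmx (x y : A) : U x -> U y -> R x *m R y = R (x * y).
Proof. by move=> hu hv; rewrite (rep_mul hR). Qed.

Definition grel : A := \sum_(i < k) ((i : nat).*2 + symp)%:R *: hel i.

Lemma inU_grel : U grel.
Proof. by apply: gsub_sum => i _; apply: gsubZ; apply: inU_hel. Qed.

Lemma grel_br t : below2 k t -> grel * Xp t = Xp t * grel + (gr2 t)%:~R *: Xp t.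
Proof.
move=> ht; have [ak bk] := andP ht.
have wtE (a : label) : (a.2 < k)%N -> \sum_(i < k) ((i : nat).*2 + symp)%:R * wt i a = (gr symp a)%:~R :> C.
  move=> ak'; rewrite (bigD1 (Ordinal ak')) //= big1 ?addr0; last first.
    by move=> i ia; rewrite /wt ifN ?mulr0 //; apply: contra ia => /eqP e; apply/eqP/val_inj.
  rewrite /wt eqxx; case: a ak' => [[] i] ik /=; rewrite grE ?mulr1 //.
  by rewrite mulrN1 mulrNz.
rewrite /grel mulr_suml mulr_sumr gr2E intrD -!wtE // -big_split scaler_suml -big_split /=.
apply: eq_bigr => i _; rewrite -scalerAl (ad_hel (hX k)) // scalerDr scalerA.
by rewrite -(scalerAr _ (Xp t) (hel i)) -mulrDr.
Qed.

Lemma eigen_letter v c t : below2 k t -> v *m R grel = c *: v ->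
  v *m R (Xp t) *m R grel = (c - (gr2 t)%:~R) *: (v *m R (Xp t)).
Proof.
move=> ht hv; have Ut : U (Xp t) by case/andP: ht => *; apply: inU_X.
have e : Xp t * grel = grel * Xp t - (gr2 t)%:~R *: Xp t by rewrite grel_br // addrK.
have Ug := inU_grel.
rewrite -mulmxA rep_mulmx // e (repB hR); [|by gsub_closed|by gsub_closed].
by rewrite (rep_mul hR) // (repZ hR) // mulmxBr -mulmxE mulmxA hv -scalemxAl -scalemxAr scalerBl.
Qed.

(* Finitely many eigenvalues, so moving up from a given one terminates. *)
Lemma eigenvalue_bound (M : 'M[C]_n.+1) c : exists N : nat, forall j v, (N <= j)%N ->
  v *m M = (c + j%:R) *: v -> v = 0.
Proof.
have [rs hrs] : exists rs : seq C, char_poly M = \prod_(z <- rs) ('X - z%:P).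
  have [rs e] := closed_field_poly_normal (char_poly M).
  by exists rs; rewrite e (monicP (char_poly_monic M)) scale1r.
have [N hN] : exists N : nat, forall j, (N <= j)%N -> c + j%:R \notin rs.
  elim: (rs) => [|r s [N hN]]; first by exists 0%N.
  case: (pselect (exists j : nat, c + j%:R = r)) => [[j0 e]|ne].
    exists (maxn N j0.+1) => j; rewrite geq_max => /andP [Nj jj].
    rewrite inE negb_or hN // andbT -e; apply/eqP => /addrI /eqP; rewrite eqr_nat => /eqP; lia.
  exists N => j Nj; rewrite inE negb_or hN // andbT; apply/eqP => e; apply: ne; by exists j.
exists N => j v Nj hv; apply/eqP; apply: contraT => v0.
have : eigenvalue M (c + j%:R) by apply/eigenvalueP; exists v.
by rewrite eigenvalue_root_char hrs root_prod_XsubC (negPf (hN j Nj)).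
Qed.

Definition hw_row v (lam : nat -> C) :=
  [/\ v != 0, forall t, below2 k t -> gr2 t < 0 -> v *m R (Xp t) = 0 &
      forall i, (i < k)%N -> v *m R (hel i) = lam i *: v].

Lemma hw_row_exists (W : 'M[C]_n.+1) : W != 0 ->
  (forall a b, (a.2 < k)%N -> (b.2 < k)%N -> stablemx W (R (X a b))) ->
  exists v lam, hw_row v lam /\ (v <= W)%MS.
Proof.
move=> W0 st; have stU := stable_rep hR st.
have [v0 [v0n v0W hv0]] : exists v0 : 'rV[C]_n.+1, [/\ v0 != 0, (v0 <= W)%MS & exists c, v0 *m R grel = c *: v0].
  have [|B C'|v [h1 h2 h3]] := @common_eigenrow n.+1 [:: R grel] W W0.
  - by move=> B; rewrite inE => /eqP ->; apply: stU; apply: inU_grel.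
  - by rewrite !inE => /eqP -> /eqP ->.
  by exists v; split=> //; apply: h3; apply: mem_head.
have [c hc] := hv0.
pose E (j : nat) : 'M[C]_n.+1 := (W :&: eigenspace (R grel) (c + j%:R))%MS.
have [N hN] := eigenvalue_bound (R grel) c.
have E0 : E 0%N != 0.
  apply: contraNneq v0n => e; rewrite -submx0 -e sub_capmx v0W; apply/eigenspaceP.
  by rewrite addr0.
have ex : exists j, E j != 0 by exists 0%N.
have bnd j : E j != 0 -> (j <= N)%N.
  move=> /rowV0Pn [v]; rewrite sub_capmx => /andP [_ /eigenspaceP hv]; apply: contraNT.
  by rewrite -ltnNge => Nj; rewrite (hN j v) // ltnW.
case: (ex_maxnP ex bnd) => j Ej jmax.
have stE A' : A' \in [seq R (hel i) | i <- iota 0 k] -> stablemx (E j) A'.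
  case/mapP => i; rewrite mem_iota => ik ->; apply/rV_subP => w.
  case/submxP => D ->; rewrite mulmxA; set u := D *m E j.
  have : (u <= E j)%MS by apply: submxMl.
  rewrite sub_capmx => /andP [uW /eigenspaceP hu]; rewrite sub_capmx; apply/andP; split.
    by apply: submx_trans (stU _ (inU_hel symp X ik)); apply: submxMr.
  apply/eigenspaceP; rewrite -mulmxA rep_mulmx; [|exact: inU_hel|exact: inU_grel].
  have -> : hel i * grel = grel * hel i.
    rewrite /grel mulr_sumr mulr_suml; apply: eq_bigr => l _.
    by rewrite -(scalerAr _ (hel i)) -(scalerAl _ _ (hel i)) (hel_comm (hX k)).
  by rewrite (rep_mul hR) -?mulmxE ?mulmxA ?hu -?scalemxAl //; [exact: inU_grel|exact: inU_hel].
have [|v [vn vE hv]] := common_eigenrow Ej stE.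
  move=> A1 A2 /mapP [i + ->] /mapP [l + ->]; rewrite !mem_iota => ik lk.
  have Ui := inU_hel symp X ik; have Ul := inU_hel symp X lk.
  by rewrite !rep_mulmx // (hel_comm (hX k)).
have /choice [lam hlam] : forall i, exists c', (i < k)%N -> v *m R (hel i) = c' *: v.
  move=> i; case: (ltnP i k) => ik; last by exists 0.
  by have [|c' hc'] := hv (R (hel i)); [apply: map_f; rewrite mem_iota|exists c'].
move: (vE); rewrite sub_capmx => /andP [vW /eigenspaceP hvc].
exists v, lam; split=> //; split=> // t ht tneg; apply/eqP; apply: contraT => nz.
have [m [m0 em]] : exists m : nat, (0 < m)%N /\ gr2 t = - m%:Z.
  by move: tneg; clear=> tneg; exists (absz (gr2 t)); split; lia.
have := eigen_letter ht hvc; rewrite em mulrNz opprK -addrA -natrD => hvt.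
suff : E (j + m)%N != 0 by move/jmax; move: m0; clear; lia.
apply: contraNneq nz => e; rewrite -submx0 -e sub_capmx; apply/andP; split; last exact/eigenspaceP.
apply: submx_trans (stU _ _); first exact: submxMr vW.
by case/andP: ht => *; apply: inU_X.
Qed.

Section Row.
Variables (th : 'rV[C]_n.+1) (lam : nat -> C).
Hypothesis hth : hw_row th lam.

Lemma hw_row_grel : exists c, th *m R grel = c *: th.
Proof.
case: hth => _ _ hh; exists (\sum_(i < k) ((i : nat).*2 + symp)%:R * lam i).
have -> : R grel = \sum_(i < k) ((i : nat).*2 + symp)%:R *: R (hel i).
  rewrite /grel; suff [] : R (\sum_(i < k) ((i : nat).*2 + symp)%:R *: hel i) = \sum_(i < k) ((i : nat).*2 + symp)%:R *: R (hel i) /\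
     U (\sum_(i < k) ((i : nat).*2 + symp)%:R *: hel i) by [].
  elim/big_rec2: _ => [|i M u _ [e hu]]; first by rewrite (rep0 hR); split=> //; apply: gsub0.
  split; last by apply: gsubP => //; apply: inU_hel.
  by rewrite (rep_lin hR) // ?e //; apply: inU_hel.
rewrite mulmx_sumr scaler_suml; apply: eq_bigr => i _.
by rewrite -scalemxAr hh // scalerA.
Qed.

Lemma hw_row_cases u : U u -> exists c w, th *m R u = c *: th + w /\
  forall Q : 'rV[C]_n.+1 -> Prop, Q 0 -> (forall a x y, Q x -> Q y -> Q (a *: x + y)) ->
   (forall t u', below2 k t -> 0 < gr2 t -> all (below2 k) u' -> sorted (relpre (hw_rank symp) leq) (rcons u' t) ->
     Q (th *m R (wprod Xp (rcons u' t)))) -> Q w.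
Proof.
move=> hu; case: (hth) => th0 hneg hh.
suff [] : (exists c w, th *m R u = c *: th + w /\ forall Q : 'rV[C]_n.+1 -> Prop, Q 0 -> (forall a x y, Q x -> Q y -> Q (a *: x + y)) ->
   (forall t u', below2 k t -> 0 < gr2 t -> all (below2 k) u' -> sorted (relpre (hw_rank symp) leq) (rcons u' t) -> Q (th *m R (wprod Xp (rcons u' t)))) -> Q w) /\ U u by [].
apply: (lspan_ind_lin (P := fun u => (exists c w, th *m R u = c *: th + w /\ forall Q : 'rV[C]_n.+1 -> Prop, Q 0 -> (forall a x y, Q x -> Q y -> Q (a *: x + y)) ->
   (forall t u', below2 k t -> 0 < gr2 t -> all (below2 k) u' -> sorted (relpre (hw_rank symp) leq) (rcons u' t) -> Q (th *m R (wprod Xp (rcons u' t)))) -> Q w) /\ U u)) (pbw_hw (hX k) hu).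
- split; last exact: gsub0.
  by exists 0, 0; rewrite (rep0 hR) mulmx0 scale0r addr0.
- move=> a x y [[c1 [w1 [e1 q1]]] U1] [[c2 [w2 [e2 q2]]] U2]; split; last exact: gsubP.
  exists (a * c1 + c2), (a *: w1 + w2); split.
    by rewrite (rep_lin hR) // mulmxDr -scalemxAr e1 e2 scalerDr scalerA scalerDl addrACA.
  by move=> Q Q0 QP Qw; exact: (QP _ _ _ (q1 Q Q0 QP Qw) (q2 Q Q0 QP Qw)).
move=> _ [w [hw srt ->]]; have Uw := inU_word X hw; split=> //.
case: (sorted_word_cases hw srt) => [w0|[t [w' [we ht tneg hw']]]|[t [w' [we ht tpos hw']]]].
- have [c hc] : exists c, th *m R (wprod Xp w) = c *: th.
    elim: w hw w0 {srt Uw} => [_ _|t w IH /= /andP [ht hw] /andP [/eqP t0 w0]].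
      by exists 1; rewrite wprod_nil; case: hR => -> _ _; rewrite mulmx1 scale1r.
    have [c hc] := IH hw w0; have [a [i [ik e]]] := X_zero (hX k) ht t0.
    have Uw := inU_word X hw; have Uh := inU_hel symp X ik.
    exists (a * lam i * c); rewrite wprod_cons e -scalerAl (repZ hR); last by gsub_closed.
    by rewrite (rep_mul hR) // -scalemxAr -mulmxE mulmxA hh // -scalemxAl hc !scalerA.
  by exists c, 0; rewrite hc addr0.
- exists 0, 0; rewrite scale0r addr0 we wprod_cons (rep_mul hR).
  + by rewrite -mulmxE mulmxA hneg // mul0mx.
  + by case/andP: ht => *; apply: inU_X.
  + exact: inU_word.
- exists 0, (th *m R (wprod Xp w)); rewrite scale0r add0r; split=> // Q _ _ Qw.
  by rewrite we; apply: Qw => //; rewrite -we.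
Qed.
End Row.
End HighestWeightRows.

Lemma subspace_mx n (S : 'rV[C]_n -> Prop) : S 0 ->
  (forall a x y, S x -> S y -> S (a *: x + y)) ->
  exists W : 'M[C]_n, forall v, (v <= W)%MS <-> S v.
Proof.
move=> S0 SP.
pose ok (r : nat) := `[< exists W : 'M[C]_n, \rank W = r /\ forall v : 'rV_n, (v <= W)%MS -> S v >].
have ex : exists r, ok r.
  by exists 0%N; apply/asboolP; exists 0; rewrite mxrank0; split=> // v; rewrite submx0 => /eqP ->.
have bnd r : ok r -> (r <= n)%N by move=> /asboolP [W [<- _]]; apply: rank_leq_col.
case: (ex_maxnP ex bnd) => r /asboolP [W [rW hW]] rmax; exists W => v; split; first exact: hW.
move=> Sv; apply: contrapT => nv.
have : ok (\rank (W + <<v>>)%MS).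
  apply/asboolP; exists (W + <<v>>)%MS; split=> // u /sub_addsmxP [[D E] /= ->].
  have h1 : S (D *m W) by apply: hW; apply: submxMl.
  have [a ->] : exists a, E *m <<v>>%MS = a *: v.
    by apply/sub_rVP; rewrite (submx_trans (submxMl _ _)) // genmxE.
  by rewrite addrC; apply: SP.
move/rmax; rewrite -rW leqNgt => /negP; apply.
rewrite ltn_neqAle mxrankS ?addsmxSl // andbT; apply/negP => /eqP e.
have := (mxrank_leqif_eq (addsmxSl W <<v>>%MS)).2; rewrite e eqxx => /esym /andP [_ h].
apply: nv; apply: submx_trans h.
by rewrite (submx_trans _ (addsmxSr _ _)) // genmxE.
Qed.

Section HighestWeightFunctionals.
Variables (symp : bool) (A : algType C) (X : label -> label -> A).
Hypothesis hX : forall k, relX symp k X.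
Variables (k n : nat) (R : A -> 'M[C]_n.+1).
Hypothesis hR : is_rep X k R.
Local Notation U := (inU k X).
Local Notation gr2 := (gr2 symp).
Local Notation hel := (hel symp X).
Local Notation Xp := (Xp X).
Local Notation grel := (grel symp X k).

Lemma eig_prod (M : 'M[C]_n.+1) (N : nat) (a : nat -> C) c (z : 'rV[C]_n.+1) : z *m M = c *: z ->
  z *m (\prod_(j < N) (M - (a j)%:M)) = (\prod_(j < N) (c - a j)) *: z.
Proof.
move=> hz; elim: N => [|N IH]; first by rewrite !big_ord0 mulmx1 scale1r.
rewrite !big_ord_recr /= -mulmxE mulmxA IH -scalemxAl mulmxBr hz mul_mx_scalar -scalerBl scalerA.
by [].
Qed.

Section Row.
Variables (th : 'rV[C]_n.+1) (lam : nat -> C) (c0 : C).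
Hypothesis hth : hw_row symp X k R th lam.
Hypothesis hc0 : th *m R grel = c0 *: th.

Definition lower_row := lspan (fun z : 'rV[C]_n.+1 => exists m : nat, z *m R grel = (c0 - m.+1%:R) *: z).

Lemma lower_row_letter z t : below2 k t -> 0 < gr2 t -> lower_row z -> lower_row (z *m R (Xp t)).
Proof.
move=> ht tpos; elim=> [|a x y [m hm] _ IH]; first by rewrite mul0mx; apply: lspan0.
rewrite mulmxDl -scalemxAl; apply: lspan_cons => //.
have [j [j0 ej]] : exists j : nat, (0 < j)%N /\ gr2 t = j%:Z by exists (absz (gr2 t)); split; lia.
exists (m + j)%N; rewrite (eigen_letter hX hR ht hm) ej.
by congr (_ *: _); rewrite -addSn natrD opprD addrA -pmulrn.
Qed.

Lemma lower_row_first t : below2 k t -> 0 < gr2 t -> lower_row (th *m R (Xp t)).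
Proof.
move=> ht tpos; apply: lspan_sub.
have [j [j0 ej]] : exists j : nat, (0 < j)%N /\ gr2 t = j.-1.+1%:Z by exists (absz (gr2 t)); split; lia.
by exists j.-1; rewrite (eigen_letter hX hR ht hc0) ej.
Qed.

Lemma lower_row_cases (v : 'cV[C]_n.+1) u :
  (forall t u', below2 k t -> 0 < gr2 t -> U u' -> th *m R (u' * Xp t) *m v = 0) ->
  U u -> exists c w, [/\ th *m R u = c *: th + w, lower_row w & w *m v = 0].
Proof.
move=> hv hu; have [c [w [e hw]]] := hw_row_cases hX hR hth hu; exists c, w; split=> //; last first.
  apply: (hw (fun w => w *m v = 0)) => [|a x y ex ey|t u' ht tpos hu' srt]; first by rewrite mul0mx.
    by rewrite mulmxDl -scalemxAl ex ey scaler0 addr0.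
  by rewrite -cats1 wprod_cat {2}/wprod big_seq1 hv //; apply: inU_word.
apply: (hw lower_row) => [|a x y|]; [exact: lspan0|exact: lspanP|] => t u' ht tpos hu' srt.
case: (hth) => _ hneg hh.
have hrc : all (below2 k) (rcons u' t) by rewrite all_rcons ht.
have tr : transitive (relpre (hw_rank symp) leq) by move=> x y z; apply: leq_trans.
elim: u' hu' srt hrc => [_ _ _|s u' IH /= /andP [hs hu'] srt /andP [_ hrc]].
  by rewrite /wprod big_seq1; apply: lower_row_first.
have Uw := inU_word X hrc.
have Us : U (Xp s) by case/andP: hs => *; apply: inU_X.
rewrite wprod_cons (rep_mul hR) // -mulmxE mulmxA.
case: (ltgtP (gr2 s) 0) => [sneg|spos|s0].
- by rewrite hneg // mul0mx; apply: lspan0.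
- have pos : all (fun r => 0 < gr2 r) (rcons u' t).
    apply/allP => r rw; have /= := allP (order_path_min tr srt) r rw.
    rewrite {1}/hw_rank ltNge (ltW spos) /= gt_eqF // /hw_rank.
    by case: ltgtP.
  have := lower_row_first hs spos; move: (rcons u' t) hrc pos (th *m R (Xp s)) {srt Uw IH}.
  elim=> [|r w' IH] hal pos z hz; first by rewrite wprod_nil; case: hR => -> _ _; rewrite mulmx1.
  move: hal pos => /= /andP [hr hal] /andP [rpos pos].
  have Ur : U (Xp r) by case/andP: hr => *; apply: inU_X.
  have Uw := inU_word X hal.
  rewrite wprod_cons (rep_mul hR) //.
  by rewrite -mulmxE mulmxA; apply: IH => //; apply: lower_row_letter.
- have [a [i [ik ->]]] := X_zero (hX k) hs s0.
  rewrite (repZ hR); last exact: inU_hel.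
  rewrite -scalemxAr hh // scalerA -scalemxAl; apply: lspanZ; apply: IH => //.
  exact: path_sorted srt.
Qed.

Lemma lower_row_sep : exists Qm : 'M[C]_n.+1, exists2 p, p != 0 &
  (forall z : 'rV[C]_n.+1, z *m R grel = c0 *: z -> z *m Qm = p *: z) /\ (forall z, lower_row z -> z *m Qm = 0).
Proof.
have [N hN] := eigenvalue_bound (- R grel) (- c0).
pose a (j : nat) := c0 - j.+1%:R.
exists (\prod_(j < N) (R grel - (a j)%:M)), (\prod_(j < N) (c0 - a j)).
  by apply/prodf_neq0 => j _; rewrite /a opprB addrC subrK pnatr_eq0.
split=> [z hz|z]; first exact: eig_prod.
elim=> [|b x y [m hm] _ IH]; first by rewrite mul0mx.
rewrite mulmxDl -scalemxAl IH addr0 (eig_prod _ _ hm).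
case: (ltnP m N) => mN; first by rewrite (bigD1 (Ordinal mN)) //= /a subrr mul0r scale0r scaler0.
rewrite (hN m.+1 x) ?scaler0 //; first by apply: leqW.
by rewrite mulmxN hm -scaleNr opprB addrC.
Qed.

Lemma hw_column : exists v : 'cV[C]_n.+1, th *m v = 1%:M /\
  forall t u, below2 k t -> 0 < gr2 t -> U u -> th *m R (u * Xp t) *m v = 0.
Proof.
suff [v [hv1 hvl]] : exists v : 'cV[C]_n.+1, th *m v = 1%:M /\ forall w, lower_row w -> w *m v = 0.
  exists v; split=> // t u ht tpos hu.
  have [|c [w [e hw _]]] := @lower_row_cases 0 u _ hu; first by move=> *; rewrite mulmx0.
  rewrite (rep_mul hR) //; last by case/andP: ht => *; apply: inU_X.
  rewrite -mulmxE mulmxA e mulmxDl -scalemxAl mulmxDl -scalemxAl !hvl ?scaler0 ?addr0 //.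
    exact: lower_row_letter.
  exact: lower_row_first.
have [Qm [p p0 [hp hl]]] := lower_row_sep.
case: (hth) => th0 _ _.
have [i ti] : exists i, th 0 i != 0.
  apply: contrapT => h; case/eqP: th0; apply/rowP => i; rewrite mxE; apply: contrapT => /eqP ti.
  by apply: h; exists i.
exists (Qm *m ((p * th 0 i)^-1 *: delta_mx i 0)); split=> [|w hw]; last by rewrite mulmxA hl // mul0mx.
rewrite mulmxA hp // -scalemxAl -scalemxAr scalerA; apply/matrixP => r s; rewrite !ord1 !mxE.
rewrite (bigD1 i) //= big1 ?addr0 => [|j ji]; rewrite !mxE ?eqxx ?mulr1 ?(negPf ji) ?mulr0 //.
rewrite invfM mulrA mulfV // mul1r mulVf //.
Qed.

Section Column.
Variable v : 'cV[C]_n.+1.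
Hypotheses (hv1 : th *m v = 1%:M) (hvl : forall t u, below2 k t -> 0 < gr2 t -> U u -> th *m R (u * Xp t) *m v = 0).

Definition rep_fun (u : A) : C := (th *m R u *m v) 0 0.

Lemma rep_fun1 : rep_fun 1 = 1.
Proof. by rewrite /rep_fun; case: hR => -> _ _; rewrite mulmx1 hv1 mxE. Qed.

Lemma rep_fun_hwf : hwf symp k X rep_fun lam.
Proof.
case: (hth) => th0 hneg hh; split.
- by move=> c u w hu hw; rewrite /rep_fun (rep_lin hR) // mulmxDr mulmxDl -scalemxAr -scalemxAl !mxE.
- move=> t u ht tneg hu; rewrite /rep_fun (rep_mul hR) //; last by case/andP: ht => *; apply: inU_X.
  by rewrite -mulmxE mulmxA hneg // !mul0mx mxE.
- by move=> t u ht tpos hu; rewrite /rep_fun hvl // mxE.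
- move=> i u ik hu; rewrite /rep_fun (rep_mul hR) //; last exact: inU_hel.
  by rewrite -mulmxE mulmxA hh // -!scalemxAl mxE.
Qed.

Hypothesis k2 : (1 < k)%N.

(* The submodule generated by a nonzero row of [th * U * x * U] has an invariant complement, so it contains [th]. *)
Lemma rep_fun_nonzero x u0 u1 : U x -> U u0 -> U u1 -> th *m R (u0 * x * u1) != 0 ->
  exists w0 w1, [/\ U w0, U w1 & rep_fun (w0 * x * w1) != 0].
Proof.
move=> Ux Uu0 Uu1 nz; apply: contrapT => all0.
pose S (z : 'rV[C]_n.+1) := exists2 y, lspan (fun y => exists w0 w1, [/\ U w0, U w1 & y = w0 * x * w1]) y & z = th *m R y.
have SU y : lspan (fun y => exists w0 w1, [/\ U w0, U w1 & y = w0 * x * w1]) y -> U y.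
  by apply: gsub_lspan => _ [w0 [w1 [h0 h1 ->]]]; gsub_closed.
have [|a z z' [y hy ->] [y' hy' ->]|W hW] := @subspace_mx _ S.
- by exists 0; [exact: lspan0|rewrite (rep0 hR) mulmx0].
- by exists (a *: y + y'); [exact: lspanP|rewrite (rep_lin hR) ?mulmxDr -?scalemxAr //; exact: SU].
have Sv0 z : S z -> z *m v = 0.
  move=> [y hy ->]; apply/matrixP => i j; rewrite !ord1 [RHS]mxE -/(rep_fun y).
  suff [] : rep_fun y = 0 /\ U y by [].
  apply: (lspan_ind_lin (P := fun y => rep_fun y = 0 /\ U y)) hy.
  - by rewrite (hwf0 rep_fun_hwf); split=> //; apply: gsub0.
  - move=> a y1 y2 [e1 h1] [e2 h2]; split; last exact: gsubP.
    by rewrite (hwf_lin rep_fun_hwf) // e1 e2 mulr0 addr0.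
  move=> _ [w0 [w1 [h0 h1 ->]]]; split; last by gsub_closed.
  by apply: contrapT => /eqP h; apply: all0; exists w0, w1.
have stW a b : (a.2 < k)%N -> (b.2 < k)%N -> stablemx W (R (X a b)).
  move=> ak bk; apply/rV_subP => z /submxP [D ->]; rewrite mulmxA.
  have /hW [y hy ->] : (D *m W <= W)%MS by apply: submxMl.
  have UX := inU_X X ak bk.
  apply/hW; exists (y * X a b); last by rewrite -mulmxA (rep_mulmx hR) //; exact: SU.
  apply: (lspan_mul (S' := fun z => z = X a b)) hy (lspan_sub _) => // _ _ [w0 [w1 [h0 h1 ->]]] ->.
  by apply: lspan_sub; exists w0, (w1 * X a b); split=> //; [gsub_closed|rewrite !mulrA].
have [P [PW WP Pc]] := stable_projection hX hR k2 stW.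
have thP : th *m P = 0.
  have /hW [y hy e] : (th *m P <= W)%MS by apply: mulmx_sub.
  have [c [w [e1 hw wv]]] := lower_row_cases hvl (SU _ hy).
  have c00 : c = 0.
    have /Sv0 : S (th *m P) by exists y.
    rewrite e e1 mulmxDl -scalemxAl hv1 wv addr0 => /matrixP /(_ 0 0).
    by rewrite !mxE mulr1.
  rewrite c00 scale0r add0r in e1.
  have [Qm [p p0 [hp hl]]] := lower_row_sep.
  have h1 : th *m P *m R grel = c0 *: (th *m P).
    have Ug : U grel by apply: inU_grel.
    by rewrite -[LHS]mulmxA (Pc _ Ug) mulmxA hc0 -scalemxAl.
  have := hp _ h1; rewrite {1}e e1 hl // => /esym/eqP.
  by rewrite scaler_eq0 (negPf p0) => /eqP.
case/eqP: nz; have Uy : U (u0 * x * u1) by gsub_closed.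
have /hW /submxP [D e] : S (th *m R (u0 * x * u1)).
  by exists (u0 * x * u1) => //; apply: lspan_sub; exists u0, u1.
by rewrite e -WP mulmxA -e -mulmxA -Pc // mulmxA thP mul0mx.
Qed.
End Column.
End Row.

Lemma hw_row_acts x : (1 < k)%N -> U x -> R x != 0 -> exists th lam,
  hw_row symp X k R th lam /\ exists2 u, U u & th *m R (u * x) != 0.
Proof.
move=> k2 Ux Rx.
pose S := lspan (fun z : 'rV[C]_n.+1 => exists r u u', [/\ U u, U u' & z = r *m R (u * x * u')]).
have [||W hW] := @subspace_mx _ S; [exact: lspan0|by move=> *; apply: lspanP|].
have stW a b : (a.2 < k)%N -> (b.2 < k)%N -> stablemx W (R (X a b)).
  move=> ak bk; apply/rV_subP => z /submxP [D ->]; rewrite mulmxA.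
  have UX := inU_X X ak bk; have /hW hD : (D *m W <= W)%MS by apply: submxMl.
  apply/hW; elim: hD => [|a' z1 z2 [r [u [u' [h1 h2 ->]]]] _ IH]; first by rewrite mul0mx; apply: lspan0.
  rewrite mulmxDl -scalemxAl; apply: lspan_cons => //; exists r, u, (u' * X a b); split=> //; first by gsub_closed.
  by rewrite -mulmxA (rep_mulmx hR) ?mulrA //; gsub_closed.
have W0 : W != 0.
  apply: contraNneq Rx => W0; apply/eqP/row_matrixP => i; rewrite row0 rowE.
  apply/eqP; rewrite -submx0 -W0; apply/hW; apply: lspan_sub; exists (delta_mx 0 i), 1, 1.
  by rewrite mul1r mulr1; split=> //; apply: gsub1.
have [th [lam [hth thW]]] := hw_row_exists hX hR W0 stW.
exists th, lam; split=> //; apply: contrapT => all0.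
pose S' (z : 'rV[C]_n.+1) := exists2 u, U u & z = th *m R u.
have [|a z z' [y hy ->] [y' hy' ->]|N hN] := @subspace_mx _ S'.
- by exists 0; [exact: gsub0|rewrite (rep0 hR) mulmx0].
- by exists (a *: y + y'); [exact: gsubP|rewrite (rep_lin hR) ?mulmxDr -?scalemxAr].
have stN a b : (a.2 < k)%N -> (b.2 < k)%N -> stablemx N (R (X a b)).
  move=> ak bk; apply/rV_subP => z /submxP [D ->]; rewrite mulmxA.
  have UX := inU_X X ak bk; have /hN [u hu ->] : (D *m N <= N)%MS by apply: submxMl.
  by apply/hN; exists (u * X a b); [gsub_closed|rewrite -mulmxA (rep_mulmx hR)].
have [P [PN NP Pc]] := stable_projection hX hR k2 stN.
have SP z : S z -> z *m P = 0.
  elim=> [|a z1 z2 [r [u [u' [h1 h2 ->]]]] _ IH]; first by rewrite mul0mx.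
  rewrite mulmxDl IH addr0 -scalemxAl -mulmxA -Pc; last by gsub_closed.
  have /hN [w hw e] : (r *m P <= N)%MS by apply: mulmx_sub.
  rewrite mulmxA e -mulmxA (rep_mulmx hR) //; last by gsub_closed.
  rewrite !mulrA -(rep_mulmx hR) //; [|by gsub_closed].
  rewrite mulmxA; have -> : th *m R (w * u * x) = 0; last by rewrite mul0mx scaler0.
  by apply: contrapT => /eqP h; apply: all0; exists (w * u) => //; gsub_closed.
case: (hth) => th0 _ _; case/eqP: th0.
have /hN /submxP [D e] : S' th by exists 1; [exact: gsub1|case: hR => -> _ _; rewrite mulmx1].
by rewrite e -NP mulmxA -e; apply: SP; apply/hW.
Qed.
End HighestWeightFunctionals.

(** * Invariance of ideals under relabelling *)

Section Relabelling.
Variables (symp : bool) (A : algType C) (X : label -> label -> A).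
Hypothesis hX : forall k, relX symp k X.
Implicit Types (phi : A -> A) (f g : nat -> nat).

Definition along (k : nat) f phi := alg_morph phi /\
  forall a b, (a.2 < k)%N -> (b.2 < k)%N -> phi (X a b) = X (relabel f a) (relabel f b).

Lemma alg_morph0 phi : alg_morph phi -> phi 0 = 0.
Proof.
move=> [h _ _]; have := h 1 0 0; rewrite !scale1r addr0.
by move/(congr1 (fun z => z - phi 0)); rewrite addrK subrr.
Qed.

Lemma alg_morph_agree phi psi (D : pred label) u : alg_morph phi -> alg_morph psi ->
  (forall a b, D a -> D b -> phi (X a b) = psi (X a b)) -> Ugen X D u -> phi u = psi u.
Proof.
move=> [p1 p2 p3] [q1 q2 q3] h; elim=> {u} [|_ [t /andP [t1 t2] ->]|c u v _ e1 _ e2|u v _ e1 _ e2].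
- by rewrite p2.
- exact: h.
- by rewrite p1 q1 e1 e2.
- by rewrite p3 q3 e1 e2.
Qed.

Lemma along_eq k f g phi psi u : (forall l, (l < k)%N -> f l = g l) -> along k f phi -> along k g psi ->
  inU k X u -> phi u = psi u.
Proof.
move=> fg [hp ep] [hq eq]; apply: alg_morph_agree => // a b ak bk.
by rewrite ep // eq // /relabel !fg.
Qed.

Lemma along_Ugen k f phi (D D' : pred label) u : along k f phi -> (forall a, D a -> (a.2 < k)%N) ->
  (forall a, D a -> D' (relabel f a)) -> Ugen X D u -> Ugen X D' (phi u).
Proof.
move=> [[p1 p2 p3] e] Dk DD; elim=> {u} [|_ [t /andP [t1 t2] ->]|c u v _ e1 _ e2|u v _ e1 _ e2].
- by rewrite p2; apply: gsub1.
- by rewrite e ?Dk //; apply: gsub_sub; exists (relabel f t.1, relabel f t.2) => //; rewrite !DD.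
- by rewrite p1; apply: gsubP.
- by rewrite p3; apply: gsubM.
Qed.

Lemma along_inU k m f phi u : along k f phi -> (forall l, (l < k)%N -> (f l < m)%N) ->
  inU k X u -> inU m X (phi u).
Proof. by move=> h fm; apply: along_Ugen h _ _ => // a; apply: fm. Qed.

Lemma along_comp k m f g phi psi : along k f phi -> along m g psi -> (forall l, (l < k)%N -> (f l < m)%N) ->
  along k (g \o f) (psi \o phi).
Proof.
move=> [[p1 p2 p3] e] [[q1 q2 q3] e'] h; split; last by move=> a b ak bk; rewrite /= e // e' //= h.
by split=> [c u v||u v] /=; rewrite ?p1 ?p2 ?p3 ?q1 ?q2 ?q3.
Qed.

Hypothesis psi_ex : forall f, injective f -> exists phi, forall k, along k f phi.

Section Ideal.
Variable I : A -> Prop.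
Hypothesis hI : two_sided_ideal I.
Variables (k : nat) (u : A).
Hypotheses (Uu : inU k X u) (Iu : I u).

Definition relabels_into f := forall phi, along k f phi -> I (phi u).

Lemma swap_index_inj i j : injective (swap_index i j).
Proof. by move=> x y; rewrite /swap_index; repeat (case: ifP => /eqP ?); lia. Qed.

Lemma relabels_swap g i j : injective g -> i != j -> (forall l, (l < k)%N -> g l != j) ->
  relabels_into g -> relabels_into (swap_index i j \o g).
Proof.
move=> gi ij gj hg phi hphi.
have [pg hpg] := psi_ex gi; have [ps hps] := psi_ex (@swap_index_inj i j).
pose m := (maxn i j + \max_(l < k) g l).+1.
have gm l : (l < k)%N -> (g l < m)%N.
  move=> lk; rewrite /m ltnS; apply: leq_trans (leq_addl _ _).
  exact: (leq_bigmax (F := fun l : 'I_k => g l) (Ordinal lk)).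
have -> : phi u = ps (pg u).
  by apply: (along_eq (f := swap_index i j \o g) _ hphi (along_comp (hpg k) (hps m) gm)).
case: hI => I0 IP IM.
apply: (swap_index_in (hX m) _ _ ij) (hps 0%N).1 _ _ _.
- by rewrite /m; lia.
- by rewrite /m; lia.
- by split.
- move=> a b z Iz; rewrite -scaleN1r addrC; apply: IP; [exact: (IM _ _ Iz).2|exact: (IM _ _ Iz).1].
- by move=> a b; apply: (hps (maxn a.2 b.2).+1).2; rewrite ltnS ?leq_maxl ?leq_maxr.
- apply: along_Ugen (hpg k) _ _ Uu => // a /= ak; apply/andP; split; [exact: gm|exact: gj].
- exact: hg.
Qed.

(* Moving the indices first out of the way and then to their targets avoids collisions. *)
Lemma ideal_relabel f phi : injective f -> along k f phi -> I (phi u).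
Proof.
move=> fi; pose B := (k + \max_(l < k) f l).+1.
have fB l : (l < k)%N -> (f l < B)%N.
  move=> lk; rewrite /B ltnS; apply: leq_trans (leq_addl _ _).
  exact: (leq_bigmax (F := fun l : 'I_k => f l) (Ordinal lk)).
have kB : (k < B)%N by rewrite /B ltnS leq_addr.
have [g [gi gE hg]] : exists g, [/\ injective g, forall l, (l < k)%N -> g l = (B + l)%N & relabels_into g].
  suff : forall t, (t <= k)%N -> exists g, [/\ injective g, forall l, (l < k)%N -> g l = if (l < t)%N then (B + l)%N else l & relabels_into g].
    by case/(_ k (leqnn k)) => g [gi gE hg]; exists g; split=> // l lk; rewrite gE // lk.
  elim=> [_|t IH tk].
    exists id; split=> // psi hpsi; rewrite (@alg_morph_agree psi id (below k) u) //; first by case: hpsi.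
    by move=> [? ?] [? ?] ak bk; rewrite hpsi.2.
  have [g [gi gE hg]] := IH (ltnW tk); exists (swap_index t (B + t) \o g); split.
  - exact: inj_comp (@swap_index_inj _ _) gi.
  - move=> l lk /=; rewrite gE // /swap_index ltnS; case: (ltngtP l t) => [lt|lt|->].
    + by do 2 (case: eqP => ?; first lia).
    + by do 2 (case: eqP => ?; first lia).
    + by rewrite eqxx.
  - apply: relabels_swap => //; first by apply/eqP; lia.
    by move=> l lk; rewrite gE //; case: ifP => h; apply/eqP; lia.
suff : forall t, (t <= k)%N -> exists g, [/\ injective g, forall l, (l < k)%N -> g l = if (l < t)%N then f l else (B + l)%N & relabels_into g].
  case/(_ k (leqnn k)) => h [hi hE hh] hphi.
  apply: hh; split; first by case: hphi.
  by move=> a b ak bk; rewrite hphi.2 // /relabel !hE // ak bk.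
elim=> [_|t IH tk]; first by exists g; split=> // l lk; rewrite gE.
have [h [hi hE hh]] := IH (ltnW tk); exists (swap_index (B + t) (f t) \o h); split.
- exact: inj_comp (@swap_index_inj _ _) hi.
- move=> l lk /=; rewrite hE // /swap_index ltnS; have := fB _ lk; have := fB _ tk.
  case: (ltngtP l t) => [lt|lt|-> _ _]; last by rewrite eqxx.
  + have nft : f l <> f t by move/fi; lia.
    by do 2 (case: eqP => ?; first lia).
  + by do 2 (case: eqP => ?; first lia).
- apply: relabels_swap => //; first by have := fB _ tk; move=> ?; apply/eqP; lia.
  move=> l lk; rewrite hE //; have := fB _ tk; have := fB _ lk.
  case: ifP => h' ? ?; apply/eqP; last lia.
  by move/fi; lia.
Qed.
End Ideal.
End Relabelling.

(** * Bounding the indices of a witness *)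

Section Witness.
Variables (symp : bool) (A : algType C) (X : label -> label -> A).
Hypothesis hX : forall k, relX symp k X.
Variables (n m : nat).
Hypotheses (n0 : (0 < n)%N) (nm : (n <= m)%N).
Local Notation Xp := (Xp X).
Local Notation gr2 := (gr2 symp).
Implicit Types (a b : label) (t y : label * label) (w : seq (label * label)).

Definition hi a : int := if (n <= a.2)%N then (if a.1 then 1 else -1) else 0.
Definition hi2 t : int := hi t.1 + hi t.2.
Definition hasE t := (t.1.1 && (n <= t.1.2)%N) || (t.2.1 && (n <= t.2.2)%N).
Definition hasF t := (~~ t.1.1 && (n <= t.1.2)%N) || (~~ t.2.1 && (n <= t.2.2)%N).
(* In a word sorted by [up_rank], the letters of rank 0 kill a highest weight row, those of rank 1 lie in [U_n],
   and those of rank 3 commute with [U_n]. *)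
Definition up_rank t : nat :=
  if hasE t then (if hasF t then 3%N else 2%N) else (if hasF t then 0%N else 1%N).
Definition up_letter : pred (label * label) := fun t => below2 m t && (up_rank t == 2%N).

Lemma hi_bracket y t : below2 m y -> below2 m t ->
  lspan (fun z => exists r, [/\ below2 m r, hi2 r = hi2 y + hi2 t & z = Xp r]) (Xp y * Xp t - Xp t * Xp y).
Proof.
move=> /andP [y1 y2] /andP [t1 t2]; rewrite /Xp (brX (hX m)) //.
have sp e a b x z : below m x -> below m z -> hi a + hi b + hi x + hi z = hi2 y + hi2 t ->
    lspan (fun z => exists r, [/\ below2 m r, hi2 r = hi2 y + hi2 t & z = Xp r]) ((e * om symp a b) *: X x z).
  move=> xm zm e1; case: (eqVneq b (star a)) => [ba|/om_eq0 ->]; last by rewrite mulr0 scale0r; apply: lspan0.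
  apply: lspanZ; apply: lspan_sub; exists (x, z); split=> //; first by rewrite /below2 /= xm.
  by move: e1; rewrite ba /hi2 /hi /star /=; case: ifP; case: (a.1) => /=; lia.
have sp1 a b x z : below m x -> below m z -> hi a + hi b + hi x + hi z = hi2 y + hi2 t ->
    lspan (fun z => exists r, [/\ below2 m r, hi2 r = hi2 y + hi2 t & z = Xp r]) (om symp a b *: X x z).
  by move=> xm zm e1; rewrite -[om _ _ _]mul1r; apply: sp.
by apply: lspanD; (apply: lspanB; [apply: sp1|apply: sp]) => //; rewrite /hi2; ring.
Qed.

Definition hisum w : int := \sum_(t <- w) hi2 t.

Lemma hi_word_bracket y w : below2 m y -> all (below2 m) w ->
  lspan (fun z => exists v, [/\ all (below2 m) v, size v = size w, hisum v = hi2 y + hisum w & z = wprod Xp v])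
    (Xp y * wprod Xp w - wprod Xp w * Xp y).
Proof.
move=> hy; elim: w => [_|t w IH /= /andP [ht hw]].
  by rewrite wprod_nil mulr1 mul1r subrr; apply: lspan0.
rewrite wprod_cons.
have -> : Xp y * (Xp t * wprod Xp w) - Xp t * wprod Xp w * Xp y =
    (Xp y * Xp t - Xp t * Xp y) * wprod Xp w + Xp t * (Xp y * wprod Xp w - wprod Xp w * Xp y).
  by rewrite mulrBl mulrBr !mulrA addrA subrK.
apply: lspanD.
  apply: (lspan_mul (S' := fun z => z = wprod Xp w)) (hi_bracket hy ht) (lspan_sub _) => //.
  move=> _ _ [r [hr er ->]] ->; apply: lspan_sub; exists (r :: w); rewrite /= hr hw wprod_cons.
  by split=> //; rewrite /hisum !big_cons er -addrA.
apply: (lspan_mul (S := fun z => z = Xp t)) (lspan_sub _) (IH hw) => //.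
move=> _ _ -> [v [hv sv ev ->]]; apply: lspan_sub; exists (t :: v); rewrite /= ht sv wprod_cons.
by split=> //; move: ev; rewrite /hisum !big_cons => ->; rewrite addrCA.
Qed.

Definition adl (S : seq (label * label)) (x : A) : A := foldr (fun y z => Xp y * z - z * Xp y) x S.

Variables (d : nat) (x : A).
Hypothesis hx : lspan (fun z => exists w, [/\ all (below2 n) w, (size w <= d)%N & z = wprod Xp w]) x.

Lemma below2_le : subpred (below2 n) (below2 m).
Proof. by move=> t /andP [t1 t2]; rewrite /below2 /below !(leq_trans _ nm). Qed.

Lemma adl_words S : all up_letter S ->
  lspan (fun z => exists w, [/\ all (below2 m) w, (size w <= d)%N, ((size S)%:Z <= hisum w)%R & z = wprod Xp w]) (adl S x).
Proof.
elim: S => [_|y S IH /= /andP [/andP [hy yup] hS]].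
  apply: lspan_mono hx => _ [w [hw sw ->]]; exists w; split=> //; first exact: sub_all below2_le _ hw.
  rewrite /hisum big_seq big1 // => t /(allP hw) /andP [t1 t2].
  by rewrite /hi2 /hi !ifN //; rewrite -ltnNge.
have y1 : (1 <= hi2 y)%R.
  move: yup; rewrite /up_rank /hasE /hasF /hi2 /hi.
  by case: (y.1.1); case: (y.2.1); case: (leqP n y.1.2) => _; case: (leqP n y.2.2) => _.
elim: (IH hS) => [|a u v [w [hw sw cw ->]] _ IHv]; first by rewrite mulr0 mul0r subrr; apply: lspan0.
rewrite (_ : _ - _ = a *: (Xp y * wprod Xp w - wprod Xp w * Xp y) + (Xp y * v - v * Xp y)); last first.
  by rewrite mulrDr mulrDl -scalerAl -(scalerAr _ (Xp y)) scalerBr opprD addrACA.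
apply: lspanP IHv; apply: lspan_mono (hi_word_bracket hy hw) => _ [v' [hv' sv' ev' ->]].
exists v'; split=> //; first by rewrite sv'.
by rewrite ev' -add1n PoszD; apply: lerD.
Qed.

Lemma hi2_le t : (hi2 t <= 2)%R.
Proof.
have h a : (hi a <= 1)%R by rewrite /hi; case: ifP => // _; case: (a.1).
by have := lerD (h t.1) (h t.2).
Qed.

(* Each up letter raises the number of high [e]'s minus the number of high [f]'s, and a word has only so many letters. *)
Lemma adl_long S : all up_letter S -> (d.*2 < size S)%N -> adl S x = 0.
Proof.
move=> hS dS; elim: (adl_words hS) => // a u v [w [hw sw cw ->]] _ ->.
suff : (hisum w <= (size w).*2%:Z)%R by move: cw dS sw; lia.
rewrite /hisum; elim: (w) => [|t w' IH]; first by rewrite big_nil.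
by rewrite big_cons /= doubleS -addn2 addnC PoszD; apply: lerD IH; apply: hi2_le.
Qed.

Lemma adl_expand (D : pred label) S : all (fun y => D y.1 && D y.2) S ->
  lspan (fun z => exists u0 u1, [/\ Ugen X D u0, Ugen X D u1 & z = u0 * x * u1]) (adl S x).
Proof.
elim: S => [_|y S IH /= /andP [hy hS]].
  by apply: lspan_sub; exists 1, 1; rewrite mul1r mulr1; split=> //; apply: gsub1.
have Uy : Ugen X D (Xp y) by apply: gsub_sub; exists y.
apply: lspanB.
  apply: (lspan_mul (S := fun z => z = Xp y)) (lspan_sub _) (IH hS) => // _ _ -> [u0 [u1 [h0 h1 ->]]].
  by apply: lspan_sub; exists (Xp y * u0), u1; rewrite !mulrA; split=> //; apply: gsubM.
apply: (lspan_mul (S' := fun z => z = Xp y)) (IH hS) (lspan_sub _) => // _ _ [u0 [u1 [h0 h1 ->]]] ->.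
by apply: lspan_sub; exists u0, (u1 * Xp y); rewrite !mulrA; split=> //; apply: gsubM.
Qed.

Lemma mixed_comm t u : below2 m t -> up_rank t = 3%N -> inU n X u -> Xp t * u = u * Xp t.
Proof.
move=> /andP [t1 t2] ht; elim=> {u} [|_ [[a b] /= /andP [an bn] ->]|c u v _ e1 _ e2|u v _ e1 _ e2].
- by rewrite mulr1 mul1r.
- have am := leq_trans an nm; have bm := leq_trans bn nm.
  apply/eqP; rewrite -subr_eq0 /Xp (brX (hX m)) //.
  have o c e : (n <= c.2)%N -> (e.2 < n)%N -> om symp c e = 0.
    by case: c e => [c i] [e j] /= h1 h2; apply: om_ne; apply/eqP; lia.
  have [h1 h2] : (n <= t.1.2)%N /\ (n <= t.2.2)%N.
    move: ht; rewrite /up_rank /hasE /hasF; case: t {t1 t2} => -[c i] [e j] /=.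
    by case: (leqP n i) => _; case: (leqP n j) => _; case: c; case: e.
  by rewrite !o // !mulr0 !scale0r subrr addr0.
- by rewrite mulrDr mulrDl -scalerAl -(scalerAr _ (Xp t)) e1 e2.
- by rewrite mulrA e1 -mulrA e2 mulrA.
Qed.

Variables (p : nat) (R : A -> 'M[C]_p.+1) (th : 'rV[C]_p.+1).
Hypothesis hR : is_rep X m R.
Hypothesis hneg : forall t, below2 m t -> gr2 t < 0 -> th *m R (Xp t) = 0.

Lemma down_negative t : up_rank t = 0%N -> gr2 t < 0.
Proof.
rewrite /up_rank /hasE /hasF gr2E; case: t => -[c i] [e j]; rewrite !grE /=.
by case: (leqP n i) => ?; case: (leqP n j) => ?; case: c; case: e => //= _; lia.
Qed.

Lemma inU_le k k' u : (k <= k')%N -> inU k X u -> inU k' X u.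
Proof.
move=> kk; apply: gsub_bind => _ [t /andP [t1 t2] ->]; apply: gsub_sub; exists t => //.
by rewrite /below !(leq_trans _ kk).
Qed.

Lemma inU_x : inU n X x.
Proof. by apply: gsub_lspan hx => _ [w [hw _ ->]]; apply: inU_word. Qed.

Lemma witness_indices u : inU m X u -> th *m R (u * x) != 0 ->
  exists F : seq nat, [/\ (size F <= d.*2.*2)%N, all (fun l => (l < m)%N) F &
    exists u0 u1, [/\ Ugen X (fun a => (a.2 < n)%N || (a.2 \in F)) u0, Ugen X (fun a => (a.2 < n)%N || (a.2 \in F)) u1 &
      th *m R (u0 * x * u1) != 0]].
Proof.
move=> hu nz; apply: contrapT => all0.
have Ux : inU m X x by apply: inU_le nm inU_x.
have UXt t : below2 m t -> inU m X (Xp t) by case/andP => *; apply: inU_X.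
have UD F z : all (fun l => (l < m)%N) F -> Ugen X (fun a => (a.2 < n)%N || (a.2 \in F)) z -> inU m X z.
  move=> hF; apply: gsub_bind => _ [t /andP [t1 t2] ->]; apply: UXt; apply/andP; split.
    by case/orP: t1 => [h|/(allP hF) //]; apply: leq_trans nm.
  by case/orP: t2 => [h|/(allP hF) //]; apply: leq_trans nm.
have Uadl S : all up_letter S -> inU m X (adl S x).
  elim: S => //= y S IH /andP [/andP [/UXt hy _] /IH hS]; gsub_closed.
have base (w1 : A) S : inU n X w1 -> all up_letter S -> th *m R (w1 * adl S x) = 0.
  move=> hw1 hS; have Uw1 : inU m X w1 by apply: inU_le nm hw1.
  case: (leqP (size S) d.*2) => sS; last by rewrite adl_long // mulr0 (rep0 hR) mulmx0.
  pose F := flatten [seq [:: y.1.2; y.2.2] | y <- S].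
  have hF : all (fun l => (l < m)%N) F.
    apply/allP => l /flatten_mapP [y /(allP hS) /andP [/andP [y1 y2] _]].
    by rewrite !inE => /orP [] /eqP ->.
  have sF : (size F <= d.*2.*2)%N.
    suff -> : size F = (size S).*2 by rewrite leq_double.
    by rewrite /F; elim: (S) => //= y S' ->; rewrite doubleS.
  have hD : all (fun y => ((y.1.2 < n)%N || (y.1.2 \in F)) && ((y.2.2 < n)%N || (y.2.2 \in F))) S.
    apply/allP => y yS; apply/andP; split; apply/orP; right; apply/flatten_mapP;
      exists y => //; by rewrite !inE eqxx ?orbT.
  have [] : th *m R (w1 * adl S x) = 0 /\ inU m X (adl S x); last by [].
  apply: (lspan_ind_lin (P := fun z => th *m R (w1 * z) = 0 /\ inU m X z)) (adl_expand (D := fun a => (a.2 < n)%N || (a.2 \in F)) hD).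
  - by rewrite mulr0 (rep0 hR) mulmx0; split=> //; apply: gsub0.
  - move=> a z1 z2 [e1 h1] [e2 h2]; split; last exact: gsubP.
    rewrite mulrDr -scalerAr (rep_lin hR) ?mulmxDr -?scalemxAr ?e1 ?e2 ?scaler0 ?addr0 //; gsub_closed.
  move=> _ [u0 [u1 [h0 h1 ->]]]; split; last first.
    by have UD0 := UD _ _ hF h0; have UD1 := UD _ _ hF h1; gsub_closed.
  apply: contrapT => /eqP nz'; apply: all0; exists F; split; [exact: sF|exact: hF|].
  exists (w1 * u0), u1; split; [|exact: h1|by move: nz'; rewrite !mulrA].
  apply: gsubM h0; apply: gsub_bind hw1 => _ [t /andP [t1 t2] ->]; apply: gsub_sub; exists t => //.
  by apply/andP; split; apply/orP; left.
have push w (w1 : A) S : inU n X w1 -> all up_letter w -> all up_letter S -> th *m R (w1 * wprod Xp w * adl S x) = 0.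
  move=> hw1; elim/last_ind: w S => [|w y IH] S hw hS; first by rewrite wprod_nil mulr1; apply: base.
  move: hw; rewrite all_rcons => /andP [hy hw]; have [hyb _] := andP hy.
  have Uw : inU m X (wprod Xp w) by apply: inU_word; apply: sub_all hw => t /andP [].
  have Uw1 : inU m X w1 by apply: inU_le nm hw1.
  have Uy := UXt _ hyb; have US := Uadl _ hS.
  rewrite -cats1 wprod_cat {2}/wprod big_seq1.
  have -> : w1 * (wprod Xp w * Xp y) * adl S x = w1 * wprod Xp w * adl (y :: S) x + w1 * wprod Xp w * adl S x * Xp y.
    by rewrite /= mulrBr !mulrA subrK.
  have US' : inU m X (adl (y :: S) x) by apply: Uadl; rewrite /= hy.
  rewrite (repD hR); [|by gsub_closed|by gsub_closed].
  rewrite mulmxDr IH //=; last by rewrite hy.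
  by rewrite (rep_mul hR) // -?mulmxE ?mulmxA ?IH ?mul0mx ?addr0 //; gsub_closed.
case/eqP: nz.
have [] : th *m R (u * x) = 0 /\ inU m X u; last by [].
apply: (lspan_ind_lin (P := fun u => th *m R (u * x) = 0 /\ inU m X u))
  (pbw_sorted up_rank (@Xp_bracket _ _ _ _ (hX m)) hu).
- by rewrite mul0r (rep0 hR) mulmx0; split=> //; apply: gsub0.
- move=> a z1 z2 [e1 h1] [e2 h2]; split; last exact: gsubP.
  rewrite mulrDl -scalerAl (rep_lin hR) ?mulmxDr -?scalemxAr ?e1 ?e2 ?scaler0 ?addr0 //; gsub_closed.
move=> _ [w [hw srt ->]]; split; last exact: inU_word.
case: (boolP (has (fun t => up_rank t == 0%N) w)) => [/hasP [t tw /eqP t0]|].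
  case: w hw srt tw => // s w /= /andP [hs hw] srt tw.
  have s0 : up_rank s = 0%N.
    move: tw; rewrite inE => /orP [/eqP <- //|tw].
    have tr : transitive (relpre up_rank leq) by move=> ? ? ?; apply: leq_trans.
    by have /= := allP (order_path_min tr srt) t tw; rewrite t0 leqn0 => /eqP.
  have Us := UXt _ hs; have Uw := inU_word X hw.
  by rewrite wprod_cons -mulrA (rep_mul hR) // -?mulmxE ?mulmxA ?hneg ?mul0mx //; [exact: down_negative|gsub_closed].
move=> /hasPn no0; rewrite (sorted_split 3 srt) (sorted_split 2 (sorted_filter _ _ srt)); last first.
  by move=> ? ? ?; apply: leq_trans.
set v := [seq s <- w | (up_rank s < 3)%N]; set w3 := [seq s <- w | ~~ (up_rank s < 3)%N].
rewrite !wprod_cat.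
have hw3 : wprod Xp w3 * x = x * wprod Xp w3.
  have : all (fun t => below2 m t && (up_rank t == 3%N)) w3.
    apply/allP => t; rewrite mem_filter => /andP [t3 /(allP hw) ->] /=.
    by move: t3; rewrite /up_rank; case: ifP; case: ifP.
  elim: (w3) => [_|t w' IH /= /andP [/andP [ht /eqP t3] hw']]; first by rewrite wprod_nil mulr1 mul1r.
  by rewrite wprod_cons -mulrA IH // !mulrA (mixed_comm ht t3 inU_x).
have Uw q : inU m X (wprod Xp [seq s <- w | q s]).
  by apply: inU_word; apply/allP => t; rewrite mem_filter => /andP [_ /(allP hw)].
have Uw' q : inU m X (wprod Xp [seq s <- v | q s]).
  by apply: inU_word; apply/allP => t; rewrite !mem_filter => /andP [_ /andP [_ /(allP hw)]].
have U3 := Uw (fun s => ~~ (up_rank s < 3)%N).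
have U2 := Uw' (fun s => ~~ (up_rank s < 2)%N).
have U1 := Uw' (fun s => (up_rank s < 2)%N).
rewrite -/w3 in U3.
rewrite -(mulrA _ (wprod Xp w3)) hw3 mulrA (rep_mul hR) //; last by gsub_closed.
rewrite -mulmxE mulmxA (push _ _ [::]) ?mul0mx //.
- apply: inU_word; apply/allP => t; rewrite !mem_filter => /andP [t2 /andP [_ tw]].
  have /andP [t1 t1'] := allP hw t tw; have := no0 t tw; move: t2.
  rewrite /up_rank /hasE /hasF; case: t t1 t1' {tw} => -[c i] [e j] /= _ _.
  rewrite /below2 /below /=.
  by case: (leqP n i) => ?; case: (leqP n j) => ?; case: c; case: e => //= _ _.
- apply/allP => t; rewrite !mem_filter => /andP [t2 /andP [t3 /(allP hw) tw]].
  by rewrite /up_letter /= tw; move: t2 t3; rewrite /up_rank; case: ifP; case: ifP.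
Qed.
End Witness.

Lemma pad_indices (m K : nat) (G : seq nat) : (size G <= K)%N -> (K <= m)%N -> all (fun l => (l < m)%N) G ->
  exists G', [/\ uniq G', size G' = K, all (fun l => (l < m)%N) G' & {subset G <= G'}].
Proof.
move=> sG Km hG.
suff : forall r, (r <= K)%N -> exists G', [/\ uniq G', (r <= size G' <= K)%N, all (fun l => (l < m)%N) G' & {subset G <= G'}].
  by case/(_ K (leqnn K)) => G' [h1 h2 h3 h4]; exists G'; split=> //; lia.
elim=> [_|r IH rK].
  exists (undup G); split; rewrite ?undup_uniq //; first by rewrite (leq_trans (size_undup _)).
    by apply/allP => l; rewrite mem_undup; apply: (allP hG).
  by move=> l; rewrite mem_undup.
have [G' [h1 /andP [h2 h2'] h3 h4]] := IH (ltnW rK).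
case: (ltnP r (size G')) => rG; first by exists G'; rewrite rG h2'.
have [l [lm lG]] : exists l, (l < m)%N /\ l \notin G'.
  apply: contrapT => h; have : (size (iota 0 m) <= size G')%N.
    apply: uniq_leq_size (iota_uniq _ _) _ => l; rewrite mem_iota => lm.
    by apply: contrapT => /negP lG; apply: h; exists l.
  by rewrite size_iota; lia.
exists (l :: G'); split=> /=; rewrite ?lG ?lm //; first by rewrite ltnS h2 (leq_ltn_trans rG rK).
by move=> z /h4 zG; rewrite inE zG orbT.
Qed.

Lemma homo_fix (s : nat -> nat) n : {homo s : x y / (x < y)%N} ->
  (forall l, (l < n)%N -> exists j, s j = l) -> forall l, (l < n)%N -> s l = l.
Proof.
move=> hs onto l; elim/ltn_ind: l => l IH ln.
have ge j : (j <= s j)%N by elim: j => // j IHj; apply: leq_ltn_trans IHj (hs _ _ (ltnSn j)).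
have [j ej] := onto l ln; have jl := ge j; rewrite ej in jl.
case: (ltngtP j l) jl => // [jl _|e _]; last by rewrite -{1}e.
by have := IH j jl (ltn_trans jl ln); rewrite ej => e; rewrite e ltnn in jl.
Qed.

Lemma enum_indices m K n (F : seq nat) : (n + size F <= K)%N -> (K <= m)%N -> all (fun l => (l < m)%N) F ->
  exists s, [/\ {homo s : x y / (x < y)%N}, s K = m, forall l, (l < n)%N -> s l = l &
    forall l, (l < n)%N || (l \in F) -> exists2 j, (j < K)%N & s j = l].
Proof.
move=> sK Km hF.
have [||G [Gu Gs Gm GF]] := @pad_indices m K (iota 0 n ++ F) _ Km.
- by rewrite size_cat size_iota.
- rewrite all_cat hF andbT; apply/allP => l; rewrite mem_iota; lia.
pose G' := sort leq G; have sG' : size G' = K by rewrite size_sort.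
have lG' : sorted ltn G'.
  by rewrite ltn_sorted_uniq_leq sort_uniq Gu sort_sorted // => x y; apply: leq_total.
pose s l := if (l < K)%N then nth 0%N G' l else (m + (l - K))%N.
have hs : {homo s : x y / (x < y)%N}.
  move=> x y xy; rewrite /s; case: (ltnP y K) => yK.
    rewrite (ltn_trans xy yK); apply: (sorted_ltn_nth ltn_trans 0%N lG') => //; rewrite inE sG' //.
    exact: ltn_trans yK.
  case: (ltnP x K) => xK; last by lia.
  have : nth 0%N G' x \in G by rewrite -(mem_sort leq) mem_nth ?sG'.
  by move/(allP Gm); lia.
have onto l : (l < n)%N || (l \in F) -> exists2 j, (j < K)%N & s j = l.
  move=> h; have lG : l \in G'.
    by rewrite mem_sort; apply: GF; rewrite mem_cat mem_iota add0n.
  by exists (index l G'); rewrite -?sG' ?index_mem //; rewrite /s -sG' index_mem lG nth_index.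
exists s; split=> //; first by rewrite /s ltnn subnn addn0.
by apply: homo_fix => // l ln; have [|j _ e] := onto l; [rewrite ln|exists j].
Qed.

Section Pullback.
Variables (symp : bool) (A : algType C) (X : label -> label -> A).
Hypothesis hX : forall k, relX symp k X.
Local Notation gr2 := (gr2 symp).

Lemma along_surj K f phi (D : pred label) u : along X K f phi ->
  (forall a, D a -> exists2 j, (j < K)%N & f j = a.2) -> Ugen X D u -> exists2 u', inU K X u' & phi u' = u.
Proof.
move=> [[p1 p2 p3] e] onto; elim=> {u} [|_ [[[b x] [c y]] /= /andP [/onto [i iK ei] /onto [j jK ej]] ->]|c u v _ [u' hu <-] _ [v' hv <-]|u v _ [u' hu <-] _ [v' hv <-]].
- by exists 1; [exact: gsub1|].
- by exists (X (b, i) (c, j)); [exact: inU_X|rewrite e // /relabel ei ej].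
- by exists (c *: u' + v'); [exact: gsubP|rewrite p1].
- by exists (u' * v'); [exact: gsubM|rewrite p3].
Qed.

Lemma along_id k u : inU k X u -> forall f phi, (forall l, (l < k)%N -> f l = l) -> along X k f phi -> phi u = u.
Proof.
move=> hu f phi fl [hp e]; apply: (alg_morph_agree (psi := id)) hu => // a b ak bk.
by rewrite e // /relabel !fl // -!surjective_pairing.
Qed.

Variables (k m : nat) (f : nat -> nat) (phi : A -> A).
Hypotheses (hphi : along X k f phi) (fhom : {homo f : x y / (x < y)%N}) (f0 : f 0 = 0%N)
  (fm : forall l, (l < k)%N -> (f l < m)%N).

Definition relabel2 (t : label * label) := (relabel f t.1, relabel f t.2).

Lemma below2_relabel t : below2 k t -> below2 m (relabel2 t).
Proof. by move=> /andP [t1 t2]; apply/andP; split; apply: fm. Qed.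

Lemma gr2_relabel t : (0 < gr2 t -> 0 < gr2 (relabel2 t)) /\ (gr2 t < 0 -> gr2 (relabel2 t) < 0).
Proof.
clear hX; case: t => -[b i] [c j]; rewrite /relabel2 /relabel !gr2E !grE /=.
have p x : (0 < x)%N -> (0 < f x)%N by move/fhom; rewrite f0.
have := p i; have := p j; have := @fhom i j; have := @fhom j i.
by case: b; case: c; case: (ltngtP i j) => [ij|ij|->]; (split; [lia|]); lia.
Qed.

Lemma phi_Xp t : below2 k t -> phi (Xp X t) = Xp X (relabel2 t).
Proof. by move=> /andP [t1 t2]; rewrite /Xp hphi.2. Qed.

Lemma phi_hel i : (i < k)%N -> phi (hel symp X i) = hel symp X (f i).
Proof.
case: (hphi) => -[p1 _ _] e ik; have p0 := alg_morph0 hphi.1.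
by rewrite !helE -[in LHS](addr0 (_ *: _)) p1 p0 addr0 e.
Qed.

Lemma phi_inU u : inU k X u -> inU m X (phi u).
Proof. exact: along_inU hphi fm. Qed.

Variables (p : nat) (R : A -> 'M[C]_p.+1).
Hypothesis hR : is_rep X m R.

Lemma rep_along : is_rep X k (R \o phi).
Proof.
case: hphi => -[p1 p2 p3] _; split=> [|c u v hu hv|u v hu hv] /=.
- by rewrite p2; case: hR.
- by rewrite p1 (rep_lin hR) //; apply: phi_inU.
- by rewrite p3 (rep_mul hR) //; apply: phi_inU.
Qed.

Lemma hw_row_along th lam : hw_row symp X m R th lam -> hw_row symp X k (R \o phi) th (lam \o f).
Proof.
case=> th0 hn hh; split=> // [t ht tneg|i ik] /=.
  by rewrite phi_Xp // hn //; [exact: below2_relabel|apply: (gr2_relabel t).2].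
by rewrite phi_hel // hh //; apply: fm.
Qed.
End Pullback.

Definition dominant (symp : bool) (k : nat) (lam : nat -> C) :=
  (forall i, (i.+1 < k)%N -> exists d : nat, lam i.+1 - lam i = d%:R) /\
  exists n0 : nat, (if symp then lam 0%N else lam 1%N + lam 0%N) = n0%:R.

Section Dominance.
Variables (symp : bool) (A : algType C) (X : label -> label -> A).
Hypothesis hX : forall k, relX symp k X.
Variables (k n : nat) (R : A -> 'M[C]_n.+1) (th : 'rV[C]_n.+1) (v : 'cV[C]_n.+1) (lam : nat -> C).
Hypotheses (hR : is_rep X k R) (hth : hw_row symp X k R th lam) (hv1 : th *m v = 1%:M)
 (hvl : forall t u, below2 k t -> 0 < gr2 symp t -> inU k X u -> th *m R (u * Xp X t) *m v = 0) (k2 : (1 < k)%N).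
Local Notation f := (rep_fun R th v).
Local Notation e_ i := ((true, i) : label).
Local Notation f_ i := ((false, i) : label).

Lemma raising_nilpotent t : below2 k t -> 0 < gr2 symp t -> exists N, th *m R (Xp X t ^+ N) = 0.
Proof.
move=> ht tpos; have [c hc] := hw_row_grel hR hth.
have Ut : inU k X (Xp X t) by case/andP: ht => *; apply: inU_X.
apply: (@eigen_shift _ (R (grel symp X k)) (fun j => th *m R (Xp X t ^+ j)) c (- (gr2 symp t)%:~R)).
  by rewrite oppr_eq0 intr_eq0 gt_eqF.
elim=> [|j IH]; first by case: (hR) => -> _ _; rewrite mulmx1 hc mul0r addr0.
have UX : inU k X (Xp X t ^+ j) by gsub_closed.
rewrite exprSr (rep_mul hR) // -mulmxE !mulmxA (eigen_letter hX hR ht IH); congr (_ *: _).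
by rewrite -natr1; ring.
Qed.

Lemma rep_fun_dominant : dominant symp k lam.
Proof.
have hf := rep_fun_hwf hR hth hvl.
have f1 : f 1 != 0 by rewrite (rep_fun1 hR hv1) oner_neq0.
have bl b i c j : (i < k)%N -> (j < k)%N -> below2 k ((b, i), (c, j)) by rewrite /below2 /below /= => -> ->.
have Ul t : below2 k t -> inU k X (Xp X t) by case/andP => *; apply: inU_X.
have dom E F c H l : below2 k E -> below2 k F -> 0 < gr2 symp E -> gr2 symp F < 0 -> inU k X H ->
    Xp X E * (c *: Xp X F) - (c *: Xp X F) * Xp X E = H -> H * Xp X E - Xp X E * H = Xp X E *+ 2 ->
    (forall u, inU k X u -> f (H * u) = l * f u) -> exists d : nat, l = d%:R.
  move=> hE hF E0 F0 UH h1 h2 hH; have [N hN] := raising_nilpotent hE E0.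
  have UE := Ul _ hE; have UF := Ul _ hF.
  have UcF : inU k X (c *: Xp X F) by gsub_closed.
  have [||d _ ->] := sl2_dominant (N := N) hf h1 h2 UE UcF UH _ hH f1 _; last by exists d.
    by move=> u hu; rewrite -scalerAl (hwfZ hf) ?(hwf_neg hf) ?mulr0 //; gsub_closed.
  by rewrite /rep_fun (rep_mul hR) -?mulmxE ?mulmxA ?hN ?mul0mx ?mxE //; gsub_closed.
have Uh i : (i < k)%N -> inU k X (hel symp X i) by apply: inU_hel.
split.
  move=> i ik; have ik' := ltnW ik; have [h1 h2 _] := sl2_gl (hX k) ik.
  apply: dom h1 h2 _; [exact: bl|exact: bl|by rewrite gr2E !grE /=; lia|by rewrite gr2E !grE /=; lia| |].
    by have := Uh _ ik; have := Uh _ ik'; move=> *; gsub_closed.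
  move=> u hu; rewrite mulrBl (hwfB hf); try by have := Uh _ ik; have := Uh _ ik'; move=> *; gsub_closed.
  by rewrite !(hwf_hel hf) // mulrBl.
have k0 := ltnW k2; case: (boolP symp) => sp.
  have [h1 h2 _] := sl2_sp (hX k) sp k0.
  apply: dom h1 h2 _; [exact: bl|exact: bl|by rewrite gr2E !grE /= sp|by rewrite gr2E !grE /= sp|exact: Uh|].
  by move=> u hu; rewrite (hwf_hel hf).
have [h1 h2 _] := sl2_o (hX k) sp k2.
apply: dom h1 h2 _; [exact: bl|exact: bl|by rewrite gr2E !grE /= (negPf sp)|by rewrite gr2E !grE /= (negPf sp)| |].
  by have := Uh _ k0; have := Uh _ k2; move=> *; gsub_closed.
move=> u hu; rewrite mulrDl (hwfD hf); try by have := Uh _ k0; have := Uh _ k2; move=> *; gsub_closed.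
by rewrite !(hwf_hel hf) // mulrDl.
Qed.
End Dominance.

Definition skip (j r l : nat) : nat := if (l <= j)%N then l else (l + r)%N.

Lemma gap_exists (s : nat -> nat) n K M : (0 < n <= K)%N -> s n.-1 = n.-1 -> (K * M.+1 < s K)%N ->
  exists j, [/\ (n.-1 <= j)%N, (j < K)%N & (s j + M < s j.+1)%N].
Proof.
move=> /andP [n0 nK] sn sK; apply: contrapT => h.
have st j : (n.-1 <= j)%N -> (j < K)%N -> (s j.+1 <= s j + M)%N.
  by move=> h1 h2; rewrite leqNgt; apply/negP => h3; apply: h; exists j.
have : forall i, (n.-1 + i <= K)%N -> (s (n.-1 + i)%N <= n.-1 + i * M)%N.
  elim=> [_|i IH hi]; first by rewrite !addn0 sn.
  by have := st (n.-1 + i)%N; rewrite -addnS in hi *; have := IH; lia.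
move/(_ (K - n.-1)%N); rewrite subnKC; last by lia.
move=> /(_ (leqnn _)) => h'.
have : ((K - n.-1) * M <= K * M)%N by apply: leq_mul; rewrite ?leq_subr.
by move: sK; rewrite mulnS; lia.
Qed.

Section GapWeights.
Variables (symp : bool) (A : algType C) (X : label -> label -> A).
Hypothesis hX : forall k, relX symp k X.
Hypothesis psi_ex : forall f, injective f -> exists phi : A -> A, forall k, along X k f phi.
Variable I : A -> Prop.
Hypothesis hI : two_sided_ideal I.
Hypothesis hloc : forall m x, inU m X x -> ~ I x -> exists J,
  [/\ fincodim_ideal (inU m X) J, ~ J x & forall u, inU m X u -> I u -> J u].
Variables (n d : nat) (x : A).
Hypothesis n2 : (1 < n)%N.
Hypothesis hx : lspan (fun z => exists w, [/\ all (below2 n) w, (size w <= d)%N & z = wprod (Xp X) w]) x.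
Hypothesis nIx : ~ I x.
Local Notation K := (n + d.*2.*2)%N.

Lemma homo_lt_inj (f : nat -> nat) : {homo f : x y / (x < y)%N} -> injective f.
Proof. by move=> hf a b; case: (ltngtP a b) => // /hf + e; rewrite e ltnn. Qed.

Lemma gap_weights M : exists j lam f,
  [/\ (n.-1 <= j < K)%N, hwf symp (K + M) X f lam /\ f 1 = 1,
      forall u, inU (K + M) X u -> I u -> f u = 0, dominant symp (K + M) lam &
      exists w0 w1, [/\ inU K X w0, inU K X w1 &
        forall phi, along X K (skip j M) phi -> f (phi (w0 * x * w1)) != 0]].
Proof.
pose m := (K * M.+1).+1.
have nK : (n <= K)%N by apply: leq_addr.
have Km : (K <= m)%N by rewrite /m; nia.
have nm := leq_trans nK Km.
have k2 : (1 < K)%N := leq_trans n2 nK.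
have n0 : (0 < n)%N := ltnW n2.
have Uxn := inU_x hx.
have Ux : inU m X x := inU_le nm Uxn.
have [J [hJ nJx IJ]] := hloc Ux nIx.
have J1 : ~ J 1.
  move=> h; apply: nJx; case: hJ => _ _ _ hM _; have := (hM x 1 Ux h).1; by rewrite mulr1.
have [q [R [hR RJ]]] := rep_exists hJ J1.
have Rx : R x != 0 by apply/eqP => /(RJ x Ux).
have [th [lam [hth [u Uu hu]]]] := hw_row_acts hX hR (leq_trans n2 nm) Ux Rx.
have hneg : forall t, below2 m t -> gr2 symp t < 0 -> th *m R (Xp X t) = 0 by case: hth.
have [F [sF Fm [u0 [u1 [hu0 hu1 nz]]]]] := witness_indices hX n0 nm hx hR hneg Uu hu.
have [|s [shom sK sn onto]] := @enum_indices m K n F _ Km Fm; first by rewrite leq_add2l.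
have s0 : s 0%N = 0%N by apply: sn.
have sm l : (l < K)%N -> (s l < m)%N by move/shom; rewrite sK.
have [ps hps0] := psi_ex (homo_lt_inj shom).
have hps := hps0 K.
have [u0' Uu0 e0] := along_surj hps (fun a => onto a.2) hu0.
have [u1' Uu1 e1] := along_surj hps (fun a => onto a.2) hu1.
have psx : ps x = x by apply: along_id Uxn _ _ sn (hps0 n).
have hRs := rep_along hps sm hR.
have [j [jn jK gap]] : exists j, [/\ (n.-1 <= j)%N, (j < K)%N & (s j + M < s j.+1)%N].
  by apply: gap_exists; [lia|apply: sn; lia|rewrite sK].
have leg l l' : (l <= l')%N -> (s l <= s l')%N by rewrite leq_eqVlt => /orP [/eqP -> //|/shom /ltnW].
pose sg l := if (l <= j)%N then s l else if (l <= j + M)%N then (s j + (l - j))%N else s (l - M)%N.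
have sghom : {homo sg : l l' / (l < l')%N}.
  move=> l l' ll'; rewrite /sg; case: (leqP l j) => lj; last first.
    case: (leqP l' j) => l'j; first by lia.
    case: (leqP l (j + M)) => lM; last by rewrite ifN; [apply: shom|]; lia.
    case: (leqP l' (j + M)) => l'M; first by lia.
    by have := leg j.+1 (l' - M)%N; lia.
  case: (leqP l' j) => l'j; first exact: shom.
  have := leg l j lj; case: (leqP l' (j + M)) => l'M; first by lia.
  by have := leg j.+1 (l' - M)%N; lia.
have sg0 : sg 0%N = 0%N by rewrite /sg leq0n.
have sgm l : (l < K + M)%N -> (sg l < m)%N.
  have -> : m = sg (K + M)%N by rewrite /sg ifN ?ifN ?addnK ?sK //; lia.
  exact: sghom.
have sgE l : sg (skip j M l) = s l.
  rewrite /skip; case: (leqP l j) => lj; first by rewrite /sg lj.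
  by rewrite /sg !ifN ?addnK //; lia.
have [pg hpg0] := psi_ex (homo_lt_inj sghom).
have hpg := hpg0 (K + M)%N.
have hRg := rep_along hpg sgm hR.
have hthg := hw_row_along hpg sghom sg0 sgm hth.
have hths := hw_row_along hps shom s0 sm hth.
have k2' : (1 < K + M)%N := leq_trans k2 (leq_addr _ _).
have [c0 hc0] := hw_row_grel hRg hthg.
have [v [hv1 hvl]] := hw_column hX hRg hthg hc0.
have hf := rep_fun_hwf hRg hthg hvl.
have skK l : (l < K)%N -> (skip j M l < K + M)%N by rewrite /skip; case: ifP; lia.
have skhom : {homo skip j M : l l' / (l < l')%N} by move=> l l'; rewrite /skip; do 2 case: ifP; lia.
have sk0 : skip j M 0 = 0%N by [].
have pgE phi z : along X K (skip j M) phi -> inU K X z -> pg (phi z) = ps z.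
  move=> hphi hz; apply: (along_eq _ (along_comp hphi hpg skK) hps hz) => l _; apply: sgE.
have [w0 [w1 [h0 h1 nz']]] : exists w0 w1, [/\ inU K X w0, inU K X w1 & rep_fun (R \o ps) th v (w0 * x * w1) != 0].
  have [c1 hc1] := hw_row_grel hRs hths.
  apply: (rep_fun_nonzero hX hRs hths hc1 hv1 _ k2 (u0 := u0') (u1 := u1')).
  - move=> t z ht tpos hz /=.
    have [phi hphi0] := psi_ex (homo_lt_inj skhom); have hphi := hphi0 K.
    have UX : inU K X (Xp X t) by case/andP: ht => *; apply: inU_X.
    rewrite -(pgE _ _ hphi (gsubM hz UX)); case: (hphi) => -[_ _ p3] _; rewrite p3 (phi_Xp hphi ht).
    apply: hvl; [exact: below2_relabel skK _ ht|exact: (gr2_relabel symp skhom sk0 t).1|exact: phi_inU hphi skK _ hz].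
  - exact: inU_le nK Uxn.
  - exact: Uu0.
  - exact: Uu1.
  - by case: (hps) => -[_ _ p3] _; rewrite /= !p3 e0 e1 psx.
exists j, (lam \o sg), (rep_fun (R \o pg) th v); split; first by rewrite jn.
- by split=> //; apply: (rep_fun1 hRg hv1).
- move=> z hz Iz; rewrite /rep_fun /=.
  have Ug : inU m X (pg z) by apply: phi_inU hpg sgm _ hz.
  have -> : R (pg z) = 0 by apply/(RJ _ Ug)/IJ => //; apply: (ideal_relabel hX psi_ex hI hz Iz (homo_lt_inj sghom)) hpg.
  by rewrite mulmx0 mul0mx mxE.
- exact: (rep_fun_dominant hX hRg hthg hv1 hvl k2').
exists w0, w1; split; [exact: h0|exact: h1|] => phi hphi; rewrite /rep_fun /= (pgE _ _ hphi); first exact: nz'.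
by have UxK := inU_le nK Uxn; gsub_closed.
Qed.
End GapWeights.

(** * Hilbert's basis theorem and generic points *)

Section IdealSpan.
Variable R : comNzRingType.
Implicit Types (s : seq R) (x y : R) (J : R -> Prop).

Inductive ispan s : R -> Prop :=
| ispan0 : ispan s 0
| ispan_cons a x y : x \in s -> ispan s y -> ispan s (a * x + y).

Definition ideal J := J 0 /\ forall a x y, J x -> J y -> J (a * x + y).

Lemma ispan_ideal s : ideal (ispan s).
Proof.
split=> [|a x y]; first exact: ispan0.
elim=> [|b u v us _ IH] hy; first by rewrite mulr0 add0r.
by rewrite mulrDr mulrA -addrA; apply: ispan_cons => //; apply: IH.
Qed.

Lemma ispan_min s J x : ideal J -> (forall y, y \in s -> J y) -> ispan s x -> J x.
Proof. by move=> [J0 JP] sJ; elim=> // a u v us _ Jv; apply: JP => //; apply: sJ. Qed.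

Definition noetherian := forall J, ideal J -> exists2 s, (forall x, x \in s -> J x) & forall x, J x -> ispan s x.
End IdealSpan.

Lemma field_noetherian (F : fieldType) : noetherian F.
Proof.
move=> J [J0 JP]; case: (pselect (exists2 x, J x & x != 0)) => [[x Jx x0]|h].
  exists [:: x] => [y|y _]; first by rewrite inE => /eqP ->.
  by rewrite -[y]addr0 -[y](divfK x0); apply: ispan_cons; [rewrite mem_head|apply: ispan0].
exists [::] => // x Jx; suff -> : x = 0 by apply: ispan0.
by apply: contrapT => /eqP x0; apply: h; exists x.
Qed.

Section Hilbert.
Variable R : comNzRingType.
Hypothesis hR : noetherian R.
Variable J : {poly R} -> Prop.
Hypothesis hJ : ideal J.

Definition top_coefs (n : nat) (c : R) := exists p : {poly R}, [/\ J p, (size p <= n.+1)%N & p`_n = c].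

Lemma top_coefs_ideal n : ideal (top_coefs n).
Proof.
have [J0 JP] := hJ; split=> [|a x y [p [Jp sp <-]] [q [Jq sq <-]]].
  by exists 0; rewrite size_poly0 coef0.
exists (a%:P * p + q); rewrite coefD coefCM; split=> //; first exact: JP.
rewrite (leq_trans (size_polyD _ _)) // geq_max sq andbT mul_polyC.
exact: leq_trans (size_scale_leq _ _) sp.
Qed.

Lemma top_coefs_le n m c : (n <= m)%N -> top_coefs n c -> top_coefs m c.
Proof.
move=> nm [p [Jp sp <-]]; have [J0 JP] := hJ; exists ('X^(m - n) * p + 0); split; first exact: JP.
  rewrite addr0; have [->|p0] := eqVneq p 0; first by rewrite mulr0 size_poly0.
  by rewrite mulrC size_mulXn // -(subnK nm); move: sp; set e := (m - n)%N; lia.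
by rewrite addr0 coefXnM ltnNge leq_subr /= subKn.
Qed.

Lemma top_coefs_stable : exists N, forall n c, top_coefs n c -> top_coefs (minn n N) c.
Proof.
have [|s sL hs] := hR (J := fun c => exists n, top_coefs n c).
  split; first by exists 0%N; apply: (top_coefs_ideal 0).1.
  move=> a x y [n hn] [m hm]; exists (maxn n m); apply: (top_coefs_ideal _).2.
    by apply: top_coefs_le hn; apply: leq_maxl.
  by apply: top_coefs_le hm; apply: leq_maxr.
have [N hN] : exists N, forall c, c \in s -> top_coefs N c.
  elim: (s) sL => [|c s' IH] sL; first by exists 0%N.
  have [|N hN] := IH; first by move=> x xs; apply: sL; rewrite inE xs orbT.
  have [n hn] := sL c (mem_head _ _); exists (maxn n N) => x; rewrite inE => /orP [/eqP ->|/hN h].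
    by apply: top_coefs_le hn; apply: leq_maxl.
  by apply: top_coefs_le h; apply: leq_maxr.
exists N => n c hc; case: (leqP n N) => nN; first by [].
by apply: (ispan_min (top_coefs_ideal N) hN); apply: hs; exists n.
Qed.

Lemma ideal_fin_gen : exists2 s, (forall x, x \in s -> J x) & forall x, J x -> ispan s x.
Proof.
have [J0 JP] := hJ; have [N hN] := top_coefs_stable.
have /choice [G hG] : forall n, exists G : seq {poly R}, (forall p, p \in G -> J p /\ (size p <= n.+1)%N) /\
    forall c, top_coefs n c -> ispan [seq (p : {poly R})`_n | p <- G] c.
  move=> n; have [s sL hs] := hR (top_coefs_ideal n).
  suff [G GJ eG] : exists2 G : seq {poly R}, (forall p, p \in G -> J p /\ (size p <= n.+1)%N) & s = [seq (p : {poly R})`_n | p <- G].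
    by exists G; rewrite -eG.
  elim: (s) sL => [|c s' IH] sL; first by exists [::].
  have [|G hG ->] := IH; first by move=> x xs; apply: sL; rewrite inE xs orbT.
  have [p [Jp sp <-]] := sL c (mem_head _ _); exists (p :: G) => // q.
  by rewrite inE => /orP [/eqP ->|/hG].
pose T := flatten [seq G n | n <- iota 0 N.+1].
have TG n p : (n <= N)%N -> p \in G n -> p \in T.
  by move=> nN pG; apply/flatten_mapP; exists n; rewrite ?mem_iota.
have TJ p : p \in T -> J p by case/flatten_mapP => n _ /(hG n).1 [].
exists T => // p; elim: {p}(size p) {-2}p (leqnn (size p)) => [|m IH] p sp Jp.
  by move: sp; rewrite leqn0 size_poly_eq0 => /eqP ->; apply: ispan0.
have [g [gT sg gc]] : exists g, [/\ ispan T g, (size g <= (minn m N).+1)%N & g`_(minn m N) = p`_m].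
  have : top_coefs (minn m N) p`_m by apply: hN; exists p.
  move/(hG _).2; elim=> [|a x y /mapP [q qG ->] _ [g [gT sg <-]]].
    by exists 0; rewrite size_poly0 coef0; split=> //; apply: ispan0.
  exists (a%:P * q + g); rewrite coefD coefCM; split=> //.
    by apply: ispan_cons => //; apply: TG qG; apply: geq_minr.
  rewrite (leq_trans (size_polyD _ _)) // geq_max sg andbT mul_polyC.
  exact: leq_trans (size_scale_leq _ _) ((hG _).1 _ qG).2.
have [_ TP] := ispan_ideal T.
pose e := (m - minn m N)%N; have em : (e + minn m N)%N = m by rewrite subnK // geq_minl.
have Jg : J g by apply: ispan_min gT.
have -> : p = 'X^e * g + (- 1 * ('X^e * g) + p) by rewrite mulN1r addrA subrr add0r.
apply: TP => //; apply: IH; last first.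
  by apply: (JP _ _ _ _ Jp); rewrite -['X^e * g]addr0; apply: JP.
apply/leq_sizeP => i mi; rewrite mulN1r coefD coefN coefXnM.
case: (ltnP i e) => ie; first by lia.
case: (ltngtP m i) => [lt|gt|<-]; [|by lia|].
  rewrite (nth_default _ (leq_trans sp lt)) nth_default ?oppr0 ?addr0 //.
  by rewrite (leq_trans sg) //; lia.
by rewrite -gc (_ : m - e = minn m N)%N ?addNr //; lia.
Qed.
End Hilbert.

Fixpoint multipoly (k : nat) : comNzRingType := if k is k'.+1 then {poly (multipoly k')} else C.

Fixpoint meval (lam : nat -> C) k : {rmorphism multipoly k -> C} :=
  match k return {rmorphism multipoly k -> C} with
  | 0 => idfun
  | k'.+1 => horner_eval (lam k') \o map_poly (meval lam k')
  end.

Lemma multipoly_noetherian k : noetherian (multipoly k).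
Proof. by elim: k => [|k IH]; [apply: field_noetherian|move=> J; apply: ideal_fin_gen]. Qed.

Lemma mevalS lam k (p : {poly multipoly k}) : meval lam k.+1 p = (map_poly (meval lam k) p).[lam k].
Proof. by []. Qed.

Lemma Pol_meval k p : Pol k p -> exists P : multipoly k, forall lam, p lam = meval lam k P.
Proof.
elim=> {p} [c|i ik|p q _ [P hP] _ [Q hQ]|p q _ [P hP] _ [Q hQ]].
- elim: k => [|k [P hP]]; first by exists c.
  by exists (P%:P : {poly multipoly k}) => lam; rewrite mevalS map_polyC hornerC; apply: hP.
- elim: k ik => // k IH; rewrite ltnS leq_eqVlt => /orP [/eqP ->|/IH [P hP]].
    by exists ('X : {poly multipoly k}) => lam; rewrite mevalS map_polyX hornerX.
  by exists (P%:P : {poly multipoly k}) => lam; rewrite mevalS map_polyC hornerC; apply: hP.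
- by exists (P + Q) => lam; rewrite rmorphD hP hQ.
- by exists (P * Q) => lam; rewrite rmorphM hP hQ.
Qed.

(* Hilbert's basis theorem: the ideals of the tails of a sequence of points become stationary. *)
Lemma generic_point k (q : nat -> nat -> C) :
  exists a0, forall p, Pol k p -> (exists A, forall a, (A <= a)%N -> p (q a) = 0) -> p (q a0) = 0.
Proof.
pose J (P : multipoly k) := exists A, forall a, (A <= a)%N -> meval (q a) k P = 0.
have [|s sJ hs] := @multipoly_noetherian k J.
  split; first by exists 0%N => a _; rewrite rmorph0.
  move=> a P Q [A hA] [B hB]; exists (maxn A B) => i; rewrite geq_max => /andP [Ai Bi].
  by rewrite rmorphD rmorphM hA // hB // mulr0 addr0.
have [a0 ha0] : exists a0, forall P, P \in s -> meval (q a0) k P = 0.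
  suff [A hA] : exists A, forall P a, P \in s -> (A <= a)%N -> meval (q a) k P = 0.
    by exists A => P Ps; apply: hA.
  elim: (s) sJ => [|P s' IH] sJ; first by exists 0%N.
  have [|A hA] := IH; first by move=> Q Qs; apply: sJ; rewrite inE Qs orbT.
  have [B hB] := sJ P (mem_head _ _); exists (maxn A B) => Q a; rewrite inE geq_max => + /andP [Aa Ba].
  by move=> /orP [/eqP ->|Qs]; [apply: hB|apply: hA].
exists a0 => p /Pol_meval [P hP] [A hA]; rewrite hP.
have : ispan s P by apply: hs; exists A => a Aa; rewrite -hP hA.
apply: (ispan_min (J := fun P => meval (q a0) k P = 0)) => //.
split; first exact: rmorph0.
by move=> a x y hx hy; rewrite rmorphD rmorphM hx hy mulr0 addr0.
Qed.

Lemma Pol_subst k k' p g : Pol k p -> (forall i, (i < k)%N -> (g i < k')%N) -> Pol k' (fun mu => p (mu \o g)).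
Proof.
move=> hp hg; elim: hp => {p} [c|i ik|p q _ hP _ hQ|p q _ hP _ hQ].
- exact: Pol_const.
- exact: (Pol_var (hg i ik)).
- exact: Pol_add.
- exact: Pol_mul.
Qed.

Definition setw (lam : nat -> C) i t : nat -> C := fun l => if l == i then t else lam l.

Lemma Pol_degree k p : Pol k p -> exists D, forall lam i, exists2 Q : {poly C}, (size Q <= D.+1)%N &
  forall t, p (setw lam i t) = Q.[t].
Proof.
elim=> {p} [c|l lk|p q _ [D hD] _ [E hE]|p q _ [D hD] _ [E hE]].
- exists 0%N => lam i; exists c%:P; first by rewrite size_polyC; case: eqP.
  by move=> t; rewrite hornerC.
- exists 1%N => lam i; case: (eqVneq l i) => li.
    by exists 'X; [rewrite size_polyX|move=> t; rewrite hornerX /setw li eqxx].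
  exists (lam l)%:P; first by rewrite size_polyC; case: eqP.
  by move=> t; rewrite hornerC /setw (negPf li).
- exists (maxn D E) => lam i; have [P sP hP] := hD lam i; have [Q sQ hQ] := hE lam i; exists (P + Q).
    by rewrite (leq_trans (size_polyD _ _)) // geq_max (leq_trans sP) ?(leq_trans sQ) // ltnS ?leq_maxl ?leq_maxr.
  by move=> t; rewrite hornerD hP hQ.
- exists (D + E)%N => lam i; have [P sP hP] := hD lam i; have [Q sQ hQ] := hE lam i; exists (P * Q).
    by rewrite (leq_trans (size_polyMleq _ _)) //; lia.
  by move=> t; rewrite hornerM hP hQ.
Qed.

Lemma Pol_grid k p D lam i (w : nat -> C) :
  (forall lam i, exists2 Q : {poly C}, (size Q <= D.+1)%N & forall t, p (setw lam i t) = Q.[t]) ->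
  Pol k p -> {in gtn D.+1 &, injective w} -> (forall e, (e <= D)%N -> p (setw lam i (w e)) = 0) -> p lam = 0.
Proof.
move=> hD hp winj hw; have [Q sQ hQ] := hD lam i.
suff Q0 : Q = 0.
  have -> : p lam = p (setw lam i (lam i)).
    by apply: Pol_ext hp _ => l _; rewrite /setw; case: eqP => [->|].
  by rewrite hQ Q0 horner0.
apply: (@roots_geq_poly_eq0 _ _ [seq w e | e <- iota 0 D.+1]); last by rewrite size_map size_iota.
  by apply/allP => _ /mapP [e + ->]; rewrite mem_iota => eD; apply/rootP; rewrite -hQ hw //; lia.
by rewrite map_inj_in_uniq ?iota_uniq // => e e'; rewrite !mem_iota => h h'; apply: winj.
Qed.

(** * Limits of highest weights *)

Lemma run_cases (V : nat -> nat) a : {homo V : s t / (s <= t)%N} -> (0 < a)%N ->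
  (exists2 t0, (t0 + a <= a * a)%N & forall i, (i < a)%N -> V (t0 + i)%N = V t0) \/
  (forall e e', (e < e')%N -> (e' < a)%N -> (V (e * a) < V (e' * a))%N).
Proof.
move=> hV a0; case: (pselect (exists2 e, (e.+1 < a)%N & V (e * a)%N = V (e.+1 * a)%N)) => [[e ea eV]|h].
  left; exists (e * a)%N => [|i ia]; first by rewrite addnC -mulSn leq_mul2r ltnW ?orbT.
  apply/eqP; rewrite eqn_leq; apply/andP; split; last by apply: hV; apply: leq_addr.
  by rewrite eV; apply: hV; rewrite mulSn addnC leq_add2r ltnW.
right=> e e' ee e'a; have st i : (i.+1 < a)%N -> (V (i * a) < V (i.+1 * a))%N.
  move=> ia; rewrite ltn_neqAle hV ?leq_mul2r ?leqnSn ?orbT // andbT.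
  by apply/eqP => e1; apply: h; exists i.
elim: e' ee e'a => // e' IH; rewrite ltnS leq_eqVlt => /orP [/eqP -> |ee] e'a; first exact: st.
by apply: ltn_trans (IH ee (ltnW e'a)) (st _ e'a).
Qed.

Lemma dominant_heights symp k lam : dominant symp k lam ->
  exists2 ht : nat -> nat, {homo ht : s t / (s <= t)%N} & forall i, (i < k)%N -> lam i = lam 0%N + (ht i)%:R.
Proof.
move=> [hd _]; have /choice [d hd'] : forall i, exists d, (i.+1 < k)%N -> lam i.+1 - lam i = d%:R.
  move=> i; case: (ltnP i.+1 k) => ik; last by exists 0%N.
  by have [d e] := hd i ik; exists d.
exists (fun i => \sum_(0 <= l < i) d l)%N => [s t st|i]; last first.
  elim: i => [|i IH ik]; first by rewrite big_nil addr0.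
  by rewrite big_nat_recr //= natrD addrA -IH ?(ltnW ik) // -(hd' i ik) addrC subrK.
by rewrite (big_cat_nat (leq0n s) st) /= leq_addr.
Qed.

(* [mu \o collapse j r] repeats [r] times the coordinate [j.+1] of [mu]. *)
Definition collapse (j r l : nat) : nat := if (l <= j)%N then l else if (l <= j + r)%N then j.+1 else (l - r).+1.

Lemma gl_boundE d s t : gl_bound d s t = (\prod_(s <= l < t) (d l).+1)%N. Proof. by []. Qed.

Lemma gl_bound_gt0 d s t : (0 < gl_bound d s t)%N.
Proof. by rewrite gl_boundE; apply: prodn_gt0. Qed.

Lemma gl_bound_le d s s' t' t : (s <= s')%N -> (t' <= t)%N -> (gl_bound d s' t' <= gl_bound d s t)%N.
Proof.
move=> ss tt; case: (leqP s' t') => st; last first.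
  by rewrite gl_boundE big_geq ?gl_bound_gt0 // ltnW.
rewrite !gl_boundE [leqRHS](big_cat_nat (leq_trans ss st) tt) (big_cat_nat ss st) /=.
rewrite -mulnA mulnCA leq_pmulr // muln_gt0.
by rewrite -!gl_boundE !gl_bound_gt0.
Qed.

Definition stretch (d : nat -> nat) (j r l : nat) : nat :=
  if (l <= j)%N then d l else if (l < j + r)%N then 0%N else d (l - r).+1.

Lemma gl_bound_stretch d j r K : (0 < r)%N -> (j < K)%N ->
  gl_bound (stretch d j r) 0 (K + r).-1 = gl_bound d 0 K.
Proof.
move=> r0 jK; rewrite !gl_boundE.
rewrite (big_cat_nat (n := j.+1)) //=; last by lia.
rewrite [in RHS](big_cat_nat (n := j.+1)) //=; congr (_ * _)%N.
  by apply: eq_big_nat => l /andP [_ lj]; rewrite /stretch -ltnS lj.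
rewrite (big_cat_nat (n := (j + r)%N)) //=; try by lia.
rewrite big_nat big1 ?mul1n => [|l /andP [l1 l2]]; last by rewrite /stretch l2 ifN //; lia.
rewrite (_ : j + r = j.+1 + r.-1)%N; last by lia.
rewrite big_addn (_ : (K + r).-1 - r.-1 = K)%N; last by lia.
apply: eq_big_nat => l /andP [l1 l2]; rewrite /stretch !ifN; try by lia.
by congr (d _).+1; lia.
Qed.

Section LimitWeights.
Variables (symp : bool) (A : algType C) (X : label -> label -> A).
Hypothesis hX : forall k, relX symp k X.
Hypothesis psi_ex : forall f, injective f -> exists phi : A -> A, forall k, along X k f phi.
Variable I : A -> Prop.
Hypothesis hI : two_sided_ideal I.

Lemma hwf_along k m f phi F lam : along X k f phi -> {homo f : x y / (x < y)%N} -> f 0%N = 0%N ->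
  (forall l, (l < k)%N -> (f l < m)%N) -> hwf symp m X F lam -> hwf symp k X (F \o phi) (lam \o f).
Proof.
move=> hphi fhom f0 fm hF; have [[p1 _ p3] _] := hphi.
have UP u : inU k X u -> inU m X (phi u) by apply: phi_inU hphi fm _.
split=> [c u v hu hv|t u ht tneg hu|t u ht tpos hu|i u ik hu] /=.
- by rewrite p1 (hwf_lin hF) //; apply: UP.
- rewrite p3 (phi_Xp hphi ht) (hwf_neg hF) //; [exact: below2_relabel ht|exact: (gr2_relabel symp fhom f0 t).2|exact: UP].
- rewrite p3 (phi_Xp hphi ht) (hwf_pos hF) //; [exact: below2_relabel ht|exact: (gr2_relabel symp fhom f0 t).1|exact: UP].
- by rewrite p3 (phi_hel symp hphi ik) (hwf_hel hF) //; [exact: fm|exact: UP].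
Qed.

Lemma Act_relabel k m f lam : {homo f : x y / (x < y)%N} -> f 0%N = 0%N ->
  (forall l, (l < k)%N -> (f l < m)%N) -> Act symp m X I lam -> Act symp k X I (lam \o f).
Proof.
move=> fhom f0 fm [F [hF F1 FI]]; have [phi hphi0] := psi_ex (homo_lt_inj fhom).
have hphi := hphi0 k; exists (F \o phi); split.
- exact: hwf_along hphi fhom f0 fm hF.
- by case: hphi => -[_ p1 _] _; rewrite /= p1.
- move=> u hu Iu; apply: FI; first exact: phi_inU hphi fm _ hu.
  exact: (ideal_relabel hX psi_ex hI hu Iu (homo_lt_inj fhom) hphi).
Qed.

Lemma hwf_ext k F lam lam' : (forall i, (i < k)%N -> lam i = lam' i) -> hwf symp k X F lam -> hwf symp k X F lam'.
Proof. by move=> e [h1 h2 h3 h4]; split=> // i u ik hu; rewrite -e // h4. Qed.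

Lemma Act_ext k lam lam' : (forall i, (i < k)%N -> lam i = lam' i) -> Act symp k X I lam -> Act symp k X I lam'.
Proof. by move=> e [F [hF F1 FI]]; exists F; split=> //; apply: hwf_ext hF. Qed.

Variables (K j : nat).
Hypotheses (j0 : (0 < j)%N) (jK : (j < K)%N).

Definition run_stable (a : nat) (mu : nat -> C) := forall r P D, (0 < r)%N -> (r * D.+1 <= a)%N ->
  Pol (K + r) P -> (forall lam i, exists2 Q : {poly C}, (size Q <= D.+1)%N & forall t, P (setw lam i t) = Q.[t]) ->
  (forall lam, Act symp (K + r) X I lam -> P lam = 0) -> P (mu \o collapse j r) = 0.

Lemma run_weight a M lam : (0 < a)%N -> (a * a <= M)%N -> dominant symp (K + M) lam -> Act symp (K + M) X I lam ->
  exists mu, [/\ run_stable a mu, dominant symp K.+1 mu & forall l, mu (skip j 1 l) = lam (skip j M l)].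
Proof.
move=> a0 aM dom act; have [ht hthom hlam] := dominant_heights dom.
have lamD s t : (s <= t)%N -> (t < K + M)%N -> lam t - lam s = (ht t - ht s)%N%:R.
  move=> st tK; rewrite (hlam t tK) (hlam s (leq_ltn_trans st tK)) opprD addrACA subrr add0r.
  by rewrite natrB // hthom.
pose rho t l := if (l <= j)%N then l else if l == j.+1 then t else (l.-1 + M)%N.
have rho_dom t : (j <= t <= j + M)%N -> dominant symp K.+1 (lam \o rho t).
  move=> /andP [jt tj]; split=> [i iK|].
    exists (ht (rho t i.+1) - ht (rho t i))%N; rewrite /= lamD //.
      rewrite /rho; case: (leqP i.+1 j) => ij; first by rewrite (ltnW ij).
      by case: (leqP i j) => ij'; case: eqP => e1; try (case: eqP => e2); lia.
    rewrite /rho; case: (leqP i.+1 j) => ij; first by lia.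
    by case: eqP => e1; lia.
  by case: dom => _ [n0 hn0]; exists n0; rewrite -hn0 /= /rho leq0n j0.
have rho_skip t l : (lam \o rho t) (skip j 1 l) = lam (skip j M l).
  rewrite /rho /skip /=; case: (leqP l j) => lj; first by rewrite lj.
  by rewrite ifN ?ifN ?addn1 //; lia.
have [|[t0 t0a t0V]|inc] := @run_cases (fun t => ht (j.+1 + t)%N) a _ a0.
- by move=> s t st; apply: hthom; rewrite leq_add2l.
- exists (lam \o rho (j.+1 + t0)%N); split=> //; last by apply: rho_dom; lia.
  move=> r P D r0 ra hP hD hact; have ra' : (r <= a)%N by apply: leq_trans ra; rewrite leq_pmulr.
  apply: hact.
  pose tau l := if (l <= j)%N then l else if (l <= j + r)%N then (l + t0)%N else (l - r + M)%N.
  apply: (@Act_ext _ (lam \o tau)); last first.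
    apply: Act_relabel act => //.
    + move=> x y xy; rewrite /tau; case: (leqP x j) => xj; case: (leqP y j) => yj; try lia.
        by case: (leqP y (j + r)); lia.
      by case: (leqP x (j + r)); case: (leqP y (j + r)); lia.
    + by move=> l lK; rewrite /tau; case: (leqP l j) => lj; case: (leqP l (j + r)) => lr; lia.
  move=> l lK; rewrite /tau /collapse /rho /=; case: (leqP l j) => lj; first by rewrite lj.
  case: (leqP l (j + r)) => lr; last first.
    by rewrite ifN ?ifN; try lia; congr lam; lia.
  rewrite ltnn eqxx (hlam _) ?(hlam (j.+1 + t0)%N); try lia.
  have := t0V (l - j.+1)%N; rewrite addnA => e; rewrite -e; last by lia.
  by congr (_ + (ht _)%:R); lia.
exists (lam \o rho j); split=> //; last by apply: rho_dom; lia.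
move=> r P D r0 ra hP hD hact.
suff claim s : (s <= r)%N -> forall y, (forall l, (l <= j)%N -> y l = lam l) ->
    (forall l, (j + r < l)%N -> (l < K + r)%N -> y l = lam (l - r + M)%N) ->
    (forall i, (s <= i)%N -> (i < r)%N -> exists2 e, (i * D.+1 <= e < i.+1 * D.+1)%N & y (j.+1 + i)%N = lam (j.+1 + e * a)%N) ->
    P y = 0.
  apply: (claim r) => // [l lj|l lj lK|i ri ir]; last by lia.
    by rewrite /= /collapse lj /rho lj.
  by rewrite /= /collapse !ifN; try lia; rewrite /rho !ifN; try lia; congr lam; lia.
have ebnd i e : (i < r)%N -> (e < i.+1 * D.+1)%N -> (e < a)%N.
  move=> ir ei; apply: leq_trans ei _; apply: leq_trans ra; by rewrite leq_mul2r ir orbT.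
elim: s => [_|s IH sr] y yj yr ys.
  have /choice [e he] : forall i, exists e, (i < r)%N -> (i * D.+1 <= e < i.+1 * D.+1)%N /\ y (j.+1 + i)%N = lam (j.+1 + e * a)%N.
    move=> i; case: (ltnP i r) => ir; last by exists 0%N.
    by have [e h1 h2] := ys i (leq0n _) ir; exists e.
  have emono i i' : (i < i')%N -> (i' < r)%N -> (e i < e i')%N.
    move=> ii ir; have [/andP [_ h1] _] := he i (ltn_trans ii ir); have [/andP [h2 _] _] := he i' ir.
    apply: leq_trans h1 (leq_trans _ h2); by rewrite leq_mul2r ii orbT.
  have ea i : (i < r)%N -> (e i * a + a <= M)%N.
    move=> ir; apply: leq_trans aM; rewrite addnC -mulSn leq_mul2r (ebnd i) ?orbT //.
    by case: (he i ir) => /andP [].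
  apply: hact; pose tau l := if (l <= j)%N then l else if (l <= j + r)%N then (j.+1 + e (l - j.+1) * a)%N else (l - r + M)%N.
  apply: (@Act_ext _ (lam \o tau)); last first.
    apply: Act_relabel act => //.
    + move=> x y' xy; rewrite /tau; case: (leqP x j) => xj; case: (leqP y' j) => yj'; try lia.
        by case: (leqP y' (j + r)); lia.
      case: (leqP x (j + r)) => xr; case: (leqP y' (j + r)) => yr'; try lia; last first.
        by have := ea (x - j.+1)%N; lia.
      rewrite ltn_add2l ltn_mul2r a0 /=; apply: emono; lia.
    + move=> l lK; rewrite /tau; case: (leqP l j) => lj; case: (leqP l (j + r)) => lr; try lia.
      by have := ea (l - j.+1)%N; lia.
  move=> l lK; rewrite /tau /=; case: (leqP l j) => lj; first by rewrite yj.
  case: (leqP l (j + r)) => lr; last by rewrite yr.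
  have [|_ <-] := he (l - j.+1)%N; first by lia.
  by congr y; lia.
apply: (Pol_grid (i := (j.+1 + s)%N) (w := fun e' => lam (j.+1 + (s * D.+1 + e') * a)%N) hD hP).
  have lt e1 e2 : (e1 < e2)%N -> (e2 < D.+1)%N ->
      lam (j.+1 + (s * D.+1 + e1) * a)%N != lam (j.+1 + (s * D.+1 + e2) * a)%N.
    move=> e12 e2D; have e2a : (s * D.+1 + e2 < a)%N by apply: (ebnd s) => //; rewrite mulSn addnC ltn_add2r.
    have h := inc (s * D.+1 + e1)%N (s * D.+1 + e2)%N.
    rewrite ltn_add2l in h; have {}h := h e12 e2a.
    have b : ((s * D.+1 + e2) * a + a <= M)%N by apply: leq_trans aM; rewrite addnC -mulSn leq_mul2r e2a orbT.
    rewrite (hlam (j.+1 + (s * D.+1 + e1) * a)%N) ?(hlam (j.+1 + (s * D.+1 + e2) * a)%N); try by lia.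
      by rewrite (inj_eq (addrI _)) eqr_nat; apply/eqP; lia.
    have : ((s * D.+1 + e1) * a <= (s * D.+1 + e2) * a)%N by rewrite leq_mul2r leq_add2l (ltnW e12) orbT.
    by lia.
  move=> e1 e2; rewrite !inE => h1 h2 /eqP e; case: (ltngtP e1 e2) => // h.
    by move: e; rewrite (negPf (lt _ _ h h2)).
  by move: e; rewrite eq_sym (negPf (lt _ _ h h1)).
move=> e eD; apply: IH (ltnW sr) _ _ _ _ => [l lj|l lr lK|i si ir].
- by rewrite /setw ifN ?yj //; apply/eqP; lia.
- by rewrite /setw ifN ?yr //; apply/eqP; lia.
- move: si; rewrite leq_eqVlt => /orP [/eqP <-|si].
    by exists (s * D.+1 + e)%N; rewrite /setw ?eqxx // mulSn; lia.
  have [e' h1 h2] := ys i si ir; exists e' => //.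
  by rewrite /setw ifN // eqn_add2l; apply/eqP; lia.
Qed.
End LimitWeights.

Lemma infinite_fiber (K : nat) (jf : nat -> nat) : (forall M, (jf M < K)%N) ->
  exists2 j, (j < K)%N & forall M0, exists2 M, (M0 <= M)%N & jf M = j.
Proof.
move=> hK; apply: contrapT => h.
have /choice [b hb] : forall j, exists b, (j < K)%N -> forall M, (b <= M)%N -> jf M <> j.
  move=> j; case: (ltnP j K) => jK; last by exists 0%N.
  apply: contrapT => h'; apply: h; exists j => // M0; apply: contrapT => h''; apply: h'.
  by exists M0 => _ M hM e; apply: h''; exists M.
pose B := (\max_(j < K) b j)%N; have jK := hK B.
by apply: (hb (jf B) jK B) => //; apply: (leq_bigmax (F := fun j : 'I_K => b j) (Ordinal jK)).
Qed.

Section LimitFunctionals.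
Variables (symp : bool) (A : algType C) (X : label -> label -> A).
Hypothesis hX : forall k, relX symp k X.
Hypothesis psi_ex : forall f, injective f -> exists phi : A -> A, forall k, along X k f phi.
Variable I : A -> Prop.
Hypothesis hI : two_sided_ideal I.
Hypothesis hloc : forall m x, inU m X x -> ~ I x -> exists J,
  [/\ fincodim_ideal (inU m X) J, ~ J x & forall u, inU m X u -> I u -> J u].
Variables (n d : nat) (x : A).
Hypothesis n2 : (1 < n)%N.
Hypothesis hx : lspan (fun z => exists w, [/\ all (below2 n) w, (size w <= d)%N & z = wprod (Xp X) w]) x.
Hypothesis nIx : ~ I x.
Local Notation K := (n + d.*2.*2)%N.

Lemma limit_weight : exists j mu w0 w1,
  [/\ (n.-1 <= j < K)%N, forall r, (0 < r)%N -> Act symp (K + r) X I (mu \o collapse j r), dominant symp K.+1 mu,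
     inU K X w0 /\ inU K X w1 & exists F, [/\ hwf symp K X F (mu \o skip j 1), F 1 = 1 & F (w0 * x * w1) != 0]].
Proof.
have /choice [jf hjf] := gap_weights hX psi_ex hI hloc n2 hx nIx.
have [j jK hj] : exists2 j, (j < K)%N & forall M0, exists2 M, (M0 <= M)%N & jf M = j.
  by apply: infinite_fiber => M; have [lam [f [/andP [_ h] _ _ _ _]]] := hjf M.
have nj : (n.-1 <= j)%N.
  by have [M _ <-] := hj 0%N; have [lam [f [/andP [h _] _ _ _ _]]] := hjf M.
have j0 : (0 < j)%N by lia.
have nK : (n <= K)%N by apply: leq_addr.
have Ux := inU_le nK (inU_x hx).
have skhom M : {homo skip j M : l l' / (l < l')%N} by move=> l l'; rewrite /skip; do 2 case: ifP; lia.
have skK M l : (l < K)%N -> (skip j M l < K + M)%N by rewrite /skip; case: ifP; lia.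
have sk0 M : skip j M 0 = 0%N by [].
have /choice [mu hmu] : forall a, exists mu, [/\ run_stable symp X I K j a.+1 mu, dominant symp K.+1 mu &
    exists w0 w1, (inU K X w0 /\ inU K X w1) /\ exists F, [/\ hwf symp K X F (mu \o skip j 1), F 1 = 1 & F (w0 * x * w1) != 0]].
  move=> a; have [M hM jM] := hj (a.+1 * a.+1)%N.
  have [lam [f [_ [hf f1] fI dom [w0 [w1 [h0 h1 hw]]]]]] := hjf M; rewrite jM in hw.
  have act : Act symp (K + M) X I lam by exists f.
  have [mu [h2 h3 h4]] := run_weight hX psi_ex hI j0 jK (ltn0Sn a) hM dom act.
  exists mu; split=> //; exists w0, w1; split=> //.
  have [phi hphi0] := psi_ex (homo_lt_inj (skhom M)); have hphi := hphi0 K.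
  exists (f \o phi); split; last exact: hw.
    apply: (@hwf_ext symp A X K _ (lam \o skip j M)); first by move=> i _; rewrite /= h4.
    by apply: hwf_along hphi (skhom M) _ (skK M) hf.
  by case: hphi => -[_ p1 _] _; rewrite /= p1.
have [a0 ha0] := generic_point K.+1 mu.
have [_ hdom [w0 [w1 [hw hF]]]] := hmu a0.
exists j, (mu a0), w0, w1; split=> //; first by rewrite nj.
move=> r r0; apply: (Act_closed (hX _)) => P hP hact.
apply: (ha0 (fun q => P (q \o collapse j r))).
  by apply: Pol_subst hP _ => i iK; rewrite /collapse; case: (leqP i j) => h1; case: (leqP i (j + r)) => h2; lia.
have [D hD] := Pol_degree hP; exists (r * D.+1)%N => a ra.
by have [st _ _] := hmu a; apply: (st r P D r0 _ hP hD hact); apply: leqW.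
Qed.

Lemma limit_functionals : exists N, forall r, (0 < r)%N -> exists f lam,
  [/\ hwf symp (K + r) X f lam, forall u, inU (K + r) X u -> I u -> f u = 0,
      forall u u', inU (K + r) X u -> inU (K + r) X u' -> f (u * Xp X (low_letter symp (K + r)) ^+ N * u') = 0 &
      exists w0 w1, [/\ inU (K + r) X w0, inU (K + r) X w1 & f (w0 * x * w1) != 0]].
Proof.
have [j [mu [w0 [w1 [/andP [nj jK] act [hd [n0 hn0]] [h0 h1] [F [hF F1 nz]]]]]]] := limit_weight.
have j0 : (0 < j)%N by lia.
have nK : (n <= K)%N by apply: leq_addr.
have Ux := inU_le nK (inU_x hx).
have /choice [dd hdd] : forall i, exists e, (i < K)%N -> mu i.+1 - mu i = e%:R.
  move=> i; case: (ltnP i K) => iK; last by exists 0%N.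
  by have [e he] := hd i iK; exists e.
pose G := gl_bound dd 0 K; pose N := (G * (G * n0.+1))%N.
exists N => r r0; have [f [hf f1 fI]] := act r r0; exists f, (mu \o collapse j r); split=> //.
- have K3 : (2 < K + r)%N by lia.
  move=> u u' hu hu'.
  have hdr i : (i.+1 < K + r)%N -> (mu \o collapse j r) i.+1 - (mu \o collapse j r) i = (stretch dd j r i)%:R.
    move=> iK; rewrite /= /collapse /stretch; case: (ltngtP i j) => [ij|ji|->].
    + by rewrite hdd ?(ltn_trans ij jK) // ltnW.
    + case: (ltnP i (j + r)) => ir; first by rewrite ifT ?subrr //; lia.
      case: (leqP i (j + r)) => ir'; rewrite -hdd; try by lia.
        by congr (mu _ - mu _); lia.
      by rewrite subSn //; lia.
    + by rewrite ifT ?hdd //; lia.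
  have hn0r : (if symp then (mu \o collapse j r) 0%N else (mu \o collapse j r) 1%N + (mu \o collapse j r) 0%N) = n0%:R.
    by rewrite -hn0 /= /collapse leq0n j0.
  have kill := low_bikilled (hX _) hf hdr hn0r K3.
  have Gr : gl_bound (stretch dd j r) 0 (K + r).-1 = G by apply: gl_bound_stretch.
  have lbN : (low_bound symp (K + r) (stretch dd j r) n0 <= N)%N.
    rewrite /low_bound /N; case: (symp).
      by rewrite Gr leq_pmull // gl_bound_gt0.
    by rewrite leq_mul // ?leq_mul2r -?Gr ?gl_bound_le ?orbT //; lia.
  have Ulow : inU (K + r) X (Xp X (low_letter symp (K + r))).
    have /andP [b1 b2] : below2 (K + r) (low_letter symp (K + r)) by apply: below2_low.
    exact: inU_X.
  rewrite -(subnKC lbN) exprD mulrA -(mulrA (u * _)); apply: kill => //; gsub_closed.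
have skhom : {homo skip j r : l l' / (l < l')%N} by move=> l l'; rewrite /skip; do 2 case: ifP; lia.
have skK l : (l < K)%N -> (skip j r l < K + r)%N by rewrite /skip; case: ifP; lia.
have [phi hphi0] := psi_ex (homo_lt_inj skhom); have hphi := hphi0 K.
exists (phi w0), (phi w1); split; [exact: phi_inU hphi skK _ h0|exact: phi_inU hphi skK _ h1|].
have [p [_ hp]] := harish_chandra (hX K) (gsubM (gsubM h0 Ux) h1).
have := hp _ _ hF; rewrite F1 mulr1 => eF.
have hf' := hwf_along hphi skhom (erefl 0%N : skip j r 0 = 0%N) skK hf.
have := hp _ _ hf'; rewrite /=; case: (hphi) => -[_ p1 p3] _; rewrite !p3 p1 f1 mulr1.
rewrite (along_id (inU_x hx) _ (hphi0 n)) => [->|l ln]; last by rewrite /skip ifT //; lia.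
rewrite (_ : _ \o _ = mu \o skip j 1) -?eF //; apply/funext => l /=; congr mu.
rewrite /collapse /skip; case: (leqP l j) => lj; first by rewrite lj.
by rewrite !ifN ?addnK ?addn1 //; lia.
Qed.
End LimitFunctionals.

(** * Finite codimension *)

Section NilpotentLetters.
Variables (symp : bool) (A : algType C) (X : label -> label -> A).
Hypothesis hX : forall k, relX symp k X.
Local Notation eps := (eps symp).
Local Notation om := (om symp).
Implicit Types (a b c : label).

(* Letters spanning the Lie algebra, each of them conjugate to a root vector: in the symplectic case the squares
   of [a] and [a + b], in the orthogonal case [a b] for [b != star a] and [(a + c) (star a - star c)]. *)
Definition other (i : nat) : nat := if i == 0%N then 1%N else 0%N.
Definition nil_letter (t : label * label) : A :=
  let: (a, b) := t in let c := (true, other a.2) in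
  if symp then (if a == b then X a a else X a a + X b a *+ 2 + X b b)
  else if b == star a then - X a (star c) + (X a (star a) - X c (star c)) + X c (star a) else X a b.

Variable k : nat.
Hypothesis k6 : (5 < k)%N.

Lemma om_idx a b : a.2 != b.2 -> om a b = 0.
Proof. by case: a b => [a i] [b j]; apply: om_ne. Qed.

Lemma om_diag a : om a a = 0.
Proof. by case: a => [a i]; apply: om_same. Qed.

Lemma om_star a : om (star a) a * om (star a) a = 1.
Proof. by case: a => [[] i]; rewrite /star /= ?om_ef ?om_fe ?eps2 ?mulr1. Qed.

Lemma X_sym a b : (a.2 < k)%N -> (b.2 < k)%N -> X b a = - eps *: X a b.
Proof. exact: (hX k).1. Qed.

Lemma fresh_index (s : seq nat) : (size s < k)%N -> exists2 i, (i < k)%N & i \notin s.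
Proof.
move=> sk; apply: contrapT => h; have : (size (iota 0 k) <= size s)%N.
  apply: uniq_leq_size (iota_uniq _ _) _ => i; rewrite mem_iota => ik.
  by apply: contrapT => /negP is_; apply: h; exists i.
by rewrite size_iota; lia.
Qed.

Section Transport.
Variables (K : A -> Prop) (N : nat).
Hypotheses (hK : subspace K) (Kad : forall a b z, (a.2 < k)%N -> (b.2 < k)%N -> K z -> K (X a b * z - z * X a b)).

Lemma KadZ s a b z : (a.2 < k)%N -> (b.2 < k)%N -> K z -> K ((s *: X a b) * z - z * (s *: X a b)).
Proof.
move=> ak bk Kz; rewrite -(scalerAl s (X a b)) -(scalerAr s z) -scalerBr.
by apply: subspaceZ => //; apply: Kad.
Qed.

Lemma bracketZ s a b u v : X a b * u - u * X a b = v -> (s *: X a b) * u - u * (s *: X a b) = s *: v.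
Proof. by move=> <-; rewrite -(scalerAl s (X a b)) -(scalerAr s u) scalerBr. Qed.

Lemma move_left a b c : (a.2 < k)%N -> (b.2 < k)%N -> (c.2 < k)%N -> a.2 != b.2 -> c.2 != a.2 -> c.2 != b.2 ->
  K (X a b ^+ N) -> K (X c b ^+ N).
Proof.
move=> ak bk ck ab ca cb; have ba : b.2 != a.2 by rewrite eq_sym.
have ac : a.2 != c.2 by rewrite eq_sym.
apply: (nil_top1 (y := om (star a) a *: X c (star a)) hK) => [z||]; first exact: KadZ.
- rewrite (@bracketZ _ _ _ _ (om (star a) a *: X c b)) ?scalerA ?om_star ?scale1r //.
  by rewrite (brX (hX k)) // (om_idx ca) (om_idx (a := star a) ab) (om_idx cb) !mulr0 !scale0r !subr0 addr0.
- rewrite (@bracketZ _ _ _ _ (0)) ?scaler0 //.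
  by rewrite (brX (hX k)) // (om_idx (a := star a) (b := c) ac) (om_idx (a := star a) (b := b) ab) (om_idx cb) om_diag !mulr0 !scale0r !subr0 addr0.
Qed.

Lemma power_neg u : K (u ^+ N) -> K ((- u) ^+ N).
Proof. by move=> Ku; rewrite exprNn -signr_odd; case: odd; rewrite ?expr1 ?mul1r // mulN1r -scaleN1r; apply: subspaceZ. Qed.

Lemma move_right a b c : symp = false -> (a.2 < k)%N -> (b.2 < k)%N -> (c.2 < k)%N -> a.2 != b.2 -> c.2 != a.2 -> c.2 != b.2 ->
  K (X a b ^+ N) -> K (X a c ^+ N).
Proof.
move=> so ak bk ck ab ca cb Kab; rewrite (X_sym ck ak) so epsF scaleN1r; apply: power_neg.
apply: (move_left (a := b)) => //; first by rewrite eq_sym.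
by rewrite (X_sym ak bk) so epsF scaleN1r; apply: power_neg.
Qed.

Lemma move_both a b c d : symp = false -> (a.2 < k)%N -> (b.2 < k)%N -> (c.2 < k)%N -> (d.2 < k)%N -> a.2 != b.2 -> c.2 != d.2 ->
  K (X a b ^+ N) -> K (X c d ^+ N).
Proof.
move=> so ak bk ck dk ab cd Kab.
have [|p pk] := @fresh_index [:: a.2; b.2; c.2; d.2]; first exact: ltn_trans k6.
rewrite !inE !negb_or => /and4P [pa pb pc pd].
have [|q qk] := @fresh_index [:: a.2; b.2; c.2; d.2; p]; first exact: k6.
rewrite !inE !negb_or => /and5P [qa qb qc qd qp].
have h1 : K (X (true, p) b ^+ N) by apply: move_left Kab.
have h2 : K (X (true, p) (true, q) ^+ N) by apply: move_right h1.
have h3 : K (X c (true, q) ^+ N) by apply: move_left h2 => //=; rewrite eq_sym.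
by apply: move_right h3 => //=; rewrite eq_sym.
Qed.

Lemma symp_shear a b : symp -> (a.2 < k)%N -> (b.2 < k)%N -> a != b ->
  exists y, [/\ forall z, K z -> K (y * z - z * y), y * X a a - X a a * y = X b a *+ 2,
    y * (X b a *+ 2) - (X b a *+ 2) * y = X b b *+ 2 & y * X b b - X b b * y = 0].
Proof.
move=> sp ak bk ab; have e1 : eps = -1 by rewrite sp epsT.
have sym x y : (x.2 < k)%N -> (y.2 < k)%N -> X y x = X x y by move=> xk yk; rewrite (X_sym xk yk) e1 opprK scale1r.
have w2 := om_star a; set w := om (star a) a in w2.
have dbl (y u : A) : y * (u *+ 2) - (u *+ 2) * y = (y * u - u * y) *+ 2 by rewrite mulrnAr mulrnAl mulrnBl.
case: (eqVneq b.2 a.2) => [ba2|ba].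
  have -> : b = star a by move: ba2 ab; case: (a) => [x i]; case: (b) => [y j] /= ->; case: x; case: y; rewrite ?eqxx.
  exists ((w / 2%:R) *: X (star a) (star a)); split=> [z|||]; first exact: KadZ.
  - rewrite (@bracketZ _ _ _ _ (w *: X (star a) a *+ 4)).
      by rewrite -!scaler_nat !scalerA; congr (_ *: _); rewrite [4 * w]mulrC mulrACA w2 mul1r (natrM _ 2 2) mulKf ?pnatr_eq0.
    rewrite (brX (hX k)) // -/w e1 !mulN1r (sym (star a) a) // !scaleNr !opprK.
    by rewrite !mulrS mulr0n addr0 !addrA.
  - rewrite dbl (@bracketZ _ _ _ _ (w *: X (star a) (star a) *+ 2)).
      by rewrite -!scaler_nat !scalerA; congr (_ *: _); rewrite [2%:R * (w / _)]mulrC mulfVK ?pnatr_eq0 // [2%:R * w]mulrC mulrA w2 mul1r.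
    by rewrite (brX (hX k)) // om_diag -/w e1 !mulr0 !mulN1r !scale0r subrr add0r scaleNr opprK mulr2n.
  - rewrite (@bracketZ _ _ _ _ (0)) ?scaler0 //.
    by rewrite (brX (hX k)) // om_diag !mulr0 !scale0r subrr addr0.
have ab2 : a.2 != b.2 by rewrite eq_sym.
exists (w *: X b (star a)); split=> [z|||]; first exact: KadZ.
- rewrite (@bracketZ _ _ _ _ (w *: X b a *+ 2)); first by rewrite -scaler_nat !scalerA mulrCA w2 mulr1 scaler_nat.
  by rewrite (brX (hX k)) // -/w (om_idx ba) !mulr0 !scale0r !subr0 (sym b a) // mulr2n.
- rewrite dbl (@bracketZ _ _ _ _ (w *: X b b)); first by rewrite scalerA w2 scale1r.
  by rewrite (brX (hX k)) // -/w (om_idx (a := star a) ab2) (om_idx ba) om_diag !mulr0 !scale0r !subr0 add0r.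
- rewrite (@bracketZ _ _ _ _ (0)) ?scaler0 //.
  by rewrite (brX (hX k)) // (om_idx (a := star a) ab2) om_diag !mulr0 !scale0r !subr0 addr0.
Qed.

Lemma nil_letter_power t0 t : below2 k t0 -> (if symp then t0.1 == t0.2 else t0.1.2 != t0.2.2) -> below2 k t ->
  (0 < N)%N -> K (Xp X t0 ^+ N) -> K (nil_letter t ^+ N).
Proof.
case: t0 t => [a0 b0] [a b] /andP /= [a0k b0k] h0 /andP /= [ak bk] N0; rewrite /Xp /= /nil_letter => K0.
case: (boolP symp) h0 => sp h0.
  have step c d : (c.2 < k)%N -> (d.2 < k)%N -> K (X c c ^+ N) -> K (X d d ^+ N).
    move=> ck dk; case: (eqVneq c d) => [-> //|cd].
    by have [y [hy e0 e1 e2]] := symp_shear sp ck dk cd; apply: nil_top2 hy e0 e1 e2.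
  have Kaa : K (X a a ^+ N) by apply: step a0k ak _; rewrite (eqP h0) in K0 *.
  case: (eqVneq a b) => // ab.
  have [y [hy e0 e1 e2]] := symp_shear sp ak bk ab.
  exact: nil_exp hK hy (expad_quad e0 e1 e2) Kaa.
have so : symp = false by apply/negbTE.
have e1 : eps = 1 by rewrite so epsF.
have Kcd c d : (c.2 < k)%N -> (d.2 < k)%N -> c.2 != d.2 -> K (X c d ^+ N).
  by move=> ck dk cd; apply: move_both h0 cd K0.
have k1 : (1 < k)%N by apply: ltn_trans k6.
case: (eqVneq b (star a)) => [_|ba].
  set c := (true, other a.2).
  have ca : c.2 != a.2 by rewrite /c /other /=; case: (a.2) => [|[|]].
  have ac : a.2 != c.2 by rewrite eq_sym.
  have ck : (c.2 < k)%N by rewrite /c /other /=; case: ifP => // _; apply: ltn_trans k1.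
  have omS x : om (star x) x = 1 by case: (x) => [[] i]; rewrite /star /= ?om_ef ?om_fe ?e1.
  have omS' x : om x (star x) = 1 by case: (x) => [[] i]; rewrite /star /= ?om_ef ?om_fe ?e1.
  have hy z : K z -> K (X c (star a) * z - z * X c (star a)) by apply: Kad.
  apply: (nil_exp hK hy (u := - X a (star c))); last by apply: power_neg; apply: Kcd.
  have hs : X (star a) (star c) = - X (star c) (star a) by rewrite (X_sym (a := star c)) // e1 scaleN1r.
  have o1 := om_idx (a := star a) (b := star c) ac. have o2 := om_idx (a := c) (b := a) ca.
  have o3 := om_idx (a := star a) (b := c) ac. have o4 := om_idx (a := c) (b := star a) ca.
  apply: expad_quad.
  - rewrite mulrN mulNr -opprD (brX (hX k)) // o1 o2 omS omS' e1 !mulr0 !mulr1 !scale0r !scale1r subr0 sub0r.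
    by rewrite opprD opprK addrC.
  - rewrite mulrBr mulrBl opprD addrACA -opprD !(brX (hX k)) //.
    rewrite !om_diag o1 o2 o3 o4 omS omS' e1 !mulr0 !mulr1 !scale0r !scale1r !subr0 !addr0 !add0r.
    by rewrite opprK mulr2n.
  - by rewrite (brX (hX k)) // o3 om_diag o4 om_diag !mulr0 !scale0r !subr0 addr0.
case: (eqVneq a.2 b.2) => [ab|]; last exact: Kcd.
have -> : b = a by move: ab ba; case: (a) => [x i]; case: (b) => [y j] /= <-; rewrite /star /=; case: x; case: y; rewrite ?eqxx.
by rewrite (X_diag (hX k) so) // expr0n (gtn_eqF N0); case: hK.
Qed.
End Transport.
End NilpotentLetters.

Section LongWords.
Variables (T : eqType) (B : algType C) (Z : T -> B) (L : seq T).

Fixpoint short_words (b : nat) : seq (seq T) :=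
  if b is b'.+1 then [::] :: [seq t :: w | t <- L, w <- short_words b'] else [:: [::]].

Lemma mem_short_words b w : {subset w <= L} -> (size w <= b)%N -> w \in short_words b.
Proof.
elim: b w => [|b IH] [|t w] //= wL sw.
rewrite inE /=; apply/allpairsP; exists (t, w); split=> //=; first by apply: wL; rewrite mem_head.
by apply: IH => // s sw'; apply: wL; rewrite inE sw' orbT.
Qed.

Lemma size_count (w : seq T) : uniq L -> {subset w <= L} -> (size w = \sum_(t <- L) count_mem t w)%N.
Proof.
move=> uL; elim: w => [_|s w IH wL] /=; first by rewrite big1_seq.
rewrite big_split /= -IH; last by move=> t tw; apply: wL; rewrite inE tw orbT.
rewrite (bigD1_seq s) //=; last by apply: wL; rewrite mem_head.
by rewrite eqxx big1 // => t /negPf; rewrite eq_sym => ->.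
Qed.

Variables (K : B -> Prop) (N : nat).
Hypothesis KM : forall u v z, K z -> K (u * z * v).
Hypothesis hZ : forall t, t \in L -> K (Z t ^+ N).
Hypothesis uL : uniq L.

(* In a long sorted word some letter is repeated [N] times in a row. *)
Lemma long_word w : {subset w <= L} -> sorted (relpre (index^~ L) leq) w -> (size L * N < size w)%N -> K (wprod Z w).
Proof.
move=> wL srt sw.
have [t tL ct] : exists2 t, t \in L & (N <= count_mem t w)%N.
  apply: contrapT => h; have : (\sum_(t <- L) count_mem t w <= \sum_(t <- L) N)%N.
    rewrite !big_seq; apply: leq_sum => t tL; rewrite leqNgt; apply/negP => h'; apply: h; exists t => //.
    exact: ltnW.
  by rewrite -size_count // big_const_seq count_predT iter_addn addn0 mulnC leqNgt sw.
rewrite (sorted_split (index t L) srt); set w1 := filter _ _; set w2 := filter _ _.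
have s2 : sorted (relpre (index^~ L) leq) w2.
  by apply: sorted_filter srt => x y z; apply: leq_trans.
rewrite (sorted_split (index t L).+1 s2); set w3 := filter _ _; set w4 := filter _ _.
have e3 : all (pred1 t) w3.
  apply/allP => s; rewrite !mem_filter ltnS => /andP [h1 /andP [h2 sw']] /=.
  rewrite -[s](nth_index t (wL _ sw')) -[X in _ == X](nth_index t tL); apply/eqP; congr nth.
  by apply/eqP; rewrite eqn_leq h1 leqNgt.
have sz : (N <= size w3)%N.
  apply: leq_trans ct _; rewrite /w3 /w2 -filter_predI size_filter; apply: sub_count => s /eqP -> /=.
  by rewrite ltnSn ltnn.
have wn n : wprod Z (nseq n t) = Z t ^+ n.
  by elim: n => [|n IH]; rewrite ?wprod_nil ?expr0 //= wprod_cons IH exprS.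
move/all_pred1P: e3 => ->; rewrite !wprod_cat wn -(subnKC sz) exprD -(mulrA (Z t ^+ N)) mulrA.
exact: KM (hZ tL).
Qed.
End LongWords.

Section FiniteCodimension.
Variables (symp : bool) (A : algType C) (X : label -> label -> A).
Hypothesis hX : forall k, relX symp k X.
Variable k : nat.
Hypothesis k2 : (1 < k)%N.
Local Notation Z := (nil_letter symp X).

Lemma nil_letter_lspan t : below2 k t -> lspan (fun z => exists2 s, below2 k s & z = Xp X s) (Z t).
Proof.
case: t => a b /andP /= [ak bk].
have L c e : below k c -> below k e -> lspan (fun z => exists2 s, below2 k s & z = Xp X s) (X c e).
  by move=> ck ek; apply: lspan_sub; exists (c, e); rewrite // /below2 /= ck.
have ok : below k (true, other a.2) by rewrite /below /other /=; case: ifP => // _; apply: ltnW.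
case: ifP => _; first case: ifP => _.
- exact: L.
- by rewrite mulr2n; do ! apply: lspanD; apply: L.
case: ifP => _; last exact: L.
by apply: lspanD; [apply: lspanD; [apply: lspanN|apply: lspanB]|]; apply: L.
Qed.

Lemma lspan_nil_letter t : below2 k t -> lspan (fun z => exists2 s, below2 k s & z = Z s) (Xp X t).
Proof.
case: t => a b /andP /= [ak bk]; rewrite /Xp /=.
have L c e : below k c -> below k e -> lspan (fun z => exists2 s, below2 k s & z = Z s) (Z (c, e)).
  by move=> ck ek; apply: lspan_sub; exists (c, e); rewrite // /below2 /= ck.
have half (u : A) : u = 2%:R^-1 *: (u *+ 2) by rewrite -scaler_nat scalerA mulVf ?pnatr_eq0 // scale1r.
have /orP [sp|sp] : symp || ~~ symp by case: symp.
  have Laa c : below k c -> lspan (fun z => exists2 s, below2 k s & z = Z s) (X c c).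
    by move=> ck; have := L c c ck ck; rewrite /nil_letter sp eqxx.
  case: (eqVneq a b) => [<-|ab]; first exact: Laa.
  have e1 : eps symp = -1 by rewrite sp epsT.
  rewrite (hX k).1 // e1 opprK scale1r [X b a]half; apply: lspanZ.
  rewrite (_ : _ *+ 2 = Z (a, b) - X a a - X b b).
    by do 2 (apply: lspanB; last exact: Laa); apply: L.
  by rewrite /nil_letter sp (negPf ab) addrAC addrK addrAC addrN add0r.
have so : symp = false by apply/negbTE.
have Lo c e : below k c -> below k e -> e != star c -> lspan (fun z => exists2 s, below2 k s & z = Z s) (X c e).
  by move=> ck ek ec; have := L c e ck ek; rewrite /nil_letter so (negPf ec).
case: (eqVneq b (star a)) => [->|]; last exact: Lo.
wlog: a ak {b bk} / a.1 => [th|at_].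
  case: (boolP a.1) => [|af]; first exact: th.
  have -> : X a (star a) = - X (star a) (star (star a)).
    by rewrite starK (hX k).1 // so epsF scaleN1r.
  by apply: lspanN; apply: th.
set c := (true, other a.2).
have ck : below k c by rewrite /c /below /other /=; case: ifP => // _; apply: ltnW.
have ca : c.2 != a.2 by rewrite /c /other /=; case: (a.2) => [|[|]].
rewrite [X a _]half; apply: lspanZ.
rewrite (_ : _ *+ 2 = (Z (a, star a) + X a (star c) - X c (star a)) - (Z (star a, a) + X (star a) (star c) - X c a)); last first.
  rewrite /nil_letter so starK !eqxx -/c [X (star a) a](hX k).1 // so epsF scaleN1r.
  rewrite mulr2n /= -/c.
  set p := X a (star a); set q := X c (star c).
  have cancel (u v r : A) : - u + v + r + u - r = v by rewrite (addrAC _ r u) addrK addrAC addNr add0r.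
  by rewrite !cancel opprD !opprK addrACA addNr addr0.
apply: lspanB; apply: lspanB; try apply: lspanD; try (by apply: L);
  apply: Lo => //; apply/eqP => /(congr1 snd) /= h; case/eqP: ca; rewrite /c /=; lia.
Qed.

Lemma nil_letter_bracket s t : below2 k s -> below2 k t ->
  lspan (fun z => exists2 r, below2 k r & z = Z r) (Z s * Z t - Z t * Z s).
Proof.
move=> hs ht; apply: (lspan_bind (S := fun z => exists2 s, below2 k s & z = Xp X s)).
  by move=> _ [r hr ->]; apply: lspan_nil_letter.
elim: (nil_letter_lspan hs) => [|a u v [s' hs' ->] _ IH].
  by rewrite mul0r mulr0 subrr; apply: lspan0.
rewrite mulrDl mulrDr opprD addrACA; apply: lspanD IH.
rewrite -scalerAl -(scalerAr a (Z t)) -scalerBr; apply: lspanZ.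
elim: (nil_letter_lspan ht) => [|b u' v' [t' ht' ->] _ IH'].
  by rewrite mul0r mulr0 subrr; apply: lspan0.
rewrite mulrDl mulrDr opprD addrACA; apply: lspanD IH'.
rewrite -scalerAr -(scalerAl b _ (Xp X s')) -scalerBr; apply: lspanZ.
exact: (@Xp_bracket _ _ _ _ (hX k) s' t').
Qed.

Lemma finite_codim (K : A -> Prop) N : subspace K -> (forall u v z, K z -> K (u * z * v)) ->
  (forall t, below2 k t -> K (Z t ^+ N)) ->
  exists s : seq A, forall u, inU k X u -> exists2 z, lspan (fun y => y \in s) z & K (u - z).
Proof.
move=> hK KM KZ; pose L := allpairs pair (lbs k) (lbs k).
have memL t : (t \in L) = below2 k t.
  apply/allpairsP/andP => [[[x y] /= [+ + ->]]|[h1 h2]]; first by rewrite !mem_lbs.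
  by exists t; rewrite !mem_lbs -surjective_pairing.
have uL : uniq L by apply: allpairs_uniq; rewrite ?uniq_lbs // => -[? ?] [? ?] _ _ [-> ->].
exists [seq wprod Z w | w <- short_words L (size L * N)] => u hu.
have gu : gsub (fun z => exists2 t, below2 k t & z = Z t) u.
  apply: gsub_bind hu => _ [t ht ->]; apply: gsub_lspan (lspan_nil_letter (t := t) ht) => _ [s hs ->].
  by apply: gsub_sub; exists s.
elim: (pbw_sorted (index^~ L) nil_letter_bracket gu) => [|a x y [w [hw srt ->]] _ [z hz Kz]].
  by exists 0; [exact: lspan0|rewrite subrr; case: hK].
have wL : {subset w <= L} by move=> t tw; rewrite memL (allP hw).
case: (leqP (size w) (size L * N)) => sw.
  exists (a *: wprod Z w + z); last by rewrite opprD addrACA subrr add0r.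
  apply: lspan_cons hz; apply: map_f; exact: mem_short_words.
exists z => //; rewrite -addrA; case: hK => K0 KP; apply: KP => //.
by apply: (@long_word _ _ Z L K N) => // t; rewrite memL; apply: KZ.
Qed.
End FiniteCodimension.

(** * A module of functionals *)

(* Zorn: a maximal subspace containing [K] and avoiding [x] is a hyperplane. *)
Lemma separating_functional (V : lmodType C) (K : V -> Prop) x : K 0 ->
  (forall a u v, K u -> K v -> K (a *: u + v)) -> ~ K x ->
  exists f : V -> C, [/\ forall a u v, f (a *: u + v) = a * f u + f v, forall z, K z -> f z = 0 & f x = 1].
Proof.
move=> K0 KP nKx; pose W (S : set V) := lspan (fun z => K z \/ S z).
have [F FP tot|S [nSx maxS]] := @Zorn_bigcup V (fun S => ~ W S x).
  have dich z : W (bigcup F id) z -> K z \/ exists2 S, F S & W S z.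
    elim=> [|a u v hu _ IHv]; first by left.
    have Wle S S' y : (S `<=` S')%classic -> W S y -> W S' y.
      by move=> SS'; apply: lspan_mono => w [h|/SS']; [left|right].
    case: hu IHv => [Ku|[S FS Su]] [Kv|[S' FS' Wv]].
    - by left; apply: KP.
    - by right; exists S' => //; apply: lspan_cons Wv; left.
    - right; exists S => //; apply: lspan_cons; first by right.
      by apply: lspan_sub; left.
    - have [SS|SS] := tot _ _ FS FS'.
        by right; exists S' => //; apply: lspan_cons Wv; right; apply: SS.
      by right; exists S => //; apply: lspan_cons; [right|apply: Wle Wv].
  by case/dich => // -[S FS]; apply: FP FS.
have /choice [f hf] : forall y, exists c, W S (y - c *: x).
  move=> y; case: (pselect (W S y)) => hy; first by exists 0; rewrite scale0r subr0.
  have h : W (S `|` [set y])%classic x.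
    apply: contrapT; apply: maxS; split; first by move=> z Sz; left.
    by move=> h; apply: hy; apply: lspan_sub; right; apply: h; right.
  have dich z : W (S `|` [set y])%classic z -> exists c, W S (z - c *: y).
    elim=> [|a u v hu _ [c hc]]; first by exists 0; rewrite scale0r subr0; apply: lspan0.
    case: hu => [Ku|[Su|->]].
    - by exists c; rewrite -addrA; apply: lspan_cons hc; left.
    - by exists c; rewrite -addrA; apply: lspan_cons hc; right.
    - by exists (a + c); rewrite scalerDl opprD addrACA subrr add0r.
  have [c hc] := dich x h; exists c^-1.
  have c0 : c != 0 by apply/eqP => c0; apply: nSx; move: hc; rewrite c0 scale0r subr0.
  have := lspanZ (- c^-1) hc; rewrite scalerBr !scaleNr opprK scalerA mulVf // scale1r addrC.
  by [].
have uniq y c c' : W S (y - c *: x) -> W S (y - c' *: x) -> c = c'.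
  move=> h h'; apply/eqP; rewrite -subr_eq0; apply/eqP; apply: contrapT => /eqP cc; apply: nSx.
  have := lspanZ (c - c')^-1 (lspanB h' h).
  rewrite (_ : y - c' *: x - _ = (c - c') *: x); last by rewrite opprB addrC addrA subrK scalerBl.
  by rewrite scalerA mulVf // scale1r.
exists f; split=> [a u v|z Kz|].
- apply: (uniq (a *: u + v)) => //; rewrite scalerDl opprD addrACA -scalerA -scalerBr.
  by apply: lspanP; apply: hf.
- by apply: (uniq z) => //; rewrite scale0r subr0; apply: lspan_sub; left.
- by apply: (uniq x) => //; rewrite scale1r subrr; apply: lspan0.
Qed.

Lemma lspan_in_span (V : lmodType C) (s : seq V) v : lspan (fun z => z \in s) v -> in_span s v.
Proof.
elim=> [|a x y xs _ [c ->]]; first by exists (fun=> 0); rewrite big1 // => i _; rewrite scale0r.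
exists (fun i => (if i == index x s then a else 0) + c i).
under [RHS]eq_bigr do rewrite scalerDl; rewrite big_split /=; congr (_ + _).
have xi : (index x s < size s)%N by rewrite index_mem.
rewrite (bigD1 (Ordinal xi)) //= eqxx nth_index // big1 ?addr0 // => i ix.
by rewrite ifN ?scale0r //; apply: contra ix => /eqP e; apply/eqP/val_inj.
Qed.

Section SmoothFunctionals.
Variables (A : algType C) (K : nat -> A -> Prop).

Definition smooth_pred : {pred (A -> C^o)} := fun f =>
  `[< (forall a u v, f (a *: u + v) = a * f u + f v) /\ exists N, forall z, K N z -> f z = 0 >].

Hypothesis Kle : forall N N' z, (N <= N')%N -> K N' z -> K N z.

Lemma smooth_closed : GRing.submod_closed smooth_pred.
Proof.
split=> [|b f g]; rewrite ?unfold_in /smooth_pred.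
  by apply/asboolP; split=> [a u v|]; [rewrite /= mulr0 addr0|exists 0%N].
move=> /asboolP [fl [N fN]] /asboolP [gl [N' gN]]; apply/asboolP; split=> [a u v|].
  by rewrite !fctE fl gl; rewrite /GRing.scale /=; ring.
exists (maxn N N') => z Kz; rewrite !fctE fN ?gN ?scaler0 ?addr0 //.
  by apply: Kle Kz; apply: leq_maxr.
by apply: Kle Kz; apply: leq_maxl.
Qed.
HB.instance Definition _ := GRing.isSubmodClosed.Build C (A -> C^o) smooth_pred smooth_closed.

Definition smooth := {f : A -> C^o | smooth_pred f}.
HB.instance Definition _ := SubType.on smooth.
HB.instance Definition _ := [Choice of smooth by <:].
HB.instance Definition _ := [SubChoice_isSubLmodule of smooth by <:].

Hypothesis KM : forall N u z v, K N z -> K N (u * z * v).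

Lemma smooth_act (u : A) (f : smooth) : smooth_pred (fun a => val f (a * u)).
Proof.
have /asboolP [fl [N fN]] := valP f; apply/asboolP; split=> [a v w|].
  by rewrite mulrDl -scalerAl fl.
by exists N => z Kz; rewrite fN // -[z]mul1r; apply: KM.
Qed.

Definition act (u : A) (f : smooth) : smooth := Sub (fun a => val f (a * u)) (smooth_act u f).

Lemma actE u f a : val (act u f) a = val f (a * u).
Proof. by rewrite /act SubK. Qed.

Lemma smooth_lin (f : smooth) a u v : val f (a *: u + v) = a * val f u + val f v.
Proof. by have /asboolP [fl _] := valP f; apply: fl. Qed.

Lemma smooth_ext (f g : smooth) : (forall a, val f a = val g a) -> f = g.
Proof. by move=> e; apply: val_inj; apply/funext. Qed.

Lemma smooth_valP a (f g : smooth) u : val (a *: f + g) u = a * val f u + val g u.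
Proof. by []. Qed.

Lemma act_module : is_module act.
Proof.
split=> [a u v f|a u f g|f|u v f]; apply: smooth_ext => b.
- by rewrite smooth_valP !actE mulrDr -scalerAr smooth_lin.
- by rewrite smooth_valP !actE smooth_valP.
- by rewrite actE mulr1.
- by rewrite !actE mulrA.
Qed.

Variable I : A -> Prop.
Hypothesis Ksub : forall N, subspace (K N).
Hypothesis IK : forall N z, I z -> K N z.
Hypothesis KI : forall z, ~ I z -> exists N, ~ K N z.
Hypothesis IM : forall u z, I z -> I (u * z).
Hypothesis Kfin : forall N (s : seq A), exists t : seq A, forall u, gsub (fun x => x \in s) u ->
  exists2 z, lspan (fun y => y \in t) z & K N (u - z).

Lemma smooth_integrable : integrable_ideal I.
Proof.
exists smooth, act; split; first exact: act_module.
  move=> s f; have /asboolP [_ [N fN]] := valP f; have [t ht] := Kfin N s.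
  exists [seq act z f | z <- t] => u /gen_subalgE /ht [z hz Kz]; apply: lspan_in_span.
  have -> : act u f = act z f.
    apply: smooth_ext => a; rewrite !actE.
    have := fN (a * (u - z)); rewrite mulrBr -scaleN1r addrC smooth_lin mulN1r => h.
    apply/eqP; rewrite -subr_eq0 addrC h //.
    by rewrite scaleN1r addrC -mulrBr -[_ * _]mulr1; apply: KM.
  elim: hz => [|c x y xt _ IH].
    suff -> : act 0 f = 0 by apply: lspan0.
    apply: smooth_ext => a; rewrite actE mulr0.
    have := smooth_lin f 0 0 0; rewrite scaler0 addr0 mul0r add0r => _.
    by have := smooth_lin f (-1) 0 0; rewrite scaler0 addr0 mulN1r addNr => ->.
  case: act_module => [h _ _ _]; rewrite h; apply: lspan_cons IH.
  by apply: map_f.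
move=> x; split=> [Ix f|h].
  have /asboolP [_ [N fN]] := valP f; apply: smooth_ext => a; rewrite actE fN //.
  by apply: IK; apply: IM.
apply: contrapT => /KI [N nK]; have [K0 KP] := Ksub N.
have [f [fl fK fx]] := separating_functional K0 KP nK.
have sf : smooth_pred (f : A -> C^o) by apply/asboolP; split=> //; exists N.
have /(congr1 val) /(congr1 (fun g => g 1)) := h (Sub (f : A -> C^o) sf).
rewrite actE SubK mul1r fx => /eqP; rewrite oner_eq0 => //.
Qed.
End SmoothFunctionals.

Section Filtration.
Variables (symp : bool) (A : algType C) (X : label -> label -> A).
Hypothesis hX : forall k, relX symp k X.
Hypothesis psi_ex : forall f, injective f -> exists phi : A -> A, forall k, along X k f phi.
Hypothesis X_gen : forall x, exists k, inU k X x.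
Variable I : A -> Prop.
Hypothesis hI : two_sided_ideal I.
Hypothesis hloc : forall m x, inU m X x -> ~ I x -> exists J,
  [/\ fincodim_ideal (inU m X) J, ~ J x & forall u, inU m X u -> I u -> J u].
Local Notation Z := (nil_letter symp X).

Definition filtration (N : nat) := lspan (fun z => I z \/ exists t u v, z = u * Z t ^+ N * v).

Lemma filtration_le N N' z : (N <= N')%N -> filtration N' z -> filtration N z.
Proof.
move=> NN; apply: lspan_mono => w [Iw|[t [u [v ->]]]]; first by left.
by right; exists t, u, (Z t ^+ (N' - N) * v); rewrite -{1}(subnKC NN) exprD !mulrA.
Qed.

Lemma filtrationM N u z v : filtration N z -> filtration N (u * z * v).
Proof.
elim=> [|a x y hx _ IH]; first by rewrite mulr0 mul0r; apply: lspan0.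
rewrite mulrDr mulrDl -(scalerAr a u) -(scalerAl a _ v); apply: lspan_cons IH.
case: hx => [Ix|[t [u' [v' ->]]]]; last by right; exists t, (u * u'), (v' * v); rewrite !mulrA.
by left; case: hI => _ _ IM; apply: (IM _ _ _).2; apply: (IM _ _ _).1.
Qed.

Lemma filtration_finite N (s : seq A) : exists t : seq A, forall u, gsub (fun x => x \in s) u ->
  exists2 z, lspan (fun y => y \in t) z & filtration N (u - z).
Proof.
have [k [k2 sk]] : exists k, (1 < k)%N /\ forall x, x \in s -> inU k X x.
  elim: s => [|x s [k [k2 IH]]]; first by exists 2%N.
  have [m hm] := X_gen x; exists (maxn k m); split; first by rewrite leq_max k2.
  move=> y; rewrite inE => /orP [/eqP ->|/IH h].
    by apply: inU_le hm; apply: leq_maxr.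
  by apply: inU_le h; apply: leq_maxl.
have [|||t ht] := @finite_codim symp A X hX k k2 (filtration N) N.
- by split=> [|a u v]; [apply: lspan0|apply: lspanP].
- by move=> u v z; apply: filtrationM.
- move=> t _; apply: lspan_sub; right; exists t, 1, 1; by rewrite mul1r mulr1.
by exists t => u hu; apply: ht; apply: gsub_bind hu => x /sk.
Qed.

Lemma filtration_bounded N x : filtration N x -> exists k,
  lspan (fun z => (I z /\ inU k X z) \/ exists t u v, [/\ below2 k t, inU k X u, inU k X v & z = u * Z t ^+ N * v]) x.
Proof.
have mono k k' z : (k <= k')%N ->
  lspan (fun z => (I z /\ inU k X z) \/ exists t u v, [/\ below2 k t, inU k X u, inU k X v & z = u * Z t ^+ N * v]) z ->
  lspan (fun z => (I z /\ inU k' X z) \/ exists t u v, [/\ below2 k' t, inU k' X u, inU k' X v & z = u * Z t ^+ N * v]) z.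
  move=> kk; apply: lspan_mono => w [[Iw hw]|[t [u [v [ht hu hv ->]]]]].
    by left; split=> //; apply: inU_le hw.
  right; exists t, u, v; split=> //; try exact: inU_le kk _.
  exact: below2_le ht.
elim=> [|a y z hy _ [k hk]]; first by exists 0%N; apply: lspan0.
case: hy => [Iy|[t [u [v ->]]]].
  have [m hm] := X_gen y; exists (maxn k m); apply: lspan_cons; last by apply: mono hk; apply: leq_maxl.
  by left; split=> //; apply: inU_le hm; apply: leq_maxr.
have [m hm] := X_gen u; have [p hp] := X_gen v.
pose q := maxn (maxn k (maxn m p)) (maxn t.1.2 t.2.2).+1.
exists q; apply: lspan_cons; last by apply: mono hk; rewrite /q; lia.
right; exists t, u, v; split=> //.
- by rewrite /below2 /below /q; apply/andP; split; lia.
- by apply: inU_le hm; rewrite /q; lia.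
- by apply: inU_le hp; rewrite /q; lia.
Qed.

Lemma filtration_separates x : ~ I x -> exists N, ~ filtration N x.
Proof.
move=> nIx; have [n0 hn0] := X_gen x; pose n := maxn n0 2.
have n2 : (1 < n)%N by rewrite /n; lia.
have hn : inU n X x by apply: inU_le hn0; apply: leq_maxl.
have [d hd] : exists d, lspan (fun z => exists w, [/\ all (below2 n) w, (size w <= d)%N & z = wprod (Xp X) w]) x.
  elim: ((gsub_words (Xp X) (below2 n) x).1 hn) => [|a y z [w hw ->] _ [d hd]]; first by exists 0%N; apply: lspan0.
  exists (maxn (size w) d); apply: lspan_cons; first by exists w; rewrite leq_maxl.
  by apply: lspan_mono hd => _ [v [hv sv ->]]; exists v; split=> //; rewrite leq_max sv orbT.
have [N hN] := limit_functionals hX psi_ex hI hloc n2 hd nIx.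
exists N.+1 => /filtration_bounded [k hk].
have [|f [lam [hf fI fN [w0 [w1 [h0 h1 /eqP nz]]]]]] := hN (k + 6)%N; first by lia.
apply: nz; set m := (n + _ + (k + 6))%N in hf fI fN h0 h1.
have km : (k <= m)%N by rewrite /m; lia.
have m6 : (5 < m)%N by rewrite /m; lia.
have m2 : (1 < m)%N by apply: leq_trans m6.
pose Ker z := inU m X z /\ forall u v, inU m X u -> inU m X v -> f (u * z * v) = 0.
have KerS : subspace Ker.
  split; first by split=> [|u v _ _]; [apply: gsub0|rewrite mulr0 mul0r (hwf0 hf)].
  move=> a y z [Uy hy] [Uz hz]; split=> [|u v hu hv]; first exact: gsubP.
  rewrite mulrDr mulrDl -(scalerAr a u) -(scalerAl a _ v) (hwf_lin hf) ?hy ?hz ?mulr0 ?addr0 //; gsub_closed.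
have Kad a b z : (a.2 < m)%N -> (b.2 < m)%N -> Ker z -> Ker (X a b * z - z * X a b).
  move=> am bm [Uz hz]; have UX := inU_X X am bm; split=> [|u v hu hv]; first by gsub_closed.
  rewrite mulrBr mulrBl (hwfB hf); [|by gsub_closed|by gsub_closed].
  rewrite mulrA (mulrA u z) -[u * z * X a b * v]mulrA !hz ?subrr //; gsub_closed.
have Klow : Ker (Xp X (low_letter symp m) ^+ N.+1).
  have /andP [b1 b2] : below2 m (low_letter symp m) by apply: below2_low; apply: leq_trans m6.
  have Ul : inU m X (Xp X (low_letter symp m)) by apply: inU_X.
  split=> [|u v hu hv]; first by gsub_closed.
  by rewrite exprSr mulrA -(mulrA (u * _)); apply: fN => //; gsub_closed.
have Knil t : below2 m t -> Ker (Z t ^+ N.+1).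
  move=> ht; apply: (nil_letter_power hX m6 KerS Kad _ _ ht) Klow => //.
    by apply: below2_low; apply: leq_trans m6.
  by rewrite /low_letter; case: (symp) => //=; lia.
have [] : f (w0 * x * w1) = 0 /\ inU m X x; last by [].
apply: (lspan_ind_lin (P := fun z => f (w0 * z * w1) = 0 /\ inU m X z)) hk.
- by rewrite mulr0 mul0r (hwf0 hf); split=> //; apply: gsub0.
- move=> a y z [hy Uy] [hz Uz]; split; last exact: gsubP.
  rewrite mulrDr mulrDl -(scalerAr a w0) -(scalerAl a _ w1) (hwf_lin hf) ?hy ?hz ?mulr0 ?addr0 //; gsub_closed.
move=> z [[Iz hz]|[t [u [v [ht hu hv ->]]]]].
  have Uz := inU_le km hz; split=> //; apply: fI; first by gsub_closed.
  by case: hI => _ _ IM; apply: (IM _ _ _).2; apply: (IM _ _ _).1.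
have Uu := inU_le km hu; have Uv := inU_le km hv.
have [UZ hZ] := Knil t (below2_le km ht).
split; last by gsub_closed.
rewrite (_ : w0 * _ * w1 = w0 * u * Z t ^+ N.+1 * (v * w1)); last by rewrite !mulrA.
by apply: hZ; gsub_closed.
Qed.

Lemma locally_integrable_integrable : integrable_ideal I.
Proof.
apply: (smooth_integrable filtration_le filtrationM).
- by move=> N; split=> [|a u v]; [apply: lspan0|apply: lspanP].
- by move=> N z Iz; apply: lspan_sub; left.
- exact: filtration_separates.
- by case: hI => _ _ IM u z Iz; apply: (IM _ _ _).1.
- exact: filtration_finite.
Qed.
End Filtration.

Theorem theorem4p1 (symp : bool) (A : algType C)
    (iota : forall n : nat, 'M[C]_(n + n) -> A) :
  is_univ_env symp iota ->
  forall I : A -> Prop,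
    two_sided_ideal I ->
    locally_integrable symp iota I ->
    integrable_ideal I.
Proof.
move=> Hu I hI hl.
apply: (@locally_integrable_integrable symp A (Xg symp iota)) => //.
- by move=> k; apply: relX_Xg.
- by move=> f /(psi_exists Hu) [phi [hphi e]]; exists phi => k; split=> // a b _ _.
- exact: Xg_gen.
move=> m x; have UE : Usub symp iota m = inU m (Xg symp iota).
  by apply/funext => u; apply/propext; apply: UsubE.
rewrite -UE => Ux nIx; have [Fam [hF hE]] := hl m.
have [J FJ nJx] : exists2 J, Fam J & ~ J x.
  apply: contrapT => h; apply: nIx; apply: ((hE x).2 _).2; split=> // J FJ.
  by apply: contrapT => nJ; apply: h; exists J.
exists J; split=> //; first exact: hF.
by move=> u Uu Iu; apply: ((hE u).1 _).2.
Qed.
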